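(* The duality $\lambda\mapsto\lambda'$ induces an involution on the set of all (A)-solutions in $\mathcal{D}^-$. Moreover, let $\lambda=(p,q,r;a,b;x)\in\mathcal{D}^-$ be an (A)-solution with gamma product formula $$f(w;\lambda)=C\cdot d^{w}\cdot\frac{\prod_{i=0}^{r-1}\Gamma\left(w+\frac{i}{r}\right)}{\prod_{i=1}^{r}\Gamma(w+v_i)},$$ and let $v_1^*,\dots,v_r^*$ be the numbers complementary to $v_1,\dots,v_r$. Then the dual solution $\lambda'$ has the gamma product formula $$f(w;\lambda')=C'\cdot d^{w}\cdot\frac{\prod_{i=0}^{r-1}\Gamma\left(w+\frac{i}{r}\right)}{\prod_{i=1}^{r}\Gamma(w+v_i')},\qquad v_i':=1-\frac{2}{r}-v_i^*\quad(i=1,\dots,r),$$ where $C'$ is a positive constant and $d$ is the same number as for $\lambda$, namely $$d=\frac{r^r}{\sqrt{p^p q^q (r-p)^{r-p}(r-q)^{r-q}x^r(1-x)^{p+q-r}}}.$$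
   Context: A data is a tuple $\lambda=(p,q,r;a,b;x)$, and $f(w;\lambda):={}_2F_1(pw+a,\,qw+b;\,rw;\,x)$ (Gauss hypergeometric series), a meromorphic function of $w\in\mathbb{C}$. Problem I asks for $\lambda$ such that, for some $C,d\in\mathbb{C}^\times$, $m,n\in\mathbb{Z}_{\ge0}$ and $u_1,\dots,u_m,v_1,\dots,v_n\in\mathbb{C}$, one has a gamma product formula $f(w;\lambda)=C\,d^w\,\Gamma(w+u_1)\cdots\Gamma(w+u_m)/(\Gamma(w+v_1)\cdots\Gamma(w+v_n))$. Problem II asks for $\lambda$ such that $f(w+1;\lambda)/f(w;\lambda)$ is a rational function of $w$. $\mathcal{D}^-:=\{\lambda\in\mathbb{R}^6: p>0,\ q>0,\ r>0,\ p+q<r;\ a,b\in\mathbb{R};\ 0<x<1\}$. On $\mathcal{D}^-$ Problems I and II are known (earlier work) to be equivalent, and a solution means a solution to either one. An (A)-solution in $\mathcal{D}^-$ is a solution $\lambda\in\mathcal{D}^-$ with $p,q,r\in\mathbb{Z}$ and $r-p-q$ even. Known fact (earlier work) used to set up notation: every (A)-solution $\lambda\in\mathcal{D}^-$ has a gamma product formula of the displayed form, where $C>0$, $d$ is the number displayed in the claim, $v_1+\cdots+v_r=\frac{r-1}{2}$, and, in $\mathbb{C}[w]$, $\prod_{i=1}^r(w+v_i)$ divides $$\prod_{i=1}^{p-1}\left(w+\tfrac{i+a}{p}\right)\prod_{i=1}^{q-1}\left(w+\tfrac{i+b}{q}\right)\prod_{j=0}^{r-p-1}\left(w+\tfrac{j-a}{r-p}\right)\prod_{j=0}^{r-q-1}\left(w+\tfrac{j-b}{r-q}\right).$$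 The complementary numbers $v_1^*,\dots,v_r^*$ are defined (up to order) by $$\prod_{i=1}^r(w+v_i)\prod_{i=1}^r(w+v_i^* )=\prod_{i=0}^{p-1}\left(w+\tfrac{i+a}{p}\right)\prod_{i=0}^{q-1}\left(w+\tfrac{i+b}{q}\right)\prod_{j=0}^{r-p-1}\left(w+\tfrac{j-a}{r-p}\right)\prod_{j=0}^{r-q-1}\left(w+\tfrac{j-b}{r-q}\right).$$ Duality: $\lambda=(p,q,r;a,b;x)\mapsto\lambda'=(p,q,r;a',b';x)$ with $a':=1-\frac{2p}{r}-a$, $b':=1-\frac{2q}{r}-b$. *)

(* Defs.v *)
From Stdlib Require Import Reals ZArith.
From Coquelicot Require Import Coquelicot.

Open Scope R_scope.

(** * Complex special functions on Coquelicot's [C] *)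

Definition Cexp (z : C) : C := (exp (Re z) * cos (Im z), exp (Re z) * sin (Im z)).

(* The product of [f i] over [0 <= i < n]. *)
Fixpoint Cprod (f : nat -> C) (n : nat) : C :=
  match n with
  | O => RtoC 1
  | S k => (Cprod f k * f k)%C
  end.

(* Limits and series in C are taken componentwise. *)
Definition CLim_seq (u : nat -> C) : C :=
  (real (Lim_seq (fun n => Re (u n))), real (Lim_seq (fun n => Im (u n)))).

Definition CSeries (u : nat -> C) : C :=
  (Series (fun n => Re (u n)), Series (fun n => Im (u n))).

Definition nonpos_int (z : C) : Prop := exists k : nat, z = RtoC (- INR k).

(* The entire function 1/Gamma, by Gauss's limit
   1/Gamma(z) = lim z (z+1) ... (z+n) / (n! n^z). *)
Definition Crgamma (z : C) : C :=
  CLim_seq (fun n =>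
    (Cprod (fun k => z + RtoC (INR k)) (S n)
       / (RtoC (INR (fact n)) * Cexp (z * RtoC (ln (INR n)))))%C).

(* Meaningful off the poles, i.e. when [~ nonpos_int z]. *)
Definition Cgamma (z : C) : C := (/ Crgamma z)%C.

Definition Cpoch (z : C) (n : nat) : C := Cprod (fun k => (z + RtoC (INR k))%C) n.

(* Meaningful when [~ nonpos_int c] and [Cmod z < 1]. *)
Definition hyp2F1 (a b c z : C) : C :=
  CSeries (fun n =>
    (Cpoch a n * Cpoch b n / (Cpoch c n * RtoC (INR (fact n))) * z ^ n)%C).

(** * Data, Problems I and II, and solutions *)

Record data : Type := Data {
  dp : R; dq : R; dr : R;
  da : R; db : R;
  dx : R
}.

Definition hgf (lam : data) (w : C) : C :=
  hyp2F1 (RtoC (dp lam) * w + RtoC (da lam))%C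
         (RtoC (dq lam) * w + RtoC (db lam))%C
         (RtoC (dr lam) * w)%C
         (RtoC (dx lam)).

(* Where the series defining [hgf lam w] makes sense; for [0 < dr lam] the
   excluded set is discrete, so an identity between meromorphic functions is
   the same as a pointwise identity on regular points. *)
Definition regular (lam : data) (w : C) : Prop :=
  ~ nonpos_int (RtoC (dr lam) * w)%C.

(* f(w; lam) = A e^(delta w) prod_(i<m) Gamma(w + u_i) / prod_(i<n) Gamma(w + v_i)
   as meromorphic functions of w; 1/Gamma is used in the denominator since it
   has no poles. *)
Definition gamma_product_formula (lam : data) (A delta : C)
    (m : nat) (u : nat -> C) (n : nat) (v : nat -> C) : Prop :=
  forall w : C,
    regular lam w ->
    (forall i, (i < m)%nat -> ~ nonpos_int (w + u i)%C) ->
    hgf lam w =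
      (A * Cexp (w * delta)
         * Cprod (fun i => Cgamma (w + u i)) m
         * Cprod (fun i => Crgamma (w + v i)) n)%C.

(* d^w is exp(w log d), for any choice of the logarithm of d. *)
Definition problem_I (lam : data) : Prop :=
  exists (A d log_d : C) (m n : nat) (u v : nat -> C),
    A <> RtoC 0 /\ d <> RtoC 0 /\ Cexp log_d = d /\
    gamma_product_formula lam A log_d m u n v.

Definition Cpoly (c : nat -> C) (N : nat) (w : C) : C :=
  sum_n (fun k => (c k * w ^ k)%C) N.

Definition problem_II (lam : data) : Prop :=
  exists (P Q : nat -> C) (M N : nat),
    (exists k, (k <= N)%nat /\ Q k <> RtoC 0) /\
    forall w : C,
      regular lam w -> regular lam (w + 1)%C ->
      hgf lam w <> RtoC 0 -> Cpoly Q N w <> RtoC 0 ->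
      (hgf lam (w + 1) / hgf lam w)%C = (Cpoly P M w / Cpoly Q N w)%C.

Definition Dminus (lam : data) : Prop :=
  0 < dp lam /\ 0 < dq lam /\ 0 < dr lam /\ dp lam + dq lam < dr lam /\
  0 < dx lam < 1.

Definition solution_in_Dminus (lam : data) : Prop :=
  Dminus lam /\ (problem_I lam \/ problem_II lam).

Definition A_solution (lam : data) : Prop :=
  solution_in_Dminus lam /\
  exists p q r : Z,
    dp lam = IZR p /\ dq lam = IZR q /\ dr lam = IZR r /\ Z.Even (r - p - q).

(** * Duality *)

Definition dual (lam : data) : data :=
  Data (dp lam) (dq lam) (dr lam)
       (1 - 2 * dp lam / dr lam - da lam)
       (1 - 2 * dq lam / dr lam - db lam)
       (dx lam).

(* All bases are positive on [Dminus]. *)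
Definition dilation (lam : data) : R :=
  let p := dp lam in let q := dq lam in let r := dr lam in let x := dx lam in
  Rpower r r /
  sqrt (Rpower p p * Rpower q q * Rpower (r - p) (r - p) * Rpower (r - q) (r - q)
        * Rpower x r * Rpower (1 - x) (p + q - r)).

(* f(w; lam) = A d^w prod_(i<r) Gamma(w + i/r) / prod_(i<r) Gamma(w + v_i),
   meant for [dr lam = INR r] and [0 < d]. *)
Definition special_gpf (lam : data) (r : nat) (A d : R) (v : nat -> C) : Prop :=
  gamma_product_formula lam (RtoC A) (RtoC (ln d))
    r (fun i => RtoC (INR i / INR r)) r v.

Definition complementary_numbers (p q r : nat) (a b : R) (v vstar : nat -> C) : Prop :=
  forall w : C,
    (Cprod (fun i => w + v i) r * Cprod (fun i => w + vstar i) r)%C =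
    (Cprod (fun i => w + RtoC ((INR i + a) / INR p)) p
     * Cprod (fun i => w + RtoC ((INR i + b) / INR q)) q
     * Cprod (fun j => w + RtoC ((INR j - a) / INR (r - p))) (r - p)
     * Cprod (fun j => w + RtoC ((INR j - b) / INR (r - q))) (r - q))%C.

(* Main.v *)
Require Import Defs.
From Stdlib Require Import Reals ZArith.
From Coquelicot Require Import Coquelicot.
From Stdlib Require Import Lra Lia Psatz Classical FunctionalExtensionality.

(* Contiguity gives f(w+1) = R(w) f(w) + S(w) g(w) with R, S rational and g the
   Euler derivative of f. If f(w+1)/f(w) is rational and S is not 0, then g/f is
   rational; but g/f is asymptotic to c w with c > 0 at +oo (the terms of the
   series peak near a multiple of w), while it is positive just to the right of
   suitable poles tending to -oo. Hence S = 0. The other local solution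
   x^(1-c) (1-x)^(c-a-b) 2F1(1-a,1-b;2-c;x) obeys the same contiguity relations,
   and at (a,b,c) = (pw+a,qw+b,rw) its hypergeometric factor is
   f(2/r-w; lambda'). So S = 0 yields a first-order recurrence for the dual, whose
   coefficient is computed from that of lambda. The asymptotics
   f(n+w)/f(n) -> phi^w, with phi depending only on (p,q,r;x), then turn the
   recurrence into the gamma product formula; comparing the two recurrences gives
   d = phi and phi^2 = dilation^2. *)

(** * Limits and series of complex numbers *)

(** Up to a constant, the denominator of the contiguity relation is the product of all [w + v_i] and
    all [w + vstar_i]. Cancelling the known recurrence leaves the diagonal matrix entry proportional
    to the product of the [w + vstar_i]. The second local solution has lower parameter
    [2 - r w = r (2/r - w)], so the shift runs backwards in the dual variable. Under
    [w = 2/r - 1 - w'] each [w + vstar_i] becomes minus [w' + (1 - 2/r - vstar_i)], and the entry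
    passes from numerator to denominator. Each of the [s = r - p - q] steps that raise only [c]
    contributes a sign, and the parity of [s] removes it. The growth rate [phi] is never evaluated
    in closed form. The recurrence of the given solution has rate [d], that of the dual has rate
    [dilation^2 / d], and both equal [phi]; hence the square root in the formula for [d]. The values
    of [hgf] have a meaning only at regular points, and Problem II says nothing at zeros of [f]. The
    vanishing argument therefore samples [f] at large natural numbers, where all terms are positive,
    and just to the right of poles. *)

Definition Cconv (u : nat -> C) (l : C) : Prop :=
  is_lim_seq (fun n => Re (u n)) (Re l) /\ is_lim_seq (fun n => Im (u n)) (Im l).

Definition is_Cseries (u : nat -> C) (s : C) : Prop :=
  is_series (fun n => Re (u n)) (Re s) /\ is_series (fun n => Im (u n)) (Im s).

Lemma Re_plus (z w : C) : Re (z + w)%C = Re z + Re w.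
Proof. reflexivity. Qed.

Lemma Im_plus (z w : C) : Im (z + w)%C = Im z + Im w.
Proof. reflexivity. Qed.

Lemma Re_mult (z w : C) : Re (z * w)%C = Re z * Re w - Im z * Im w.
Proof. reflexivity. Qed.

Lemma Im_mult (z w : C) : Im (z * w)%C = Re z * Im w + Im z * Re w.
Proof. reflexivity. Qed.

Lemma C_ext (z w : C) : Re z = Re w -> Im z = Im w -> z = w.
Proof. destruct z, w; simpl; intros; subst; reflexivity. Qed.

Lemma Cmod_le_Re_Im (z : C) : Cmod z <= Rabs (Re z) + Rabs (Im z).
Proof.
  destruct z as [a b]; simpl.
  replace ((a, b) : C) with ((a, 0) + (0, b))%C
    by (apply C_ext; simpl; ring).
  eapply Rle_trans; [apply Cmod_triangle|].
  unfold Cmod; simpl.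
  replace (a * (a * 1) + 0 * (0 * 1)) with (Rsqr a) by (unfold Rsqr; ring).
  replace (0 * (0 * 1) + b * (b * 1)) with (Rsqr b) by (unfold Rsqr; ring).
  rewrite !sqrt_Rsqr_abs; lra.
Qed.

Lemma Im_le_Cmod (z : C) : Rabs (Im z) <= Cmod z.
Proof. eapply Rle_trans; [apply Rmax_r|apply Rmax_Cmod]. Qed.

Lemma Cmod_triangle_inv (z w : C) : Cmod z - Cmod w <= Cmod (z + w).
Proof.
  assert (H := Cmod_triangle (z + w) (- w)).
  rewrite Cmod_opp in H.
  replace (z + w + - w)%C with z in H by ring. lra.
Qed.

(** Estimates are made in modulus, whereas [CLim_seq] is componentwise; this joins the two. *)
Lemma Cconv_Cmod (u : nat -> C) (l : C) :
  Cconv u l <-> is_lim_seq (fun n => Cmod (u n - l)) 0.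
Proof.
  split.
  - intros [H1 H2].
    apply is_lim_seq_le_le with (u := fun _ => 0)
      (w := fun n => Rabs (Re (u n) - Re l) + Rabs (Im (u n) - Im l)).
    + intros n; split; [apply Cmod_ge_0|apply Cmod_le_Re_Im].
    + apply is_lim_seq_const.
    + replace 0 with (Rabs (Re l - Re l) + Rabs (Im l - Im l))
        by (rewrite !Rminus_eq_0, Rabs_R0; ring).
      apply is_lim_seq_plus'.
      * apply (is_lim_seq_abs _ (Finite (Re l - Re l))), is_lim_seq_minus'; [exact H1|apply
          is_lim_seq_const].
      * apply (is_lim_seq_abs _ (Finite (Im l - Im l))), is_lim_seq_minus'; [exact H2|apply
          is_lim_seq_const].
  - intros H; split.
    + apply is_lim_seq_ext with (fun n => (Re (u n) - Re l) + Re l); [intros; ring|].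
      replace (Finite (Re l)) with (Finite (0 + Re l)) by (f_equal; ring).
      apply is_lim_seq_plus'; [|apply is_lim_seq_const].
      apply is_lim_seq_abs_0.
      apply is_lim_seq_le_le with (u := fun _ => 0) (w := fun n => Cmod (u n - l)).
      * intros n; split; [apply Rabs_pos|apply (re_le_Cmod (u n - l)%C)].
      * apply is_lim_seq_const.
      * exact H.
    + apply is_lim_seq_ext with (fun n => (Im (u n) - Im l) + Im l); [intros; ring|].
      replace (Finite (Im l)) with (Finite (0 + Im l)) by (f_equal; ring).
      apply is_lim_seq_plus'; [|apply is_lim_seq_const].
      apply is_lim_seq_abs_0.
      apply is_lim_seq_le_le with (u := fun _ => 0) (w := fun n => Cmod (u n - l)).
      * intros n; split; [apply Rabs_pos|apply (Im_le_Cmod (u n - l)%C)].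
      * apply is_lim_seq_const.
      * exact H.
Qed.

Lemma Cconv_le (u : nat -> C) (l : C) (e : nat -> R) :
  eventually (fun n => Cmod (u n - l) <= e n) -> is_lim_seq e 0 -> Cconv u l.
Proof.
  intros H He. apply Cconv_Cmod.
  apply is_lim_seq_le_le_loc with (u := fun _ => 0) (w := e).
  - destruct H as [N HN]; exists N; intros n Hn.
    split; [apply Cmod_ge_0|apply HN; exact Hn].
  - apply is_lim_seq_const.
  - exact He.
Qed.

Lemma Cconv_ext_loc (u v : nat -> C) (l : C) :
  eventually (fun n => u n = v n) -> Cconv u l -> Cconv v l.
Proof.
  intros [N HN] [H1 H2]; split.
  - eapply is_lim_seq_ext_loc; [|exact H1]; exists N; intros n Hn; simpl; rewrite HN; auto.
  - eapply is_lim_seq_ext_loc; [|exact H2]; exists N; intros n Hn; simpl; rewrite HN; auto.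
Qed.

Lemma Cconv_ext (u v : nat -> C) (l : C) :
  (forall n, u n = v n) -> Cconv u l -> Cconv v l.
Proof. intros H; apply Cconv_ext_loc; exists 0%nat; auto. Qed.

Lemma Cconv_const (c : C) : Cconv (fun _ => c) c.
Proof. split; apply is_lim_seq_const. Qed.

Lemma Cconv_unique (u : nat -> C) (l m : C) : Cconv u l -> Cconv u m -> l = m.
Proof.
  intros [H1 H2] [H3 H4].
  apply is_lim_seq_unique in H1, H2, H3, H4.
  apply C_ext.
  - rewrite H1 in H3; injection H3; auto.
  - rewrite H2 in H4; injection H4; auto.
Qed.

Lemma Cconv_plus (u v : nat -> C) (l m : C) :
  Cconv u l -> Cconv v m -> Cconv (fun n => u n + v n)%C (l + m)%C.
Proof. intros [H1 H2] [H3 H4]; split; apply is_lim_seq_plus'; assumption. Qed.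

Lemma Cconv_mult (u v : nat -> C) (l m : C) :
  Cconv u l -> Cconv v m -> Cconv (fun n => u n * v n)%C (l * m)%C.
Proof.
  intros [H1 H2] [H3 H4]; split.
  - apply is_lim_seq_minus'; apply is_lim_seq_mult'; assumption.
  - apply is_lim_seq_plus'; apply is_lim_seq_mult'; assumption.
Qed.

Lemma Cconv_inv (u : nat -> C) (l : C) :
  l <> 0 -> Cconv u l -> Cconv (fun n => / u n)%C (/ l)%C.
Proof.
  intros Hl [H1 H2].
  assert (Hd : Re l ^ 2 + Im l ^ 2 <> 0).
  { rewrite <- Cmod2_alt. apply pow_nonzero.
    intro H; apply Hl, Cmod_eq_0, H. }
  assert (HD : is_lim_seq (fun n => Re (u n) ^ 2 + Im (u n) ^ 2) (Re l ^ 2 + Im l ^ 2)).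
  { simpl; apply is_lim_seq_plus'; repeat apply is_lim_seq_mult'; auto;
      apply is_lim_seq_const. }
  split; apply is_lim_seq_div'; auto.
  apply (is_lim_seq_opp _ (Finite (Im l))); auto.
Qed.

Lemma Cconv_RtoC (u : nat -> R) (l : R) :
  is_lim_seq u l -> Cconv (fun n => RtoC (u n)) (RtoC l).
Proof. split; [exact H|apply is_lim_seq_const]. Qed.

Lemma Cconv_incr_n (u : nat -> C) (l : C) (N : nat) :
  Cconv u l -> Cconv (fun n => u (n + N)%nat) l.
Proof. intros [H1 H2]; split; [apply (is_lim_seq_incr_n (fun n => Re (u n)))
  |apply (is_lim_seq_incr_n (fun n => Im (u n)))]; assumption. Qed.

Lemma CLim_seq_unique (u : nat -> C) (l : C) : Cconv u l -> CLim_seq u = l.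
Proof.
  intros [H1 H2]. unfold CLim_seq.
  rewrite (is_lim_seq_unique _ _ H1), (is_lim_seq_unique _ _ H2).
  apply C_ext; reflexivity.
Qed.

Lemma Cconv_cauchy (u : nat -> C) :
  (forall eps : posreal, exists N, forall n, (N <= n)%nat -> Cmod (u n - u N) < eps) ->
  exists l, Cconv u l.
Proof.
  intros H.
  (* Any 1-Lipschitz real function of the sequence is a real Cauchy sequence; it is applied to [Re]
     and [Im]. *)
  assert (HC : forall (f : C -> R), (forall z w, Rabs (f z - f w) <= Cmod (z - w)) ->
             ex_finite_lim_seq (fun n => f (u n))).
  { intros f Hf. apply ex_lim_seq_cauchy_corr. intros eps.
    destruct (H (pos_div_2 eps)) as [N HN]. exists N. intros n m Hn Hm.
    assert (H1 := HN n Hn); assert (H2 := HN m Hm). simpl in H1, H2.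
    replace (f (u n) - f (u m)) with ((f (u n) - f (u N)) - (f (u m) - f (u N))) by ring.
    eapply Rle_lt_trans; [apply Rabs_triang|]. rewrite Rabs_Ropp.
    assert (H3 := Hf (u n) (u N)); assert (H4 := Hf (u m) (u N)). lra. }
  destruct (HC Re) as [l1 Hl1]; [intros z w; exact (re_le_Cmod (z - w))|].
  destruct (HC Im) as [l2 Hl2]; [intros z w; exact (Im_le_Cmod (z - w))|].
  exists (l1, l2); split; assumption.
Qed.

Lemma CSeries_unique (u : nat -> C) (s : C) : is_Cseries u s -> CSeries u = s.
Proof.
  intros [H1 H2]. unfold CSeries.
  rewrite (is_series_unique _ _ H1), (is_series_unique _ _ H2).
  apply C_ext; reflexivity.
Qed.

Lemma is_Cseries_unique (u : nat -> C) (s t : C) :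
  is_Cseries u s -> is_Cseries u t -> s = t.
Proof. intros H1 H2; apply CSeries_unique in H1, H2; congruence. Qed.

Lemma is_Cseries_ext (u v : nat -> C) (s : C) :
  (forall n, u n = v n) -> is_Cseries u s -> is_Cseries v s.
Proof. intros H; replace v with u; [auto|]. now apply functional_extensionality. Qed.

Lemma is_Cseries_plus (u v : nat -> C) (s t : C) :
  is_Cseries u s -> is_Cseries v t -> is_Cseries (fun n => u n + v n)%C (s + t)%C.
Proof.
  intros [H1 H2] [H3 H4]; split.
  - exact (is_series_plus _ _ _ _ H1 H3).
  - exact (is_series_plus _ _ _ _ H2 H4).
Qed.

Lemma is_Cseries_scal (c : C) (u : nat -> C) (s : C) :
  is_Cseries u s -> is_Cseries (fun n => c * u n)%C (c * s)%C.
Proof.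
  intros [H1 H2]; split.
  - exact (is_series_minus _ _ _ _ (is_series_scal (Re c) _ _ H1) (is_series_scal (Im c) _ _ H2)).
  - exact (is_series_plus _ _ _ _ (is_series_scal (Re c) _ _ H2) (is_series_scal (Im c) _ _ H1)).
Qed.

Lemma is_Cseries_minus (u v : nat -> C) (s t : C) :
  is_Cseries u s -> is_Cseries v t -> is_Cseries (fun n => u n - v n)%C (s - t)%C.
Proof.
  intros [H1 H2] [H3 H4]; split.
  - exact (is_series_minus _ _ _ _ H1 H3).
  - exact (is_series_minus _ _ _ _ H2 H4).
Qed.

Lemma is_Cseries_shift (u : nat -> C) (s : C) :
  u 0%nat = 0 -> is_Cseries u s -> is_Cseries (fun n => u (S n)) s.
Proof.
  intros H0 [H1 H2]; split.
  - apply (is_series_incr_1 (fun n => Re (u n))). rewrite H0; simpl.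
    unfold plus; simpl. rewrite Rplus_0_r. exact H1.
  - apply (is_series_incr_1 (fun n => Im (u n))). rewrite H0; simpl.
    unfold plus; simpl. rewrite Rplus_0_r. exact H2.
Qed.

Lemma is_Cseries_RtoC (u : nat -> R) (s : R) :
  is_series u s -> is_Cseries (fun n => RtoC (u n)) (RtoC s).
Proof.
  intros H; split; [exact H|]. simpl.
  apply is_series_ext with (fun n => 0 * u n); [intros n; exact (Rmult_0_l (u n))|].
  assert (H0 := is_series_scal 0 _ _ H). change (scal 0 s) with (0 * s) in H0.
  rewrite Rmult_0_l in H0. exact H0.
Qed.

Lemma is_Cseries_summable (u : nat -> C) (M : nat -> R) :
  (forall n, Cmod (u n) <= M n) -> ex_series M -> is_Cseries u (CSeries u).
Proof.
  intros H HM; split; simpl; apply Series_correct, (ex_series_le (V := R_CompleteNormedModule))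
      with M; auto; intros n.
  - eapply Rle_trans; [apply (re_le_Cmod (u n))|apply H].
  - eapply Rle_trans; [apply (Im_le_Cmod (u n))|apply H].
Qed.

Lemma Series_abs_le (u M : nat -> R) (s m : R) :
  (forall n, Rabs (u n) <= M n) -> is_series u s -> is_series M m -> Rabs s <= m.
Proof.
  intros H Hs Hm.
  assert (Hu : ex_series (fun n => Rabs (u n))).
  { apply (ex_series_le (V := R_CompleteNormedModule)) with M; [|exists m; exact Hm].
    intros n; change (Rabs (Rabs (u n)) <= M n). rewrite Rabs_Rabsolu. apply H. }
  rewrite <- (is_series_unique _ _ Hs), <- (is_series_unique _ _ Hm).
  eapply Rle_trans; [apply Series_Rabs, Hu|].
  apply Series_le; [|exists m; exact Hm].
  intros n; split; [apply Rabs_pos|apply H].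
Qed.

(** The real and imaginary parts are bounded separately, whence the factor 2. *)
Lemma is_Cseries_Cmod_le (u : nat -> C) (M : nat -> R) (s : C) (m : R) :
  (forall n, Cmod (u n) <= M n) -> is_Cseries u s -> is_series M m -> Cmod s <= 2 * m.
Proof.
  intros H [H1 H2] Hm.
  eapply Rle_trans; [apply Cmod_le_Re_Im|].
  assert (Rabs (Re s) <= m).
  { eapply Series_abs_le; [|exact H1|exact Hm].
    intros n; eapply Rle_trans; [apply re_le_Cmod|apply H]. }
  assert (Rabs (Im s) <= m).
  { eapply Series_abs_le; [|exact H2|exact Hm].
    intros n; eapply Rle_trans; [apply Im_le_Cmod|apply H]. }
  lra.
Qed.

Lemma is_lim_seq_inv_INR : is_lim_seq (fun n => / INR n) 0.
Proof.
  replace (Finite 0) with (Rbar_inv p_infty) by reflexivity.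
  apply is_lim_seq_inv; [apply is_lim_seq_INR|discriminate].
Qed.

Lemma eventually_INR_gt (M : R) : eventually (fun n => M < INR n).
Proof.
  assert (H := is_lim_seq_INR). apply is_lim_seq_spec in H. exact (H M).
Qed.

(** * The complex exponential and Gauss's product *)

Lemma Cexp_plus (z w : C) : Cexp (z + w) = (Cexp z * Cexp w)%C.
Proof.
  unfold Cexp. rewrite Re_plus, Im_plus, exp_plus, cos_plus, sin_plus.
  apply C_ext; simpl; ring.
Qed.

Lemma Cexp_0 : Cexp 0 = 1.
Proof. unfold Cexp; simpl. rewrite exp_0, cos_0, sin_0. apply C_ext; simpl; ring. Qed.

Lemma Cmod_Cexp (z : C) : Cmod (Cexp z) = exp (Re z).
Proof.
  unfold Cmod, Cexp; simpl fst; simpl snd.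
  replace ((exp (Re z) * cos (Im z)) ^ 2 + (exp (Re z) * sin (Im z)) ^ 2)
    with (Rsqr (exp (Re z)) * (Rsqr (sin (Im z)) + Rsqr (cos (Im z))))
    by (unfold Rsqr; ring).
  rewrite sin2_cos2, Rmult_1_r, sqrt_Rsqr; [reflexivity|apply Rlt_le, exp_pos].
Qed.

Lemma Cexp_neq_0 (z : C) : Cexp z <> 0.
Proof.
  intro H. assert (E := Cmod_Cexp z). rewrite H, Cmod_0 in E.
  generalize (exp_pos (Re z)); lra.
Qed.

Lemma Cexp_opp (z : C) : Cexp (- z) = (/ Cexp z)%C.
Proof.
  assert (H : (Cexp (- z) * Cexp z)%C = 1).
  { rewrite <- Cexp_plus. replace (- z + z)%C with (RtoC 0) by ring. apply Cexp_0. }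
  replace (Cexp (- z)) with (Cexp (- z) * Cexp z * / Cexp z)%C.
  - rewrite H; ring.
  - field; apply Cexp_neq_0.
Qed.

Lemma Cexp_RtoC (t : R) : Cexp (RtoC t) = RtoC (exp t).
Proof. unfold Cexp; simpl. rewrite cos_0, sin_0. apply C_ext; simpl; ring. Qed.

(** * Taylor bounds for the exponential and the trigonometric functions *)

(** The derivative has to be bounded on the segment between 0 and [a], whatever the sign of [a]. The
    disjunction is the form in which [exp t] is at most [1 + exp a] there. *)
Lemma mean_value_bound (f df : R -> R) (a K : R) :
  (forall t, is_derive f t (df t)) ->
  (forall t, t <= 0 \/ t <= a -> Rabs t <= Rabs a -> Rabs (df t) <= K) ->
  Rabs (f a - f 0) <= K * Rabs a.
Proof.
  intros Hf HK.
  destruct (MVT_gen f 0 a df) as [c [Hc E]].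
  - intros t _; apply Hf.
  - intros t _. apply derivable_continuous_pt. exists (df t). apply is_derive_Reals, Hf.
  - rewrite E, Rabs_mult, Rminus_0_r. apply Rmult_le_compat_r; [apply Rabs_pos|].
    unfold Rmin, Rmax in Hc. destruct (Rle_dec 0 a); apply HK; try lra;
      unfold Rabs; destruct (Rcase_abs c), (Rcase_abs a); lra.
Qed.

Lemma exp_le_1_plus (t a : R) : t <= 0 \/ t <= a -> exp t <= 1 + exp a.
Proof.
  intros [H|H].
  - assert (exp t <= exp 0) by (destruct H; [apply Rlt_le, exp_increasing|subst]; lra).
    rewrite exp_0 in H0. generalize (exp_pos a); lra.
  - assert (exp t <= exp a) by (destruct H; [apply Rlt_le, exp_increasing|subst]; lra).
    lra.
Qed.

Lemma exp_minus_1_le (a : R) : Rabs (exp a - 1) <= Rabs a * (1 + exp a).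
Proof.
  replace (exp a - 1) with (exp a - exp 0) by (rewrite exp_0; ring).
  rewrite (Rmult_comm (Rabs a)).
  apply mean_value_bound with exp.
  - intros t; apply is_derive_Reals, derivable_pt_lim_exp.
  - intros t Ht _. rewrite Rabs_pos_eq by (apply Rlt_le, exp_pos).
    apply exp_le_1_plus, Ht.
Qed.

Lemma exp_taylor2_le (a : R) : Rabs (exp a - 1 - a) <= a ^ 2 * (2 + exp a).
Proof.
  replace (a ^ 2 * (2 + exp a)) with ((Rabs a * (2 + exp a)) * Rabs a)
    by (rewrite <- (pow2_abs a); ring).
  replace (exp a - 1 - a) with ((exp a - a) - (exp 0 - 0)) by (rewrite exp_0; ring).
  apply (mean_value_bound (fun t => exp t - t) (fun t => exp t - 1)).
  - intros t. auto_derive; [trivial|ring].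
  - intros t Ht Hta. eapply Rle_trans; [apply exp_minus_1_le|].
    assert (H := exp_le_1_plus t a Ht). generalize (exp_pos t); intro.
    apply Rmult_le_compat; try lra; apply Rabs_pos.
Qed.

Lemma sin_abs_le (b : R) : Rabs (sin b) <= Rabs b.
Proof.
  replace (sin b) with (sin b - sin 0) by (rewrite sin_0; ring).
  replace (Rabs b) with (1 * Rabs (b - 0)) by (rewrite Rminus_0_r; ring).
  apply bounded_variation with cos. intros t _.
  split; [apply is_derive_Reals, derivable_pt_lim_sin|].
  apply Rabs_le, COS_bound.
Qed.

Lemma cos_minus_1_abs_le (b : R) : Rabs (cos b - 1) <= Rabs b.
Proof.
  replace (cos b - 1) with (cos b - cos 0) by (rewrite cos_0; ring).
  replace (Rabs b) with (1 * Rabs (b - 0)) by (rewrite Rminus_0_r; ring).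
  apply bounded_variation with (fun t => - sin t). intros t _.
  split; [apply is_derive_Reals, derivable_pt_lim_cos|].
  rewrite Rabs_Ropp. apply Rabs_le, SIN_bound.
Qed.

Lemma cos_taylor2_le (b : R) : Rabs (cos b - 1) <= b ^ 2.
Proof.
  replace (cos b - 1) with (- (2 * (sin (b / 2) * sin (b / 2)))).
  2:{ replace b with (2 * (b / 2)) at 3 by field. rewrite cos_2a_sin. ring. }
  rewrite Rabs_Ropp. rewrite Rabs_pos_eq by nra.
  assert (H := sin_abs_le (b / 2)).
  assert (sin (b / 2) * sin (b / 2) <= (b / 2) * (b / 2)).
  { apply Rsqr_le_abs_1 in H. exact H. }
  nra.
Qed.

Lemma sin_taylor2_le (b : R) : Rabs (sin b - b) <= b ^ 2.
Proof.
  replace (b ^ 2) with (Rabs b * Rabs (b - 0)) by (rewrite Rminus_0_r, <- (pow2_abs b); ring).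
  replace (sin b - b) with ((sin b - b) - (sin 0 - 0)) by (rewrite sin_0; ring).
  apply (bounded_variation (fun t => sin t - t)) with (fun t => cos t - 1).
  intros t Ht. split.
  { auto_derive; [trivial|ring]. }
  rewrite !Rminus_0_r in Ht.
  eapply Rle_trans; [apply cos_minus_1_abs_le|exact Ht].
Qed.

Lemma Cexp_minus_1_le (z : C) : Cmod (Cexp z - 1) <= Cmod z * (3 + exp (Re z)).
Proof.
  set (a := Re z). set (b := Im z).
  assert (Ha : Rabs a <= Cmod z) by apply re_le_Cmod.
  assert (Hb : Rabs b <= Cmod z) by apply Im_le_Cmod.
  assert (H : (Cexp z - 1)%C = (RtoC (exp a - 1)%R * (cos b, sin b) + ((cos b - 1)%R, sin b))%C).
  { unfold Cexp; fold a b. apply C_ext; simpl; ring. }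
  rewrite H. eapply Rle_trans; [apply Cmod_triangle|]. rewrite Cmod_mult, Cmod_R.
  assert (H1 : Cmod (cos b, sin b) = 1).
  { unfold Cmod; simpl fst; simpl snd.
    replace (cos b ^ 2 + sin b ^ 2) with (Rsqr (sin b) + Rsqr (cos b)) by (unfold Rsqr; ring).
    rewrite sin2_cos2. apply sqrt_1. }
  rewrite H1.
  assert (H2 := exp_minus_1_le a).
  assert (H3 := Cmod_le_Re_Im (cos b - 1, sin b)). simpl in H3.
  assert (H4 := cos_minus_1_abs_le b). assert (H5 := sin_abs_le b).
  generalize (exp_pos a); intro.
  assert (Rabs a * (1 + exp a) <= Cmod z * (1 + exp a)) by (apply Rmult_le_compat_r; lra).
  lra.
Qed.

(** The second order is needed because the factors of Euler's product must be [1 + O(1/s^2)] for the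
    product to converge. *)
Lemma Cexp_taylor2_le (z : C) :
  Cmod (Cexp z - 1 - z) <= Cmod z ^ 2 * (4 + 3 * exp (Re z)).
Proof.
  set (a := Re z). set (b := Im z).
  assert (Ha : Rabs a <= Cmod z) by apply re_le_Cmod.
  assert (Hb : Rabs b <= Cmod z) by apply Im_le_Cmod.
  generalize (exp_pos a) (Rabs_pos a) (Rabs_pos b) (Cmod_ge_0 z); intros He Ha0 Hb0 Hz.
  assert (Ha2 : a ^ 2 <= Cmod z ^ 2) by (rewrite <- (pow2_abs a); apply pow_incr; lra).
  assert (Hb2 : b ^ 2 <= Cmod z ^ 2) by (rewrite <- (pow2_abs b); apply pow_incr; lra).
  assert (Hab : Rabs a * Rabs b <= Cmod z ^ 2)
    by (replace (Cmod z ^ 2) with (Cmod z * Cmod z) by ring; apply Rmult_le_compat; lra).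
  eapply Rle_trans; [apply Cmod_le_Re_Im|].
  replace (Re (Cexp z - 1 - z)) with (exp a * (cos b - 1) + (exp a - 1 - a))
    by (change (Re (Cexp z - 1 - z)) with (exp a * cos b + - (1) + - a); ring).
  replace (Im (Cexp z - 1 - z)) with ((exp a - 1) * sin b + (sin b - b))
    by (change (Im (Cexp z - 1 - z)) with (exp a * sin b + - 0 + - b); ring).
  assert (H1 := Rabs_triang (exp a * (cos b - 1)) (exp a - 1 - a)).
  assert (H2 := Rabs_triang ((exp a - 1) * sin b) (sin b - b)).
  rewrite Rabs_mult in H1, H2. rewrite (Rabs_pos_eq (exp a)) in H1 by lra.
  assert (H3 := cos_taylor2_le b). assert (H4 := sin_taylor2_le b).
  assert (H5 := exp_taylor2_le a). assert (H6 := exp_minus_1_le a).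
  assert (H7 := sin_abs_le b).
  assert (exp a * Rabs (cos b - 1) <= exp a * Cmod z ^ 2) by (apply Rmult_le_compat_l; lra).
  assert (a ^ 2 * (2 + exp a) <= Cmod z ^ 2 * (2 + exp a)) by (apply Rmult_le_compat_r; lra).
  assert (Rabs (exp a - 1) * Rabs (sin b) <= (Rabs a * (1 + exp a)) * Rabs b)
    by (apply Rmult_le_compat; try apply Rabs_pos; assumption).
  assert ((Rabs a * (1 + exp a)) * Rabs b <= Cmod z ^ 2 * (1 + exp a)).
  { replace ((Rabs a * (1 + exp a)) * Rabs b) with ((Rabs a * Rabs b) * (1 + exp a)) by ring.
    apply Rmult_le_compat_r; lra. }
  lra.
Qed.

Lemma ln_le_minus_1 (y : R) : 0 < y -> ln y <= y - 1.
Proof.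
  intros Hy. assert (H := exp_ineq1_le (ln y)). rewrite exp_ln in H; lra.
Qed.

Lemma ln_1p_bounds (u : R) : 0 <= u -> 0 <= ln (1 + u) <= u /\ u - ln (1 + u) <= u ^ 2.
Proof.
  intros Hu.
  assert (H1 := ln_le_minus_1 (1 + u) ltac:(lra)).
  assert (Hi : 0 < / (1 + u)) by (apply Rinv_0_lt_compat; lra).
  assert (H2 := ln_le_minus_1 (/ (1 + u)) Hi).
  rewrite ln_Rinv in H2 by lra.
  assert (E : / (1 + u) * (1 + u) = 1) by (field; lra).
  split; [split|]; nra.
Qed.

(** * Euler's product for 1/Gamma, with uniform remainders *)

(** This is [(1 + z/s) (1 + 1/s)^(-z)], the factor of Euler's product for 1/Gamma. The power cancels
    the first-order term [z/s]. *)
Definition gauss_factor (z : C) (s : R) : C :=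
  ((1 + z / RtoC s) * Cexp (- z * RtoC (ln ((s + 1) / s))))%C.

Lemma gauss_factor_near_1 (z : C) :
  exists K, 0 <= K /\ forall s, 1 <= s -> Cmod (gauss_factor z s - 1) <= K / s ^ 2.
Proof.
  set (m := Cmod z). generalize (Cmod_ge_0 z); fold m; intro Hm.
  exists (m + m ^ 2 + (1 + m) * (m ^ 2 * (4 + 3 * exp m))).
  generalize (exp_pos m); intro Hem.
  assert (H0 : 0 <= m ^ 2 * (4 + 3 * exp m)) by (apply Rmult_le_pos; [apply pow2_ge_0|lra]).
  split; [generalize (pow2_ge_0 m); nra|].
  intros s Hs. set (u := / s).
  assert (Hu : 0 < u <= 1).
  { unfold u; split; [apply Rinv_0_lt_compat; lra|].
    rewrite <- Rinv_1. apply Rinv_le_contravar; lra. }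
  replace ((m + m ^ 2 + (1 + m) * (m ^ 2 * (4 + 3 * exp m))) / s ^ 2)
    with ((m + m ^ 2 + (1 + m) * (m ^ 2 * (4 + 3 * exp m))) * u ^ 2)
    by (unfold u; field; lra).
  unfold gauss_factor.
  replace ((s + 1) / s) with (1 + u) by (unfold u; field; lra).
  set (L := ln (1 + u)).
  destruct (ln_1p_bounds u) as [[HL0 HL1] HL2]; [lra|]. fold L in HL0, HL1, HL2.
  replace (z / RtoC s)%C with (z * RtoC u)%C.
  2:{ unfold u. rewrite RtoC_inv by lra. reflexivity. }
  set (ze := (- z * RtoC L)%C).
  assert (Hze : Cmod ze <= m * u).
  { unfold ze. rewrite Cmod_mult, Cmod_opp, Cmod_R, Rabs_pos_eq by lra. fold m.
    apply Rmult_le_compat_l; lra. }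
  set (rho := (Cexp ze - 1 - ze)%C).
  assert (Hmu : m * u <= m) by nra.
  assert (Hrho : Cmod rho <= m ^ 2 * (4 + 3 * exp m) * u ^ 2).
  { eapply Rle_trans; [apply Cexp_taylor2_le|].
    assert (exp (Re ze) <= exp m).
    { assert (Re ze <= m).
      { eapply Rle_trans; [apply Rle_abs|]. eapply Rle_trans; [apply re_le_Cmod|]. lra. }
      destruct H; [apply Rlt_le, exp_increasing|rewrite H]; lra. }
    assert (Cmod ze ^ 2 <= (m * u) ^ 2) by (apply pow_incr; split; [apply Cmod_ge_0|lra]).
    replace (m ^ 2 * (4 + 3 * exp m) * u ^ 2) with ((m * u) ^ 2 * (4 + 3 * exp m)) by ring.
    generalize (exp_pos (Re ze)); intro.
    apply Rmult_le_compat; try lra. apply pow2_ge_0. }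
  (* With [u = 1/s], [L = ln (1 + u)] and [ze = - z L], the first-order terms cancel up to
     [z (u - L)], and all three summands are of order [u^2]. *)
  replace ((1 + z * RtoC u) * Cexp ze - 1)%C
    with (z * RtoC (u - L) + z * RtoC u * ze + (1 + z * RtoC u) * rho)%C.
  2:{ unfold rho. rewrite RtoC_minus. unfold ze at 1 3. ring. }
  eapply Rle_trans; [apply Cmod_triangle|].
  eapply Rle_trans; [apply Rplus_le_compat_r, Cmod_triangle|].
  rewrite !Cmod_mult, !Cmod_R. fold m. rewrite (Rabs_pos_eq u), (Rabs_pos_eq (u - L)) by lra.
  assert (H1 : m * (u - L) <= m * u ^ 2) by (apply Rmult_le_compat_l; lra).
  assert (H2 : m * u * Cmod ze <= m ^ 2 * u ^ 2).
  { replace (m ^ 2 * u ^ 2) with (m * u * (m * u)) by ring.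
    apply Rmult_le_compat_l; [apply Rmult_le_pos; lra|lra]. }
  assert (H3 : Cmod (1 + z * RtoC u) <= 1 + m).
  { eapply Rle_trans; [apply Cmod_triangle|].
    rewrite Cmod_mult, Cmod_1, Cmod_R, Rabs_pos_eq by lra. fold m. lra. }
  assert (H4 : Cmod (1 + z * RtoC u) * Cmod rho <= (1 + m) * (m ^ 2 * (4 + 3 * exp m) * u ^ 2)).
  { apply Rmult_le_compat; try apply Cmod_ge_0; assumption. }
  lra.
Qed.

Lemma Cprod_ext (f g : nat -> C) (n : nat) :
  (forall i, (i < n)%nat -> f i = g i) -> Cprod f n = Cprod g n.
Proof.
  induction n as [|n IH]; intros H; simpl; [reflexivity|].
  rewrite IH by (intros; apply H; lia). rewrite H by lia. reflexivity.
Qed.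

Lemma Cprod_mult (f g : nat -> C) (n : nat) :
  Cprod (fun i => f i * g i)%C n = (Cprod f n * Cprod g n)%C.
Proof. induction n as [|n IH]; simpl; [ring|rewrite IH; ring]. Qed.

Lemma Cprod_const (c : C) (n : nat) : Cprod (fun _ => c) n = (c ^ n)%C.
Proof. induction n as [|n IH]; simpl; [reflexivity|rewrite IH; ring]. Qed.

Lemma Cprod_neq_0 (f : nat -> C) (n : nat) :
  (forall i, (i < n)%nat -> f i <> 0) -> Cprod f n <> 0.
Proof.
  induction n as [|n IH]; intros H; simpl.
  - exact C1_nz.
  - apply Cmult_neq_0; [apply IH; intros; apply H; lia|apply H; lia].
Qed.

Lemma Cprod_inv (f : nat -> C) (n : nat) :
  (forall i, (i < n)%nat -> f i <> 0) -> Cprod (fun i => / f i)%C n = (/ Cprod f n)%C.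
Proof.
  induction n as [|n IH]; intros H; simpl.
  - rewrite <- RtoC_inv by lra. f_equal; field.
  - rewrite IH by (intros; apply H; lia). field. split.
    + apply H; lia.
    + apply Cprod_neq_0. intros; apply H; lia.
Qed.

Lemma Cprod_add (f : nat -> C) (m n : nat) :
  Cprod f (m + n) = (Cprod f m * Cprod (fun i => f (m + i)%nat) n)%C.
Proof.
  induction n as [|n IH].
  - rewrite Nat.add_0_r; simpl; ring.
  - rewrite Nat.add_succ_r; simpl. rewrite IH; ring.
Qed.

Lemma Cprod_first (f : nat -> C) (n : nat) :
  Cprod f (S n) = (f 0%nat * Cprod (fun i => f (S i)) n)%C.
Proof. change (S n) with (1 + n)%nat. rewrite Cprod_add. simpl. ring. Qed.

Lemma Cprod_rev (f : nat -> C) (n : nat) :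
  Cprod (fun i => f (n - 1 - i)%nat) n = Cprod f n.
Proof.
  induction n as [|n IH]; [reflexivity|].
  rewrite Cprod_first. simpl Cprod at 2. rewrite <- IH.
  replace (S n - 1 - 0)%nat with n by lia.
  rewrite (Cprod_ext (fun i => f (S n - 1 - S i)%nat) (fun i => f (n - 1 - i)%nat)).
  - ring.
  - intros; f_equal; lia.
Qed.

Lemma Cconv_Cprod (u : nat -> nat -> C) (l : nat -> C) (m : nat) :
  (forall i, (i < m)%nat -> Cconv (fun n => u n i) (l i)) ->
  Cconv (fun n => Cprod (u n) m) (Cprod l m).
Proof.
  induction m as [|m IH]; intros H; simpl; [apply Cconv_const|].
  apply Cconv_mult; [apply IH; intros; apply H; lia|apply H; lia].
Qed.

Definition gauss_prod (z : C) (A : R) (k : nat) : C :=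
  Cprod (fun j => gauss_factor z (A + INR j)) k.

(** Uniform in the number [k] of factors. This serves twice: for the tails of Euler's product, and
    for the Pochhammer quotients in all terms of the hypergeometric series at once. *)
Lemma gauss_prod_near_1 (z : C) :
  exists K S, 0 <= K /\ 2 <= S /\
    forall A k, S <= A -> Cmod (gauss_prod z A k - 1) <= K / A.
Proof.
  destruct (gauss_factor_near_1 z) as [K [HK HF]].
  (* [A >= 2 + K] keeps the exponent [y] below 1, so that [exp y - 1 <= y (1 + exp y) <= 4 y]; and
     [y <= 2 K / A] because [A >= 2]. *)
  exists (8 * K), (2 + K). split; [lra|]. split; [lra|].
  intros A k HA.
  assert (Hi : forall j : nat, 0 <= INR j) by apply pos_INR.
  (* The sum of [K / s^2] is replaced by a telescoping majorant, [1 / s^2] being at most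
     [1 / (s - 1) - 1 / s]; each factor [1 + d] is then bounded by [exp d]. *)
  assert (H1 : Cmod (gauss_prod z A k - 1) <= exp (K * (/ (A - 1) - / (A + INR k - 1))) - 1).
  { induction k as [|k IH].
    - unfold gauss_prod; simpl. replace (1 - 1)%C with (RtoC 0) by ring. rewrite Cmod_0.
      rewrite Rplus_0_r, Rminus_eq_0, Rmult_0_r, exp_0. lra.
    - unfold gauss_prod in *; simpl Cprod.
      set (P := Cprod (fun j => gauss_factor z (A + INR j)) k) in *.
      set (f := gauss_factor z (A + INR k)).
      set (E := exp (K * (/ (A - 1) - / (A + INR k - 1)))) in *.
      specialize (Hi k).
      assert (Hf : Cmod (f - 1) <= K * (/ (A + INR k - 1) - / (A + INR (S k) - 1))).
      { eapply Rle_trans; [apply HF; lra|]. rewrite S_INR.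
        unfold Rdiv. apply Rmult_le_compat_l; [lra|].
        replace (A + (INR k + 1) - 1) with (A + INR k) by ring.
        set (s := A + INR k). assert (2 <= s) by (unfold s; lra).
        replace (/ (s - 1) - / s) with (/ ((s - 1) * s)) by (field; lra).
        apply Rinv_le_contravar; nra. }
      set (d := K * (/ (A + INR k - 1) - / (A + INR (S k) - 1))) in *.
      replace (K * (/ (A - 1) - / (A + INR (S k) - 1)))
        with (K * (/ (A - 1) - / (A + INR k - 1)) + d) by (unfold d; ring).
      rewrite exp_plus. fold E.
      assert (Hd := exp_ineq1_le d).
      assert (HE : 0 < E) by apply exp_pos.
      replace (P * f - 1)%C with ((P - 1) * (1 + (f - 1)) + (f - 1))%C by ring.
      eapply Rle_trans; [apply Cmod_triangle|]. rewrite Cmod_mult.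
      assert (H2 := Cmod_triangle 1 (f - 1)). rewrite Cmod_1 in H2.
      assert (H3 : Cmod (P - 1) * Cmod (1 + (f - 1)) <= (E - 1) * (1 + d)).
      { apply Rmult_le_compat; try apply Cmod_ge_0; lra. }
      assert (H4 : E * (1 + d) <= E * exp d) by (apply Rmult_le_compat_l; lra).
      lra. }
  eapply Rle_trans; [exact H1|].
  set (y := K * (/ (A - 1) - / (A + INR k - 1))).
  specialize (Hi k).
  assert (Hy : 0 <= y <= 2 * K / A).
  { unfold y. split.
    - apply Rmult_le_pos; [lra|].
      assert (/ (A + INR k - 1) <= / (A - 1)) by (apply Rinv_le_contravar; lra). lra.
    - replace (2 * K / A) with (K * (2 / A)) by (field; lra).
      apply Rmult_le_compat_l; [lra|].
      assert (0 < / (A + INR k - 1)) by (apply Rinv_0_lt_compat; lra).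
      assert (/ (A - 1) <= 2 / A); [|lra].
      replace (2 / A) with (/ (A / 2)) by (field; lra).
      apply Rinv_le_contravar; lra. }
  assert (Hy1 : 2 * K / A <= 2).
  { apply Rle_trans with (2 * A / A); [|right; field; lra].
    unfold Rdiv; apply Rmult_le_compat_r; [apply Rlt_le, Rinv_0_lt_compat|]; lra. }
  assert (y <= 1).
  { unfold y. apply Rle_trans with (K * / (A - 1)).
    - apply Rmult_le_compat_l; [lra|].
      assert (0 < / (A + INR k - 1)) by (apply Rinv_0_lt_compat; lra). lra.
    - apply Rle_trans with ((A - 1) * / (A - 1)); [|right; field; lra].
      apply Rmult_le_compat_r; [apply Rlt_le, Rinv_0_lt_compat|]; lra. }
  assert (He : exp y <= 3).
  { apply Rle_trans with (exp 1); [|apply exp_le_3].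
    destruct H; [apply Rlt_le, exp_increasing; assumption|rewrite H; lra]. }
  assert (H2 := exp_minus_1_le y). rewrite (Rabs_pos_eq y) in H2 by lra.
  assert (H3 := Rle_abs (exp y - 1)).
  assert (y * (1 + exp y) <= y * 4) by (apply Rmult_le_compat_l; lra).
  replace (8 * K / A) with (4 * (2 * K / A)) by (field; lra). lra.
Qed.

Lemma Cpoch_pos_neq_0 (A : R) (k : nat) : 0 < A -> Cpoch (RtoC A) k <> 0.
Proof.
  intros HA. apply Cprod_neq_0. intros i _ E.
  rewrite <- RtoC_plus in E. apply RtoC_inj in E. generalize (pos_INR i); lra.
Qed.

(** The exponentials telescope, so [(A + z)_k / (A)_k] is the power [((A + k) / A)^z] up to a factor
    [1 + O(1/A)]. This takes the place of Stirling's formula. *)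
Lemma gauss_prod_Cpoch (z : C) (A : R) (k : nat) :
  0 < A ->
  gauss_prod z A k =
  (Cpoch (RtoC A + z) k / Cpoch (RtoC A) k * Cexp (- z * RtoC (ln ((A + INR k) / A))))%C.
Proof.
  intros HA. induction k as [|k IH].
  - unfold gauss_prod, Cpoch; simpl.
    replace ((A + 0) / A) with 1 by (field; lra). rewrite ln_1.
    replace (- z * 0)%C with (RtoC 0) by ring. rewrite Cexp_0. field.
  - unfold gauss_prod in *; simpl Cprod; rewrite IH. unfold Cpoch; simpl Cprod.
    fold (Cpoch (RtoC A + z) k). fold (Cpoch (RtoC A) k).
    generalize (pos_INR k); intro Hk.
    assert (HP := Cpoch_pos_neq_0 A k HA).
    unfold gauss_factor.
    replace (- z * RtoC (ln ((A + INR (S k)) / A)))%C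
      with (- z * RtoC (ln ((A + INR k) / A)) + - z * RtoC (ln ((A + INR k + 1) / (A + INR k))))%C.
    + rewrite Cexp_plus, RtoC_plus. field. split; [|exact HP].
      rewrite <- RtoC_plus. intro E; apply RtoC_inj in E; lra.
    + rewrite <- Cmult_plus_distr_l, <- RtoC_plus, <- ln_mult.
      * do 3 f_equal. rewrite S_INR. field; lra.
      * apply Rdiv_lt_0_compat; lra.
      * apply Rdiv_lt_0_compat; lra.
Qed.

Lemma gauss_prod_add (z : C) (A : R) (m n : nat) :
  gauss_prod z A (m + n) = (gauss_prod z A m * gauss_prod z (A + INR m) n)%C.
Proof.
  unfold gauss_prod. rewrite Cprod_add. f_equal. apply Cprod_ext. intros i _.
  f_equal. rewrite plus_INR; ring.
Qed.

Lemma gauss_prod_tail (z : C) :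
  exists K N, 0 <= K /\ forall J k, (N <= J)%nat ->
    Cmod (gauss_prod z (1 + INR J) k - 1) <= K / INR J /\ 0 < INR J.
Proof.
  destruct (gauss_prod_near_1 z) as [K [S [HK [HS H]]]].
  destruct (eventually_INR_gt S) as [N HN].
  exists K, N. split; [exact HK|]. intros J k HJ. specialize (HN J HJ). split; [|lra].
  eapply Rle_trans; [apply H; lra|].
  apply Rmult_le_compat_l; [exact HK|]. apply Rinv_le_contravar; lra.
Qed.

(** A zero limit can only come from a zero factor: beyond [J0] the remaining product stays within
    1/2 of 1, hence away from 0. *)
Lemma gauss_prod_conv (z : C) :
  exists l, Cconv (gauss_prod z 1) l /\
    ((forall j, gauss_factor z (1 + INR j) <> 0) -> l <> 0).
Proof.
  destruct (gauss_prod_tail z) as [K [N [HK H]]].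
  destruct (eventually_INR_gt (2 * K)) as [N1 HN1].
  set (J0 := max N N1).
  assert (HJ0 : forall k, Cmod (gauss_prod z (1 + INR J0) k - 1) <= / 2).
  { intros k. destruct (H J0 k) as [H1 H2]; [unfold J0; lia|].
    eapply Rle_trans; [exact H1|].
    assert (2 * K < INR J0) by (apply HN1; unfold J0; lia).
    apply Rmult_le_reg_r with (INR J0); [lra|]. unfold Rdiv.
    rewrite Rmult_assoc, Rinv_l by lra. lra. }
  set (B := Cmod (gauss_prod z 1 J0)).
  assert (HB : forall n, (J0 <= n)%nat -> B / 2 <= Cmod (gauss_prod z 1 n) <= 2 * B).
  { intros n Hn. replace n with (J0 + (n - J0))%nat by lia.
    rewrite gauss_prod_add, Cmod_mult. fold B.
    specialize (HJ0 (n - J0)%nat). set (q := gauss_prod z (1 + INR J0) (n - J0)) in *.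
    assert (H1 := Cmod_triangle 1 (q - 1)). assert (H2 := Cmod_triangle_inv 1 (q - 1)).
    replace (1 + (q - 1))%C with q in H1, H2 by ring. rewrite Cmod_1 in H1, H2.
    assert (HB0 : 0 <= B) by apply Cmod_ge_0.
    split; nra. }
  destruct (Cconv_cauchy (gauss_prod z 1)) as [l Hl].
  { intros eps.
    destruct (eventually_INR_gt (2 * B * K / eps + 1)) as [N2 HN2].
    set (J := max J0 (max N N2)). exists J. intros n Hn.
    assert (HJ := HN2 J ltac:(unfold J; lia)).
    destruct (H J (n - J)%nat) as [H1 H2]; [unfold J; lia|].
    assert (H3 := proj2 (HB J ltac:(unfold J; lia))).
    replace n with (J + (n - J))%nat at 1 by lia.
    rewrite gauss_prod_add.
    replace (gauss_prod z 1 J * gauss_prod z (1 + INR J) (n - J) - gauss_prod z 1 J)%C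
      with (gauss_prod z 1 J * (gauss_prod z (1 + INR J) (n - J) - 1))%C by ring.
    rewrite Cmod_mult.
    destruct eps as [eps Heps]; simpl in *.
    assert (Cmod (gauss_prod z 1 J) * Cmod (gauss_prod z (1 + INR J) (n - J) - 1)
            <= 2 * B * (K / INR J)) by (apply Rmult_le_compat; try apply Cmod_ge_0; assumption).
    eapply Rle_lt_trans; [exact H0|].
    apply Rmult_lt_reg_r with (INR J); [exact H2|].
    replace (2 * B * (K / INR J) * INR J) with (2 * B * K / eps * eps) by (field; lra).
    rewrite (Rmult_comm eps). apply Rmult_lt_compat_r; [exact Heps|]. lra. }
  exists l. split; [exact Hl|]. intros Hnz El.
  assert (HBpos : 0 < B).
  { apply Cmod_gt_0. apply Cprod_neq_0. intros; apply Hnz. }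
  assert (Hc : eventually (fun n => Cmod (gauss_prod z 1 n - l) < B / 2)).
  { apply Cconv_Cmod in Hl. apply is_lim_seq_spec in Hl.
    assert (HB2 : 0 < B / 2) by lra.
    destruct (Hl (mkposreal _ HB2)) as [n0 Hn0]. exists n0; intros n Hn.
    specialize (Hn0 n Hn). simpl in Hn0. rewrite Rminus_0_r in Hn0.
    eapply Rle_lt_trans; [apply Rle_abs|exact Hn0]. }
  destruct Hc as [n0 Hn0].
  assert (H1 := Hn0 (max n0 J0) ltac:(lia)).
  assert (H2 := proj1 (HB (max n0 J0) ltac:(lia))).
  rewrite El in H1. replace (gauss_prod z 1 (max n0 J0) - 0)%C with (gauss_prod z 1 (max n0
      J0)) in H1 by ring.
  lra.
Qed.

Definition gauss_seq (z : C) (n : nat) : C :=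
  (Cprod (fun k => z + RtoC (INR k)) (S n)
       / (RtoC (INR (fact n)) * Cexp (z * RtoC (ln (INR n)))))%C.

Lemma Cprod_S (f : nat -> C) (n : nat) : Cprod f (S n) = (Cprod f n * f n)%C.
Proof. reflexivity. Qed.

Lemma Cpoch_1 (n : nat) : Cpoch 1 n = RtoC (INR (fact n)).
Proof.
  induction n as [|n IH]; [reflexivity|].
  unfold Cpoch in *; simpl Cprod. rewrite IH.
  change (fact (S n)) with (S n * fact n)%nat. rewrite mult_INR, RtoC_mult, S_INR, RtoC_plus.
  ring.
Qed.

Lemma INR_fact_C_neq_0 (n : nat) : RtoC (INR (fact n)) <> 0.
Proof. intro E; apply RtoC_inj in E; exact (INR_fact_neq_0 n E). Qed.

(** The product yields the power [(n + 1)^z] where Gauss's limit has [n^z]; the last factor is this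
    correction and tends to 1. *)
Lemma gauss_seq_prod (z : C) (n : nat) :
  (0 < n)%nat ->
  gauss_seq z n =
  (z * gauss_prod z 1 n * Cexp (z * RtoC (ln (1 + / INR n))))%C.
Proof.
  intros Hn. apply lt_0_INR in Hn. unfold gauss_seq.
  rewrite Cprod_first, gauss_prod_Cpoch by lra. rewrite Cpoch_1.
  replace ((1 + INR n) / 1) with (1 + INR n) by field.
  change (INR 0) with 0.
  replace (1 + / INR n) with ((1 + INR n) / INR n) by (field; lra).
  unfold Rdiv. rewrite ln_mult by (try apply Rinv_0_lt_compat; lra).
  rewrite ln_Rinv by lra.
  replace (z * RtoC (ln (1 + INR n) + - ln (INR n)))%C
    with (z * RtoC (ln (1 + INR n)) + - (z * RtoC (ln (INR n))))%C
    by (rewrite RtoC_plus, RtoC_opp; ring).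
  rewrite Cexp_plus, !Cexp_opp.
  replace (- z * RtoC (ln (1 + INR n)))%C with (- (z * RtoC (ln (1 + INR n))))%C by ring.
  rewrite Cexp_opp.
  unfold Cpoch.
  rewrite (Cprod_ext (fun i => z + RtoC (INR (S i)))%C (fun k => RtoC 1 + z + RtoC (INR k))%C).
  - field. repeat split; try apply Cexp_neq_0; apply INR_fact_C_neq_0.
  - intros i _. rewrite S_INR, RtoC_plus. ring.
Qed.

Lemma Cexp_small_conv (z : C) (e : nat -> R) :
  is_lim_seq e 0 -> Cconv (fun n => Cexp (z * RtoC (e n))) 1.
Proof.
  intros He.
  assert (Hc : forall f : R -> R, continuity_pt f 0 -> forall k : R,
     is_lim_seq (fun n => f (k * e n)) (f 0)).
  { intros f Hf k. apply is_lim_seq_continuous; [exact Hf|].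
    replace (Finite 0) with (Finite (k * 0)) by (f_equal; ring).
    apply is_lim_seq_mult'; [apply is_lim_seq_const|exact He]. }
  apply Cconv_ext with (fun n => (exp (Re z * e n) * cos (Im z * e n), exp (Re z * e n) * sin
      (Im z * e n))).
  { intros n. unfold Cexp. rewrite Re_mult, Im_mult; simpl.
    f_equal; (f_equal; f_equal; ring). }
  assert (H1 := Hc exp (derivable_continuous_pt _ _ (derivable_pt_exp 0)) (Re z)).
  assert (H2 := Hc cos (derivable_continuous_pt _ _ (derivable_pt_cos 0)) (Im z)).
  assert (H3 := Hc sin (derivable_continuous_pt _ _ (derivable_pt_sin 0)) (Im z)).
  rewrite exp_0 in H1. rewrite cos_0 in H2. rewrite sin_0 in H3.
  split; simpl.
  - replace (Finite 1) with (Finite (1 * 1)) by (f_equal; ring). apply is_lim_seq_mult'; auto.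
  - replace (Finite 0) with (Finite (1 * 0)) by (f_equal; ring). apply is_lim_seq_mult'; auto.
Qed.

Lemma is_lim_seq_ln_1p_inv : is_lim_seq (fun n => ln (1 + / INR n)) 0.
Proof.
  apply is_lim_seq_le_le_loc with (u := fun _ => 0) (w := fun n => / INR n).
  - exists 1%nat. intros n Hn. apply lt_0_INR, Rinv_0_lt_compat in Hn.
    apply ln_1p_bounds; lra.
  - apply is_lim_seq_const.
  - apply is_lim_seq_inv_INR.
Qed.

Lemma gauss_seq_conv_aux (z : C) :
  exists l, Cconv (gauss_seq z) (z * l) /\
    ((forall j, gauss_factor z (1 + INR j) <> 0) -> l <> 0).
Proof.
  destruct (gauss_prod_conv z) as [l [Hl Hnz]]. exists l. split; [|exact Hnz].
  apply Cconv_ext_loc with (fun n => z * gauss_prod z 1 n * Cexp (z * RtoC (ln (1 + / INR n))))%C.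
  { exists 1%nat. intros n Hn. symmetry. apply gauss_seq_prod; lia. }
  replace (z * l)%C with (z * l * 1)%C by ring.
  apply Cconv_mult; [apply Cconv_mult; [apply Cconv_const|exact Hl]|].
  apply Cexp_small_conv, is_lim_seq_ln_1p_inv.
Qed.

Lemma gauss_seq_conv (z : C) : Cconv (gauss_seq z) (Crgamma z).
Proof.
  destruct (gauss_seq_conv_aux z) as [l [Hl _]].
  replace (Crgamma z) with (z * l)%C; [exact Hl|].
  symmetry; apply CLim_seq_unique, Hl.
Qed.

Lemma Crgamma_neq_0 (z : C) : ~ nonpos_int z -> Crgamma z <> 0.
Proof.
  intros Hz. destruct (gauss_seq_conv_aux z) as [l [Hl Hnz]].
  rewrite <- (Cconv_unique _ _ _ Hl (gauss_seq_conv z)).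
  apply Cmult_neq_0.
  - intro E; apply Hz. exists 0%nat. rewrite E; simpl. f_equal; ring.
  (* The factor of index [j] vanishes only at [z = - (j + 1)]; the remaining zero of 1/Gamma, at
     [z = 0], is the factor [z] in front. *)
  - apply Hnz. intros j. unfold gauss_factor. apply Cmult_neq_0; [|apply Cexp_neq_0].
    intro E. apply Hz. exists (S j). rewrite S_INR.
    assert (Hj : RtoC (1 + INR j) <> 0).
    { intro E'; apply RtoC_inj in E'. generalize (pos_INR j); lra. }
    replace z with ((1 + z / RtoC (1 + INR j) - 1) * RtoC (1 + INR j))%C by (field; exact Hj).
    rewrite E. rewrite RtoC_opp, !RtoC_plus. ring.
Qed.

(** Already for finite [n] the two Gauss sequences differ by the factor [1 + (z + 1) / n], so the
    identity passes to the limit for every [z], the poles of Gamma included. *)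
Lemma Crgamma_succ (z : C) : Crgamma z = (z * Crgamma (z + 1))%C.
Proof.
  symmetry. apply Cconv_unique with (fun n => z * gauss_seq (z + 1) n)%C.
  - apply Cconv_mult; [apply Cconv_const|apply gauss_seq_conv].
  - apply Cconv_ext_loc with (fun n => gauss_seq z n * (1 + RtoC (/ INR n) * (z + 1)))%C.
    + exists 1%nat. intros n Hn. apply lt_0_INR in Hn. unfold gauss_seq.
      assert (Hn0 : RtoC (INR n) <> 0) by (intro E; apply RtoC_inj in E; lra).
      replace ((z + 1) * RtoC (ln (INR n)))%C with (z * RtoC (ln (INR n)) + RtoC (ln (INR
          n)))%C by ring.
      rewrite Cexp_plus, Cexp_RtoC, exp_ln by exact Hn.
      rewrite (Cprod_first (fun k => z + RtoC (INR k))%C).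
      rewrite (Cprod_S (fun k => z + 1 + RtoC (INR k))%C).
      rewrite (Cprod_ext (fun k => z + 1 + RtoC (INR k))%C (fun i => z + RtoC (INR (S i)))%C).
      * rewrite RtoC_inv by lra. change (INR 0) with 0.
        field. repeat split; try apply Cexp_neq_0; try exact Hn0; apply INR_fact_C_neq_0.
      * intros i _. rewrite S_INR, RtoC_plus. ring.
    + replace (Crgamma z) with (Crgamma z * (1 + RtoC 0 * (z + 1)))%C by ring.
      apply Cconv_mult; [apply gauss_seq_conv|].
      apply Cconv_plus; [apply Cconv_const|].
      apply Cconv_mult; [|apply Cconv_const].
      apply Cconv_RtoC, is_lim_seq_inv_INR.
Qed.

Lemma Cgamma_succ (z : C) : ~ nonpos_int z -> Cgamma (z + 1) = (z * Cgamma z)%C.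
Proof.
  intros Hz. unfold Cgamma.
  assert (H := Crgamma_neq_0 z Hz). rewrite (Crgamma_succ z) in *.
  field. split.
  - intro E; apply H; rewrite E; ring.
  - intro E; apply H; rewrite E; ring.
Qed.

Lemma nonpos_int_pred (z : C) : nonpos_int (z + 1)%C -> nonpos_int z.
Proof.
  intros [k E]. exists (S k). rewrite S_INR.
  replace z with (z + 1 - 1)%C by ring. rewrite E, !RtoC_opp, RtoC_plus. ring.
Qed.

Lemma nonpos_int_sub (z : C) (k : nat) : nonpos_int (z + RtoC (INR k))%C -> nonpos_int z.
Proof.
  induction k as [|k IH]; intros H.
  - simpl in H. replace (z + 0)%C with z in H by ring. exact H.
  - apply IH, nonpos_int_pred. rewrite S_INR, RtoC_plus in H.
    replace (z + RtoC (INR k) + 1)%C with (z + (RtoC (INR k) + 1))%C by ring. exact H.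
Qed.

Lemma nonpos_int_neq (z : C) (k : nat) : ~ nonpos_int z -> (z + RtoC (INR k))%C <> 0.
Proof.
  intros H E. apply H. exists k. rewrite RtoC_opp.
  replace z with (z + RtoC (INR k) - RtoC (INR k))%C by ring. rewrite E. ring.
Qed.

(** * Contiguity relations *)

Definition hterm (a b c : C) (x : R) (k : nat) : C :=
  (Cpoch a k * Cpoch b k / (Cpoch c k * RtoC (INR (fact k))) * RtoC x ^ k)%C.

(** The image of the series under the [m]-th power of the Euler operator [x d/dx]; when the terms
    are positive, the [m]-th moment of the summation index. Both readings are used. *)
Definition hmom (m : nat) (a b c : C) (x : R) : C :=
  CSeries (fun k => RtoC (INR k ^ m) * hterm a b c x k)%C.

Lemma hyp2F1_hmom (a b c : C) (x : R) : hyp2F1 a b c (RtoC x) = hmom 0 a b c x.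
Proof.
  unfold hyp2F1, hmom. f_equal. apply functional_extensionality. intros k.
  simpl. unfold hterm. ring.
Qed.

Lemma Cpoch_S (z : C) (k : nat) : Cpoch z (S k) = (Cpoch z k * (z + RtoC (INR k)))%C.
Proof. reflexivity. Qed.

Lemma Cpoch_neq_0 (c : C) (k : nat) : ~ nonpos_int c -> Cpoch c k <> 0.
Proof. intros Hc. apply Cprod_neq_0. intros i _. apply nonpos_int_neq, Hc. Qed.

Lemma Cpoch_shift (z : C) (k : nat) : (z * Cpoch (z + 1) k)%C = Cpoch z (S k).
Proof.
  unfold Cpoch. rewrite Cprod_first. simpl INR at 2. f_equal.
  - ring.
  - apply Cprod_ext. intros i _. rewrite S_INR, RtoC_plus. ring.
Qed.

Lemma INR_S_C_neq_0 (k : nat) : (RtoC (INR k) + 1)%C <> 0.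
Proof.
  rewrite <- RtoC_plus. intro E. apply RtoC_inj in E. generalize (pos_INR k); lra.
Qed.

Lemma RtoC_INR_S (k : nat) : RtoC (INR (S k)) = (RtoC (INR k) + 1)%C.
Proof. rewrite S_INR, RtoC_plus. reflexivity. Qed.

Lemma hterm_S (a b c : C) (x : R) (k : nat) :
  ~ nonpos_int c ->
  (RtoC (INR (S k)) * (c + RtoC (INR k)) * hterm a b c x (S k))%C =
  (RtoC x * (a + RtoC (INR k)) * (b + RtoC (INR k)) * hterm a b c x k)%C.
Proof.
  intros Hc. unfold hterm. rewrite !Cpoch_S.
  change (fact (S k)) with (S k * fact k)%nat. rewrite mult_INR, RtoC_mult, RtoC_INR_S.
  cbn [Cpow]. field.
  repeat split; [apply INR_fact_C_neq_0|apply Cpoch_neq_0, Hc|apply INR_S_C_neq_0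
    |apply nonpos_int_neq, Hc].
Qed.

Lemma hterm_comm (a b c : C) (x : R) (k : nat) : hterm a b c x k = hterm b a c x k.
Proof. unfold hterm. rewrite (Cmult_comm (Cpoch a k)). reflexivity. Qed.

Lemma hmom_comm (m : nat) (a b c : C) (x : R) : hmom m a b c x = hmom m b a c x.
Proof.
  unfold hmom. f_equal. apply functional_extensionality. intros k.
  rewrite hterm_comm. reflexivity.
Qed.

Lemma geometric_bound (u : nat -> R) (th : R) (N : nat) :
  0 < th -> (forall k, (N <= k)%nat -> u (S k) <= th * u k) ->
  exists K, forall k, u k <= K * th ^ k.
Proof.
  intros Hth. revert u. induction N as [|N IH]; intros u H.
  - exists (u 0%nat). intros k. induction k as [|k IHk]; simpl; [lra|].
    eapply Rle_trans; [apply H; lia|].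
    replace (u 0%nat * (th * th ^ k)) with (th * (u 0%nat * th ^ k)) by ring.
    apply Rmult_le_compat_l; lra.
  - destruct (IH (fun k => u (S k))) as [K HK]; [intros; apply H; lia|].
    exists (Rmax (u 0%nat) (K / th)). intros [|k].
    + simpl. rewrite Rmult_1_r. apply Rmax_l.
    + eapply Rle_trans; [apply HK|].
      replace (K * th ^ k) with (K / th * th ^ S k) by (simpl; field; lra).
      apply Rmult_le_compat_r; [apply pow_le; lra|apply Rmax_r].
Qed.

Lemma ex_series_pow_geom (m : nat) (th : R) :
  0 < th < 1 -> ex_series (fun k => (INR k + 1) ^ m * th ^ k).
Proof.
  intros Hth.
  assert (Hp : forall k, 0 < (INR k + 1) ^ m * th ^ k).
  { intros k. apply Rmult_lt_0_compat; apply pow_lt; [generalize (pos_INR k); lra|lra]. }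
  apply ex_series_ext with (fun k => Rabs ((INR k + 1) ^ m * th ^ k)).
  { intros k. apply Rabs_pos_eq, Rlt_le, Hp. }
  apply ex_series_DAlembert with th; [lra|intros n; apply Rgt_not_eq, Hp|].
  apply is_lim_seq_ext with (fun k => (1 + / INR (S k)) ^ m * th).
  { intros k. rewrite S_INR. generalize (pos_INR k); intro Hk.
    rewrite Rabs_pos_eq.
    - replace (1 + / (INR k + 1)) with ((INR k + 1 + 1) / (INR k + 1)) by (field; lra).
      unfold Rdiv. rewrite Rpow_mult_distr, pow_inv. simpl. field.
      split; apply pow_nonzero; lra.
    - apply Rlt_le, Rdiv_lt_0_compat; [|apply Hp].
      specialize (Hp (S k)). rewrite S_INR in Hp. exact Hp. }
  replace (Finite th) with (Finite (1 ^ m * th)) by (rewrite pow1; f_equal; ring).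
  apply is_lim_seq_mult'; [|apply is_lim_seq_const].
  induction m as [|m IH]; simpl; [apply is_lim_seq_const|].
  apply is_lim_seq_mult'; [|apply IH].
  - replace (Finite 1) with (Finite (1 + 0)) by (f_equal; ring).
    apply is_lim_seq_plus'; [apply is_lim_seq_const|].
    apply (is_lim_seq_incr_1 (fun n => / INR n)), is_lim_seq_inv_INR.
  - intros k. apply Rmult_lt_0_compat; apply pow_lt; [generalize (pos_INR k); lra|lra].
Qed.

Lemma hterm_bound (a b c : C) (x : R) :
  0 < x < 1 -> ~ nonpos_int c ->
  exists K th, 0 < th < 1 /\ forall k, Cmod (hterm a b c x k) <= K * th ^ k.
Proof.
  intros Hx Hc. set (th := (1 + x) / 2).
  assert (Hth : x < th < 1) by (unfold th; lra).
  generalize (Cmod_ge_0 a) (Cmod_ge_0 b) (Cmod_ge_0 c).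
  set (al := Cmod a). set (be := Cmod b). set (ga := Cmod c). intros Hal Hbe Hga.
  (* [th - x] times the index has to absorb every lower-order term in the quotient of consecutive
     terms; [S0] bounds them together. *)
  set (S0 := al + be + al * be + 2 * ga).
  destruct (eventually_INR_gt (S0 / (th - x) + 1 + ga)) as [N HN].
  destruct (geometric_bound (fun k => Cmod (hterm a b c x k)) th N) as [K HK]; [lra| |].
  2:{ exists K, th. split; [lra|exact HK]. }
  intros k Hk. specialize (HN k Hk).
  assert (HS0 : 0 <= S0 / (th - x)).
  { unfold S0. apply Rmult_le_pos; [nra|apply Rlt_le, Rinv_0_lt_compat; lra]. }
  assert (HkS : S0 <= (th - x) * INR k).
  { apply Rle_trans with ((th - x) * (S0 / (th - x))); [right; field; lra|].
    apply Rmult_le_compat_l; lra. }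
  assert (E := f_equal Cmod (hterm_S a b c x k Hc)).
  rewrite !Cmod_mult in E.
  rewrite !Cmod_R, S_INR, (Rabs_pos_eq x), (Rabs_pos_eq (INR k + 1)) in E by (generalize
      (pos_INR k); lra).
  set (t := Cmod (hterm a b c x k)) in *. set (t1 := Cmod (hterm a b c x (S k))) in *.
  assert (Ht : 0 <= t) by apply Cmod_ge_0. assert (Ht1 : 0 <= t1) by apply Cmod_ge_0.
  assert (H1 : Cmod (a + RtoC (INR k)) <= INR k + al).
  { eapply Rle_trans; [apply Cmod_triangle|]. rewrite Cmod_R, Rabs_pos_eq by apply pos_INR.
    unfold al; lra. }
  assert (H2 : Cmod (b + RtoC (INR k)) <= INR k + be).
  { eapply Rle_trans; [apply Cmod_triangle|]. rewrite Cmod_R, Rabs_pos_eq by apply pos_INR.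
    unfold be; lra. }
  assert (H3 : INR k - ga <= Cmod (c + RtoC (INR k))).
  { assert (H := Cmod_triangle_inv (RtoC (INR k)) c).
  rewrite Cmod_R, Rabs_pos_eq in H by apply pos_INR.
    rewrite Cplus_comm. exact H. }
  assert (Hk0 := pos_INR k).
  assert (Hk1 : 1 <= INR k) by lra.
  assert (H4 : (INR k + 1) * (INR k - ga) * t1 <= (x * (INR k + al) * (INR k + be)) * t).
  { apply Rle_trans with ((INR k + 1) * Cmod (c + RtoC (INR k)) * t1).
    - apply Rmult_le_compat_r; [exact Ht1|]. apply Rmult_le_compat_l; lra.
    - rewrite E. apply Rmult_le_compat_r; [exact Ht|].
      apply Rmult_le_compat; try apply Cmod_ge_0; try assumption.
      + apply Rmult_le_pos; [lra|apply Cmod_ge_0].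
      + apply Rmult_le_compat_l; lra. }
  assert (H5 : x * (INR k + al) * (INR k + be) <= th * ((INR k + 1) * (INR k - ga))).
  { assert (S0 * INR k <= (th - x) * INR k * INR k) by (apply Rmult_le_compat_r; lra).
    assert (x * (al * INR k + be * INR k + al * be) <= 1 * (al * INR k + be * INR k + al * be))
      by (apply Rmult_le_compat_r; try lra; nra).
    assert (th * (ga * INR k + ga) <= 1 * (ga * INR k + ga)) by (apply Rmult_le_compat_r;
        [nra|lra]).
    assert (al * be <= al * be * INR k) by (assert (0 <= al * be) by (apply Rmult_le_pos; lra);
        nra).
    assert (ga <= ga * INR k) by nra.
    assert (0 <= th * INR k) by nra.
    unfold S0 in *. nra. }
  assert (Hpos : 0 < (INR k + 1) * (INR k - ga)) by (apply Rmult_lt_0_compat; lra).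
  apply Rmult_le_reg_l with ((INR k + 1) * (INR k - ga)); [exact Hpos|].
  eapply Rle_trans; [exact H4|].
  replace ((INR k + 1) * (INR k - ga) * (th * t)) with (th * ((INR k + 1) * (INR k - ga)) * t)
      by ring.
  apply Rmult_le_compat_r; assumption.
Qed.

Lemma hmom_summable (m : nat) (a b c : C) (x : R) :
  0 < x < 1 -> ~ nonpos_int c ->
  exists M, ex_series M /\ forall k, Cmod (RtoC (INR k ^ m) * hterm a b c x k) <= M k.
Proof.
  intros Hx Hc. destruct (hterm_bound a b c x Hx Hc) as [K [th [Hth H]]].
  exists (fun k => K * ((INR k + 1) ^ m * th ^ k)). split.
  - exact (ex_series_scal K (fun k => (INR k + 1) ^ m * th ^ k) (ex_series_pow_geom m th Hth)).
  - intros k. rewrite Cmod_mult, Cmod_R, Rabs_pos_eq by (apply pow_le, pos_INR).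
    replace (K * ((INR k + 1) ^ m * th ^ k)) with ((INR k + 1) ^ m * (K * th ^ k)) by ring.
    apply Rmult_le_compat; [apply pow_le, pos_INR|apply Cmod_ge_0| |apply H].
    apply pow_incr. generalize (pos_INR k); lra.
Qed.

Lemma hmom_correct (m : nat) (a b c : C) (x : R) :
  0 < x < 1 -> ~ nonpos_int c ->
  is_Cseries (fun k => RtoC (INR k ^ m) * hterm a b c x k)%C (hmom m a b c x).
Proof.
  intros Hx Hc. destruct (hmom_summable m a b c x Hx Hc) as [M [HM H]].
  eapply is_Cseries_summable; eassumption.
Qed.

(* Both sums equal [sum h(k+1) (k+1) (c+k) t_(k+1)], the first one by a shift. *)
Lemma hmom_rec (h : nat -> C) (S0 S1 : C) (a b c : C) (x : R) :
  ~ nonpos_int c ->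
  is_Cseries (fun k => h k * (RtoC (INR k) * (c + RtoC (INR k) - 1) * hterm a b c x k))%C S0 ->
  is_Cseries (fun k => h (S k) * (RtoC x * (a + RtoC (INR k)) * (b + RtoC (INR k)) * hterm a b
      c x k))%C S1 ->
  S0 = S1.
Proof.
  intros Hc H0 H1.
  apply is_Cseries_shift in H0; [|simpl; ring].
  apply (is_Cseries_unique _ _ _ H0). eapply is_Cseries_ext; [|exact H1].
  intros k. cbv beta. rewrite <- hterm_S by exact Hc. rewrite RtoC_INR_S. ring.
Qed.

Lemma is_Cseries_lin3 (u0 u1 u2 : nat -> C) (s0 s1 s2 c0 c1 c2 : C) (v : nat -> C) :
  is_Cseries u0 s0 -> is_Cseries u1 s1 -> is_Cseries u2 s2 ->
  (forall k, v k = c0 * u0 k + c1 * u1 k + c2 * u2 k)%C ->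
  is_Cseries v (c0 * s0 + c1 * s1 + c2 * s2)%C.
Proof.
  intros H0 H1 H2 Hv. eapply is_Cseries_ext; [intros k; symmetry; apply Hv|].
  repeat apply is_Cseries_plus; apply is_Cseries_scal; assumption.
Qed.

(** The hypergeometric differential equation in terms of [x d/dx]. Because of it the pair of moments
    0 and 1 is stable under contiguity. *)
Lemma hmom2 (a b c : C) (x : R) :
  0 < x < 1 -> ~ nonpos_int c ->
  ((1 - RtoC x) * hmom 2 a b c x)%C =
  ((RtoC x * (a + b) - c + 1) * hmom 1 a b c x + a * b * RtoC x * hmom 0 a b c x)%C.
Proof.
  intros Hx Hc.
  assert (H0 := hmom_correct 0 a b c x Hx Hc).
  assert (H1 := hmom_correct 1 a b c x Hx Hc).
  assert (H2 := hmom_correct 2 a b c x Hx Hc).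
  set (T0 := hmom 0 a b c x) in *. set (T1 := hmom 1 a b c x) in *. set (T2 := hmom 2 a b c x) in *.
  assert (E : (0 * T0 + (c - 1) * T1 + 1 * T2 = RtoC x * a * b * T0 + RtoC x * (a + b) * T1 +
      RtoC x * T2)%C).
  { apply (hmom_rec (fun _ => 1) _ _ a b c x Hc);
      eapply is_Cseries_lin3; [exact H0|exact H1|exact H2| |exact H0|exact H1|exact H2|];
      intros k; simpl; rewrite ?Rmult_1_r, ?RtoC_mult; ring. }
  assert (E2 : (T2 = RtoC x * T2 + (RtoC x * a * b * T0 + RtoC x * (a + b) * T1 - (c - 1) * T1))%C).
  { replace T2 with (0 * T0 + (c - 1) * T1 + 1 * T2 - (c - 1) * T1)%C at 1 by ring. rewrite E.
  ring. }
  replace ((1 - RtoC x) * T2)%C with (T2 - RtoC x * T2)%C by ring. rewrite E2 at 1. ring.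
Qed.

(** Product form, since dividing by [a] would exclude [a = 0]. *)
Lemma hterm_ac (a b c : C) (x : R) (k : nat) :
  ~ nonpos_int c ->
  (a * (c + RtoC (INR k)) * hterm (a + 1) b (c + 1) x k)%C =
  (c * (a + RtoC (INR k)) * hterm a b c x k)%C.
Proof.
  intros Hc.
  assert (Hc1 : ~ nonpos_int (c + 1)) by (intro E; apply Hc, nonpos_int_pred, E).
  unfold hterm.
  assert (Ha := Cpoch_shift a k). assert (HC := Cpoch_shift c k). rewrite Cpoch_S in Ha, HC.
  assert (Hc0 : c <> 0) by (intro E; apply Hc; exists 0%nat; rewrite E; simpl; f_equal; ring).
  assert (EC : (Cpoch c k = c * Cpoch (c + 1) k / (c + RtoC (INR k)))%C).
  { rewrite HC. field. apply nonpos_int_neq, Hc. }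
  rewrite EC.
  transitivity (a * Cpoch (a + 1) k * (c + RtoC (INR k)) * Cpoch b k / (Cpoch (c + 1) k * RtoC
      (INR (fact k))) * RtoC x ^ k)%C.
  - field. split; [apply INR_fact_C_neq_0|apply Cpoch_neq_0, Hc1].
  - rewrite Ha. field.
    repeat split; try apply INR_fact_C_neq_0; try (apply Cpoch_neq_0, Hc1); try exact Hc0;
      apply nonpos_int_neq, Hc.
Qed.

Lemma hterm_c (a b c : C) (x : R) (k : nat) :
  ~ nonpos_int c ->
  ((c + RtoC (INR k)) * hterm a b (c + 1) x k)%C = (c * hterm a b c x k)%C.
Proof.
  intros Hc.
  assert (Hc1 : ~ nonpos_int (c + 1)) by (intro E; apply Hc, nonpos_int_pred, E).
  unfold hterm.
  assert (HC := Cpoch_shift c k). rewrite Cpoch_S in HC.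
  assert (Hc0 : c <> 0) by (intro E; apply Hc; exists 0%nat; rewrite E; simpl; f_equal; ring).
  assert (EC : (Cpoch c k = c * Cpoch (c + 1) k / (c + RtoC (INR k)))%C).
  { rewrite HC. field. apply nonpos_int_neq, Hc. }
  rewrite EC. field.
  repeat split; try apply INR_fact_C_neq_0; try (apply Cpoch_neq_0, Hc1); try exact Hc0;
      apply nonpos_int_neq, Hc.
Qed.

Lemma hterm_ac_S (a b c : C) (x : R) (k : nat) :
  ~ nonpos_int c ->
  (c * RtoC (INR (S k)) * hterm a b c x (S k))%C =
  (a * RtoC x * (b + RtoC (INR k)) * hterm (a + 1) b (c + 1) x k)%C.
Proof.
  intros Hc.
  assert (Hck := nonpos_int_neq c k Hc).
  assert (E1 := hterm_S a b c x k Hc). assert (E2 := hterm_ac a b c x k Hc).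
  transitivity (c * (RtoC (INR (S k)) * (c + RtoC (INR k)) * hterm a b c x (S k)) / (c + RtoC
      (INR k)))%C.
  { field. exact Hck. }
  rewrite E1.
  transitivity (RtoC x * (b + RtoC (INR k)) * (c * (a + RtoC (INR k)) * hterm a b c x k) / (c +
      RtoC (INR k)))%C.
  { field. exact Hck. }
  rewrite <- E2. field. exact Hck.
Qed.

(* A form of the step that survives [a = 0]. *)
Lemma hterm_ac_back (a b c : C) (x : R) (k : nat) :
  ~ nonpos_int c ->
  (c * hterm a b c x (S k) - (c + RtoC (INR (S k))) * hterm (a + 1) b (c + 1) x (S k))%C =
  (- (RtoC x * (b + RtoC (INR k)) * hterm (a + 1) b (c + 1) x k))%C.
Proof.
  intros Hc.
  assert (Hc1 : ~ nonpos_int (c + 1)) by (intro E; apply Hc, nonpos_int_pred, E).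
  assert (HS := hterm_S (a + 1) b (c + 1) x k Hc1).
  assert (HA := hterm_ac_S a b c x k Hc).
  assert (HSk : RtoC (INR (S k)) <> 0) by (rewrite RtoC_INR_S; apply INR_S_C_neq_0).
  set (s := hterm (a + 1) b (c + 1) x k) in *.
  set (s' := hterm (a + 1) b (c + 1) x (S k)) in *.
  set (t' := hterm a b c x (S k)) in *.
  transitivity ((c * RtoC (INR (S k)) * t' - RtoC (INR (S k)) * (c + 1 + RtoC (INR k)) * s') /
      RtoC (INR (S k)))%C.
  { rewrite RtoC_INR_S in *. field. exact HSk. }
  rewrite HA, HS, RtoC_INR_S in *. field. exact HSk.
Qed.

Lemma RtoC_pow_INR (k m : nat) : RtoC (INR k ^ m) = (RtoC (INR k) ^ m)%C.
Proof. apply RtoC_pow. Qed.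

Lemma moment_term_0 (m : nat) (z : C) : (RtoC (INR 0 ^ S m) * z)%C = 0.
Proof. simpl. rewrite Rmult_0_l. ring. Qed.

Ltac moments_ring := intros k; cbv beta; rewrite ?RtoC_pow_INR; cbn [Cpow]; try ring.

(** * One-step contiguity relations and their inverses *)

(** Termwise, a new term combines the old terms of index [k] and [k + 1]. The shift of index is
    harmless because moments of positive order have no term at index 0. *)
Lemma step_ac_fwd (a b c : C) (x : R) :
  0 < x < 1 -> ~ nonpos_int c ->
  (RtoC x * (c - b) * a * hmom 0 (a + 1) b (c + 1) x)%C =
    (c * (RtoC x * a * hmom 0 a b c x - (1 - RtoC x) * hmom 1 a b c x))%C /\
  (RtoC x * (c - b) * a * hmom 1 (a + 1) b (c + 1) x)%C =
    (c * (- a * b * RtoC x * hmom 0 a b c x + (c - b * RtoC x) * hmom 1 a b c x))%C.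
Proof.
  intros Hx Hc.
  assert (Hc1 : ~ nonpos_int (c + 1)) by (intro E; apply Hc, nonpos_int_pred, E).
  assert (T0 := hmom_correct 0 a b c x Hx Hc).
  assert (T1 := hmom_correct 1 a b c x Hx Hc).
  assert (T2 := hmom_correct 2 a b c x Hx Hc).
  assert (S0 := hmom_correct 0 (a + 1) b (c + 1) x Hx Hc1).
  assert (S1 := hmom_correct 1 (a + 1) b (c + 1) x Hx Hc1).
  assert (E2 := hmom2 a b c x Hx Hc).
  assert (D1 := is_Cseries_shift _ _ (moment_term_0 _ _) T1).
  assert (D2 := is_Cseries_shift _ _ (moment_term_0 _ _) T2).
  assert (P : forall k, (RtoC x * (c - b) * a * hterm (a + 1) b (c + 1) x k =
    c * (RtoC x * (a + RtoC (INR k)) * hterm a b c x k - RtoC (INR (S k)) * hterm a b c x (S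
        k)))%C).
  { intros k. assert (Hck := nonpos_int_neq c k Hc).
    assert (F1 := hterm_ac a b c x k Hc). assert (F2 := hterm_S a b c x k Hc).
    transitivity (RtoC x * (c - b) * (a * (c + RtoC (INR k)) * hterm (a + 1) b (c + 1) x k) /
        (c + RtoC (INR k)))%C.
    { field. exact Hck. }
    rewrite F1.
    transitivity (c * (RtoC x * (a + RtoC (INR k)) * hterm a b c x k
       - (RtoC (INR (S k)) * (c + RtoC (INR k)) * hterm a b c x (S k)) / (c + RtoC (INR k))))%C.
    { rewrite F2. field. exact Hck. }
    field. exact Hck. }
  split.
  - apply is_Cseries_unique with (fun k => RtoC x * (c - b) * a * (RtoC (INR k ^ 0) * hterm (a
      + 1) b (c + 1) x k))%C.
    + apply is_Cseries_scal, S0.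
    + replace (c * (RtoC x * a * hmom 0 a b c x - (1 - RtoC x) * hmom 1 a b c x))%C
        with (c * RtoC x * a * hmom 0 a b c x + c * RtoC x * hmom 1 a b c x + - c * hmom 1 a b
            c x)%C by ring.
      eapply is_Cseries_lin3; [exact T0|exact T1|exact D1|].
      intros k. cbv beta. rewrite !RtoC_pow_INR. cbn [Cpow].
      transitivity (RtoC x * (c - b) * a * hterm (a + 1) b (c + 1) x k)%C; [ring|].
      rewrite P. ring.
  (* The target is rewritten so that [hmom2] can be read backwards: the termwise identity produces a
     second moment. *)
  - replace (c * (- a * b * RtoC x * hmom 0 a b c x + (c - b * RtoC x) * hmom 1 a b c x))%C
      with (c * ((RtoC x * a + 1) * hmom 1 a b c x - ((RtoC x * (a + b) - c + 1) * hmom 1 a b c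
          x + a * b * RtoC x * hmom 0 a b c x)))%C by ring.
    rewrite <- E2.
    apply is_Cseries_unique with (fun k => RtoC x * (c - b) * a * (RtoC (INR k ^ 1) * hterm (a
        + 1) b (c + 1) x k))%C.
    + apply is_Cseries_scal, S1.
    + replace (c * ((RtoC x * a + 1) * hmom 1 a b c x - (1 - RtoC x) * hmom 2 a b c x))%C
        with (c * RtoC x * a * hmom 1 a b c x + c * RtoC x * hmom 2 a b c x
              + - c * (hmom 2 a b c x - hmom 1 a b c x))%C by ring.
      eapply is_Cseries_lin3; [exact T1|exact T2|exact (is_Cseries_minus _ _ _ _ D2 D1)|].
      intros k. cbv beta. rewrite !RtoC_pow_INR. cbn [Cpow].
      transitivity (RtoC (INR k) * (RtoC x * (c - b) * a * hterm (a + 1) b (c + 1) x k))%C; [ring|].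
      rewrite P, RtoC_INR_S. ring.
Qed.

(** The inverse of the preceding step. It is needed because [1 - a] and [1 - c] go down when [a] and
    [c] go up, so that raising the parameters of the second local solution is a backward step for
    its series. *)
Lemma step_ac_back (a b c : C) (x : R) :
  0 < x < 1 -> ~ nonpos_int c ->
  (c * hmom 0 a b c x)%C =
    ((c - RtoC x * b) * hmom 0 (a + 1) b (c + 1) x + (1 - RtoC x) * hmom 1 (a + 1) b (c + 1) x)%C /\
  (c * hmom 1 a b c x)%C =
    (a * b * RtoC x * hmom 0 (a + 1) b (c + 1) x + a * RtoC x * hmom 1 (a + 1) b (c + 1) x)%C.
Proof.
  intros Hx Hc.
  assert (Hc1 : ~ nonpos_int (c + 1)) by (intro E; apply Hc, nonpos_int_pred, E).
  assert (T0 := hmom_correct 0 a b c x Hx Hc).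
  assert (T1 := hmom_correct 1 a b c x Hx Hc).
  assert (S0 := hmom_correct 0 (a + 1) b (c + 1) x Hx Hc1).
  assert (S1 := hmom_correct 1 (a + 1) b (c + 1) x Hx Hc1).
  assert (D1 := is_Cseries_shift _ _ (moment_term_0 _ _) T1).
  split.
  - assert (V : is_Cseries (fun k => c * hterm a b c x k - (c + RtoC (INR k)) * hterm (a + 1) b
      (c + 1) x k)%C
       (c * hmom 0 a b c x + - c * hmom 0 (a + 1) b (c + 1) x + -(1) * hmom 1 (a + 1) b (c + 1)
           x)%C).
    { eapply is_Cseries_lin3; [exact T0|exact S0|exact S1|]. moments_ring. }
    apply is_Cseries_shift in V.
    2:{ unfold hterm, Cpoch; simpl. ring. }
    assert (W : is_Cseries (fun k => - (RtoC x * (b + RtoC (INR k)) * hterm (a + 1) b (c + 1) x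
        k))%C
       (- RtoC x * b * hmom 0 (a + 1) b (c + 1) x + - RtoC x * hmom 1 (a + 1) b (c + 1) x + 0 *
           hmom 1 (a + 1) b (c + 1) x)%C).
    { eapply is_Cseries_lin3; [exact S0|exact S1|exact S1|]. moments_ring. }
    assert (E := is_Cseries_unique _ _ _ V
      (is_Cseries_ext _ _ _ (fun k => eq_sym (hterm_ac_back a b c x k Hc)) W)).
    replace (c * hmom 0 a b c x)%C
      with (c * hmom 0 a b c x + - c * hmom 0 (a + 1) b (c + 1) x + -(1) * hmom 1 (a + 1) b (c
          + 1) x
            + (c * hmom 0 (a + 1) b (c + 1) x + hmom 1 (a + 1) b (c + 1) x))%C by ring.
    rewrite E. ring.
  - apply is_Cseries_unique with (fun k => c * (RtoC (INR (S k) ^ 1) * hterm a b c x (S k)))%C.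
    + apply is_Cseries_scal, D1.
    + replace (a * b * RtoC x * hmom 0 (a + 1) b (c + 1) x + a * RtoC x * hmom 1 (a + 1) b (c +
        1) x)%C
        with (a * b * RtoC x * hmom 0 (a + 1) b (c + 1) x + a * RtoC x * hmom 1 (a + 1) b (c + 1) x
              + 0 * hmom 1 (a + 1) b (c + 1) x)%C by ring.
      eapply is_Cseries_lin3; [exact S0|exact S1|exact S1|].
      intros k. cbv beta. rewrite !RtoC_pow_INR. cbn [Cpow].
      transitivity (c * RtoC (INR (S k)) * hterm a b c x (S k))%C; [ring|].
      rewrite hterm_ac_S by exact Hc. ring.
Qed.

Lemma step_c_fwd (a b c : C) (x : R) :
  0 < x < 1 -> ~ nonpos_int c ->
  (RtoC x * (c - a) * (c - b) * hmom 0 a b (c + 1) x)%C =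
    (c * (- RtoC x * (a + b - c) * hmom 0 a b c x + (1 - RtoC x) * hmom 1 a b c x))%C /\
  (RtoC x * (c - a) * (c - b) * hmom 1 a b (c + 1) x)%C =
    (c * (a * b * RtoC x * hmom 0 a b c x - (1 - RtoC x) * c * hmom 1 a b c x))%C.
Proof.
  intros Hx Hc.
  assert (Hc1 : ~ nonpos_int (c + 1)) by (intro E; apply Hc, nonpos_int_pred, E).
  assert (T0 := hmom_correct 0 a b c x Hx Hc).
  assert (T1 := hmom_correct 1 a b c x Hx Hc).
  assert (T2 := hmom_correct 2 a b c x Hx Hc).
  assert (S0 := hmom_correct 0 a b (c + 1) x Hx Hc1).
  assert (S1 := hmom_correct 1 a b (c + 1) x Hx Hc1).
  assert (E2 := hmom2 a b c x Hx Hc).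
  assert (D1 := is_Cseries_shift _ _ (moment_term_0 _ _) T1).
  assert (D2 := is_Cseries_shift _ _ (moment_term_0 _ _) T2).
  assert (P : forall k, (RtoC x * (c - a) * (c - b) * hterm a b (c + 1) x k =
    c * (RtoC (INR (S k)) * hterm a b c x (S k) - RtoC x * (RtoC (INR k) + a + b - c) * hterm a
        b c x k))%C).
  { intros k. assert (Hck := nonpos_int_neq c k Hc).
    assert (F1 := hterm_c a b c x k Hc). assert (F2 := hterm_S a b c x k Hc).
    transitivity (RtoC x * (c - a) * (c - b) * ((c + RtoC (INR k)) * hterm a b (c + 1) x k) /
        (c + RtoC (INR k)))%C.
    { field. exact Hck. }
    rewrite F1.
    transitivity (c * ((RtoC (INR (S k)) * (c + RtoC (INR k)) * hterm a b c x (S k)) / (c +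
        RtoC (INR k))
       - RtoC x * (RtoC (INR k) + a + b - c) * hterm a b c x k))%C.
    { rewrite F2. field. exact Hck. }
    field. exact Hck. }
  split.
  - apply is_Cseries_unique with (fun k => RtoC x * (c - a) * (c - b) * (RtoC (INR k ^ 0) *
      hterm a b (c + 1) x k))%C.
    + apply is_Cseries_scal, S0.
    + replace (c * (- RtoC x * (a + b - c) * hmom 0 a b c x + (1 - RtoC x) * hmom 1 a b c x))%C
        with (- c * RtoC x * (a + b - c) * hmom 0 a b c x + - c * RtoC x * hmom 1 a b c x + c *
            hmom 1 a b c x)%C by ring.
      eapply is_Cseries_lin3; [exact T0|exact T1|exact D1|].
      intros k. cbv beta. rewrite !RtoC_pow_INR. cbn [Cpow].
      transitivity (RtoC x * (c - a) * (c - b) * hterm a b (c + 1) x k)%C; [ring|].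
      rewrite P. ring.
  - replace (c * (a * b * RtoC x * hmom 0 a b c x - (1 - RtoC x) * c * hmom 1 a b c x))%C
      with (c * (((RtoC x * (a + b) - c + 1) * hmom 1 a b c x + a * b * RtoC x * hmom 0 a b c x)
             - (1 + RtoC x * (a + b - c)) * hmom 1 a b c x))%C by ring.
    rewrite <- E2.
    apply is_Cseries_unique with (fun k => RtoC x * (c - a) * (c - b) * (RtoC (INR k ^ 1) *
        hterm a b (c + 1) x k))%C.
    + apply is_Cseries_scal, S1.
    + replace (c * ((1 - RtoC x) * hmom 2 a b c x - (1 + RtoC x * (a + b - c)) * hmom 1 a b c x))%C
        with (- c * RtoC x * (a + b - c) * hmom 1 a b c x + - c * RtoC x * hmom 2 a b c x
              + c * (hmom 2 a b c x - hmom 1 a b c x))%C by ring.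
      eapply is_Cseries_lin3; [exact T1|exact T2|exact (is_Cseries_minus _ _ _ _ D2 D1)|].
      intros k. cbv beta. rewrite !RtoC_pow_INR. cbn [Cpow].
      transitivity (RtoC (INR k) * (RtoC x * (c - a) * (c - b) * hterm a b (c + 1) x k))%C; [ring|].
      rewrite P, RtoC_INR_S. ring.
Qed.

(** A term for [c + 1] times [c + k] is [c] times the term for [c], which raises the order of a
    moment by one; the second moment that arises is removed by [hmom2]. *)
Lemma step_c_back (a b c : C) (x : R) :
  0 < x < 1 -> ~ nonpos_int c ->
  (c * hmom 0 a b c x)%C = (c * hmom 0 a b (c + 1) x + hmom 1 a b (c + 1) x)%C /\
  (c * (1 - RtoC x) * hmom 1 a b c x)%C =
    (a * b * RtoC x * hmom 0 a b (c + 1) x + RtoC x * (a + b - c) * hmom 1 a b (c + 1) x)%C.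
Proof.
  intros Hx Hc.
  assert (Hc1 : ~ nonpos_int (c + 1)) by (intro E; apply Hc, nonpos_int_pred, E).
  assert (T0 := hmom_correct 0 a b c x Hx Hc).
  assert (T1 := hmom_correct 1 a b c x Hx Hc).
  assert (S0 := hmom_correct 0 a b (c + 1) x Hx Hc1).
  assert (S1 := hmom_correct 1 a b (c + 1) x Hx Hc1).
  assert (S2 := hmom_correct 2 a b (c + 1) x Hx Hc1).
  assert (E2 := hmom2 a b (c + 1) x Hx Hc1).
  assert (P : forall m, (c * hmom m a b c x = c * hmom m a b (c + 1) x + hmom (S m) a b (c + 1)
      x)%C).
  { intros m.
    apply is_Cseries_unique with (fun k => c * (RtoC (INR k ^ m) * hterm a b c x k))%C.
    - apply is_Cseries_scal, hmom_correct; assumption.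
    - apply is_Cseries_ext with (fun k => c * (RtoC (INR k ^ m) * hterm a b (c + 1) x k)
        + RtoC (INR k ^ S m) * hterm a b (c + 1) x k)%C.
      + intros k.
        transitivity (RtoC (INR k ^ m) * ((c + RtoC (INR k)) * hterm a b (c + 1) x k))%C.
        * rewrite !RtoC_pow_INR. cbn [Cpow]. ring.
        * rewrite hterm_c by exact Hc. ring.
      + apply is_Cseries_plus; [apply is_Cseries_scal|]; apply hmom_correct; assumption. }
  split; [apply P|].
  replace (c * (1 - RtoC x) * hmom 1 a b c x)%C with ((1 - RtoC x) * (c * hmom 1 a b c x))%C by
      ring.
  rewrite P.
  replace ((1 - RtoC x) * (c * hmom 1 a b (c + 1) x + hmom 2 a b (c + 1) x))%C
    with ((1 - RtoC x) * c * hmom 1 a b (c + 1) x + (1 - RtoC x) * hmom 2 a b (c + 1) x)%C by ring.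
  rewrite E2. ring.
Qed.

(** * Transfer matrices acting on both local solutions *)

Record mat2 : Type := Mat2 { m11 : C; m12 : C; m21 : C; m22 : C }.

Definition mmul2 (M N : mat2) : mat2 :=
  Mat2 (m11 M * m11 N + m12 M * m21 N)%C (m11 M * m12 N + m12 M * m22 N)%C
       (m21 M * m11 N + m22 M * m21 N)%C (m21 M * m12 N + m22 M * m22 N)%C.

Definition mid2 : mat2 := Mat2 1 0 0 1.

(** The scalars hold the denominators of a step and the normalization of the solution. Keeping them
    outside leaves [M] polynomial in the parameters and common to both local solutions. *)
Definition carries (M : mat2) (D E : C) (u v : C * C) : Prop :=
  (D * fst v)%C = (E * (m11 M * fst u + m12 M * snd u))%C /\
  (D * snd v)%C = (E * (m21 M * fst u + m22 M * snd u))%C.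

Lemma carries_id (u : C * C) : carries mid2 1 1 u u.
Proof. split; simpl; ring. Qed.

Lemma carries_comp (M N : mat2) (D E D' E' : C) (u v w : C * C) :
  carries M D E u v -> carries N D' E' v w -> carries (mmul2 N M) (D * D') (E * E') u w.
Proof.
  intros [H1 H2] [H3 H4]; split; simpl.
  - replace (D * D' * fst w)%C with (D * (D' * fst w))%C by ring. rewrite H3.
    replace (D * (E' * (m11 N * fst v + m12 N * snd v)))%C
      with (E' * (m11 N * (D * fst v) + m12 N * (D * snd v)))%C by ring.
    rewrite H1, H2. ring.
  - replace (D * D' * snd w)%C with (D * (D' * snd w))%C by ring. rewrite H4.
    replace (D * (E' * (m21 N * fst v + m22 N * snd v)))%C
      with (E' * (m21 N * (D * fst v) + m22 N * (D * snd v)))%C by ring.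
    rewrite H1, H2. ring.
Qed.

Lemma carries_eq (M : mat2) (D E D' E' : C) (u v u' v' : C * C) :
  carries M D E u v -> D = D' -> E = E' -> u = u' -> v = v' -> carries M D' E' u' v'.
Proof. intros; subst; assumption. Qed.

Definition hvec (a b c : C) (x : R) : C * C := (hmom 0 a b c x, hmom 1 a b c x).

(* The pair (value, Euler derivative) of the second local solution
   x^(1-c) (1-x)^(c-a-b) 2F1(1-a,1-b;2-c;x), up to the power factors and a
   factor 1-x. *)
Definition dual_hvec (a b c : C) (x : R) : C * C :=
  let h := hvec (1 - a) (1 - b) (2 - c) x in
  ((1 - RtoC x) * fst h,
   (1 - c - RtoC x + RtoC x * (a + b)) * fst h + (1 - RtoC x) * snd h)%C.

Definition mat_ac (a b c : C) (x : R) : mat2 :=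
  Mat2 (RtoC x * a) (- (1 - RtoC x)) (- a * b * RtoC x) (c - b * RtoC x).

Definition mat_c (a b c : C) (x : R) : mat2 :=
  Mat2 (- RtoC x * (a + b - c)) (1 - RtoC x) (a * b * RtoC x) (- (1 - RtoC x) * c).

Lemma hvec_comm (a b c : C) (x : R) : hvec a b c x = hvec b a c x.
Proof. unfold hvec. rewrite (hmom_comm 0 a), (hmom_comm 1 a). reflexivity. Qed.

Lemma dual_hvec_comm (a b c : C) (x : R) : dual_hvec a b c x = dual_hvec b a c x.
Proof.
  unfold dual_hvec. rewrite (hvec_comm (1 - a)%C). cbv zeta. f_equal.
  rewrite (Cplus_comm a b). reflexivity.
Qed.

Lemma carries_ac (a b c : C) (x : R) :
  0 < x < 1 -> ~ nonpos_int c ->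
  carries (mat_ac a b c x) (RtoC x * (c - b) * a) c (hvec a b c x) (hvec (a + 1) b (c + 1) x).
Proof.
  intros Hx Hc. destruct (step_ac_fwd a b c x Hx Hc) as [H1 H2].
  split; simpl; [rewrite H1|rewrite H2]; ring.
Qed.

Lemma carries_c (a b c : C) (x : R) :
  0 < x < 1 -> ~ nonpos_int c ->
  carries (mat_c a b c x) (RtoC x * (c - a) * (c - b)) c (hvec a b c x) (hvec a b (c + 1) x).
Proof.
  intros Hx Hc. destruct (step_c_fwd a b c x Hx Hc) as [H1 H2].
  split; simpl; [rewrite H1|rewrite H2]; ring.
Qed.

(** The matrix is that of [carries_ac], because contiguity operators are differential operators and
    act alike on every local solution; only the scalar depends on the solution. The proof is the
    inverse step at [(-a, 1-b, 1-c)]. *)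
Lemma dual_carries_ac (a b c : C) (x : R) :
  0 < x < 1 -> ~ nonpos_int (1 - c)%C ->
  carries (mat_ac a b c x) (c - 1) 1 (dual_hvec a b c x) (dual_hvec (a + 1) b (c + 1) x).
Proof.
  intros Hx Hc. destruct (step_ac_back (- a) (1 - b) (1 - c) x Hx Hc) as [H1 H2].
  replace (- a + 1)%C with (1 - a)%C in H1, H2 by ring.
  replace (1 - c + 1)%C with (2 - c)%C in H1, H2 by (rewrite (RtoC_plus 1 1 : RtoC 2 = _); ring).
  unfold dual_hvec, hvec. cbn [fst snd].
  replace (1 - (a + 1))%C with (- a)%C by ring.
  replace (2 - (c + 1))%C with (1 - c)%C by (rewrite (RtoC_plus 1 1 : RtoC 2 = _); ring).
  set (T0 := hmom 0 (- a) (1 - b) (1 - c) x) in *.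
  set (T1 := hmom 1 (- a) (1 - b) (1 - c) x) in *.
  set (S0 := hmom 0 (1 - a) (1 - b) (2 - c) x) in *.
  set (S1 := hmom 1 (1 - a) (1 - b) (2 - c) x) in *.
  split; cbn [fst snd m11 m12 m21 m22 mat_ac].
  - transitivity (- (1 - RtoC x) * ((1 - c) * T0))%C; [ring|]. rewrite H1. ring.
  - transitivity (- (1 - (c + 1) - RtoC x + RtoC x * (a + 1 + b)) * ((1 - c) * T0)
       - (1 - RtoC x) * ((1 - c) * T1))%C; [ring|]. rewrite H1, H2. ring.
Qed.

(** The step raises the exponent [c - a - b] of [1 - x] by one, whence the factor [1 - x] in the
    scalar. *)
Lemma dual_carries_c (a b c : C) (x : R) :
  0 < x < 1 -> ~ nonpos_int (1 - c)%C ->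
  carries (mat_c a b c x) ((1 - c) * (1 - RtoC x)) 1 (dual_hvec a b c x) (dual_hvec a b (c + 1) x).
Proof.
  intros Hx Hc. destruct (step_c_back (1 - a) (1 - b) (1 - c) x Hx Hc) as [H1 H2].
  replace (1 - c + 1)%C with (2 - c)%C in H1, H2 by (rewrite (RtoC_plus 1 1 : RtoC 2 = _); ring).
  unfold dual_hvec, hvec. cbn [fst snd].
  replace (2 - (c + 1))%C with (1 - c)%C by (rewrite (RtoC_plus 1 1 : RtoC 2 = _); ring).
  set (T0 := hmom 0 (1 - a) (1 - b) (1 - c) x) in *.
  set (T1 := hmom 1 (1 - a) (1 - b) (1 - c) x) in *.
  set (S0 := hmom 0 (1 - a) (1 - b) (2 - c) x) in *.
  set (S1 := hmom 1 (1 - a) (1 - b) (2 - c) x) in *.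
  split; cbn [fst snd m11 m12 m21 m22 mat_c].
  - transitivity ((1 - RtoC x) * (1 - RtoC x) * ((1 - c) * T0))%C; [ring|]. rewrite H1. ring.
  - transitivity ((1 - RtoC x) * ((1 - (c + 1) - RtoC x + RtoC x * (a + b)) * ((1 - c) * T0)
       + ((1 - c) * (1 - RtoC x) * T1)))%C; [ring|]. rewrite H1, H2. ring.
Qed.

Fixpoint chain_ac (n : nat) (a b c : C) (x : R) : mat2 :=
  match n with
  | O => mid2
  | S k => mmul2 (mat_ac (a + RtoC (INR k)) b (c + RtoC (INR k)) x) (chain_ac k a b c x)
  end.

Fixpoint chain_c (n : nat) (a b c : C) (x : R) : mat2 :=
  match n with
  | O => mid2
  | S k => mmul2 (mat_c a b (c + RtoC (INR k)) x) (chain_c k a b c x)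
  end.

Lemma carries_chain_ac (n : nat) (a b c : C) (x : R) :
  0 < x < 1 -> ~ nonpos_int c ->
  carries (chain_ac n a b c x)
    (Cprod (fun k => RtoC x * (c + RtoC (INR k) - b) * (a + RtoC (INR k)))%C n) (Cpoch c n)
    (hvec a b c x) (hvec (a + RtoC (INR n)) b (c + RtoC (INR n)) x).
Proof.
  intros Hx Hc. induction n as [|n IH].
  - simpl. rewrite !Cplus_0_r. apply carries_id.
  - eapply carries_eq; [eapply carries_comp; [exact IH|apply (carries_ac _ b)]|reflexivity..|].
    + exact Hx.
    + intro E; apply Hc; eapply nonpos_int_sub; exact E.
    + rewrite RtoC_INR_S, !Cplus_assoc. reflexivity.
Qed.

Lemma carries_chain_c (n : nat) (a b c : C) (x : R) :
  0 < x < 1 -> ~ nonpos_int c ->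
  carries (chain_c n a b c x)
    (Cprod (fun k => RtoC x * (c + RtoC (INR k) - a) * (c + RtoC (INR k) - b))%C n) (Cpoch c n)
    (hvec a b c x) (hvec a b (c + RtoC (INR n)) x).
Proof.
  intros Hx Hc. induction n as [|n IH].
  - simpl. rewrite !Cplus_0_r. apply carries_id.
  - eapply carries_eq; [eapply carries_comp; [exact IH|apply (carries_c a b)]|reflexivity..|].
    + exact Hx.
    + intro E; apply Hc; eapply nonpos_int_sub; exact E.
    + rewrite RtoC_INR_S, !Cplus_assoc. reflexivity.
Qed.

(** The lower parameter [2 - c] decreases along the chain, so regularity is imposed at the far end
    and inherited by the intermediate steps. *)
Lemma dual_carries_chain_ac (n : nat) (a b c : C) (x : R) :
  0 < x < 1 -> ~ nonpos_int (2 - (c + RtoC (INR n)))%C ->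
  carries (chain_ac n a b c x) (Cprod (fun k => c + RtoC (INR k) - 1)%C n) 1
    (dual_hvec a b c x) (dual_hvec (a + RtoC (INR n)) b (c + RtoC (INR n)) x).
Proof.
  intros Hx Hc. induction n as [|n IH].
  - simpl. rewrite !Cplus_0_r. apply carries_id.
  - assert (H1 : ~ nonpos_int (1 - (c + RtoC (INR n)))%C).
    { intro E; apply Hc. replace (2 - (c + RtoC (INR (S n))))%C with (1 - (c + RtoC (INR
        n)))%C; [exact E|].
      rewrite RtoC_INR_S, (RtoC_plus 1 1 : RtoC 2 = _). ring. }
    eapply carries_eq; [eapply carries_comp; [apply IH|apply (dual_carries_ac _
        b)]|reflexivity|ring|reflexivity|].
    + intro E; apply H1, nonpos_int_pred.
      replace (1 - (c + RtoC (INR n)) + 1)%C with (2 - (c + RtoC (INR n)))%C; [exact E|].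
      rewrite (RtoC_plus 1 1 : RtoC 2 = _). ring.
    + exact Hx.
    + exact H1.
    + rewrite RtoC_INR_S, !Cplus_assoc. reflexivity.
Qed.

Lemma dual_carries_chain_c (n : nat) (a b c : C) (x : R) :
  0 < x < 1 -> ~ nonpos_int (2 - (c + RtoC (INR n)))%C ->
  carries (chain_c n a b c x) (Cprod (fun k => (1 - (c + RtoC (INR k))) * (1 - RtoC x))%C n) 1
    (dual_hvec a b c x) (dual_hvec a b (c + RtoC (INR n)) x).
Proof.
  intros Hx Hc. induction n as [|n IH].
  - simpl. rewrite !Cplus_0_r. apply carries_id.
  - assert (H1 : ~ nonpos_int (1 - (c + RtoC (INR n)))%C).
    { intro E; apply Hc. replace (2 - (c + RtoC (INR (S n))))%C with (1 - (c + RtoC (INR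
        n)))%C; [exact E|].
      rewrite RtoC_INR_S, (RtoC_plus 1 1 : RtoC 2 = _). ring. }
    eapply carries_eq; [eapply carries_comp; [apply IH|apply (dual_carries_c a
        b)]|reflexivity|ring|reflexivity|].
    + intro E; apply H1, nonpos_int_pred.
      replace (1 - (c + RtoC (INR n)) + 1)%C with (2 - (c + RtoC (INR n)))%C; [exact E|].
      rewrite (RtoC_plus 1 1 : RtoC 2 = _). ring.
    + exact Hx.
    + exact H1.
    + rewrite RtoC_INR_S, !Cplus_assoc. reflexivity.
Qed.

(* The order of the steps matters: raising [c] together with [a] or [b] avoids
   spurious common factors of the matrix entries. *)
Definition shift_mat (p q s : nat) (a b c : C) (x : R) : mat2 :=
  let p' := RtoC (INR p) in let q' := RtoC (INR q) in
  mmul2 (chain_c s (a + p') (b + q') (c + p' + q') x)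
    (mmul2 (chain_ac q b (a + p') (c + p') x) (chain_ac p a b c x)).

Lemma Cprod_scal (k : C) (f : nat -> C) (n : nat) :
  Cprod (fun i => k * f i)%C n = (k ^ n * Cprod f n)%C.
Proof. rewrite Cprod_mult, Cprod_const. reflexivity. Qed.

Lemma Cpoch_add (z : C) (m n : nat) :
  Cpoch z (m + n) = (Cpoch z m * Cpoch (z + RtoC (INR m)) n)%C.
Proof.
  unfold Cpoch. rewrite Cprod_add. f_equal. apply Cprod_ext. intros i _.
  rewrite plus_INR, RtoC_plus. ring.
Qed.

Lemma RtoC_INR_add (m n : nat) : RtoC (INR (m + n)) = (RtoC (INR m) + RtoC (INR n))%C.
Proof. rewrite plus_INR, RtoC_plus. reflexivity. Qed.

(** [c - b] is met by the [p] steps in [(a, c)] and the [s] steps in [c], and [c - a] by the [q]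
    steps in [(b, c)] and the same [s] steps; hence the lengths [p + s] and [q + s]. *)
Lemma carries_shift (p q s : nat) (a b c : C) (x : R) :
  0 < x < 1 -> ~ nonpos_int c ->
  carries (shift_mat p q s a b c x)
    (RtoC x ^ (p + q + s) * Cpoch a p * Cpoch b q * Cpoch (c - a) (q + s) * Cpoch (c - b) (p + s))
    (Cpoch c (p + q + s)) (hvec a b c x)
    (hvec (a + RtoC (INR p)) (b + RtoC (INR q)) (c + RtoC (INR (p + q + s))) x).
Proof.
  intros Hx Hc.
  assert (H1 := carries_chain_ac p a b c x Hx Hc).
  assert (Hc1 : ~ nonpos_int (c + RtoC (INR p))%C) by (intro E; apply Hc; eapply
      nonpos_int_sub; exact E).
  assert (Hc2 : ~ nonpos_int (c + RtoC (INR p) + RtoC (INR q))%C) by (intro E; apply Hc1;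
      eapply nonpos_int_sub; exact E).
  assert (H2 := carries_chain_ac q b (a + RtoC (INR p)) (c + RtoC (INR p)) x Hx Hc1).
  assert (H3 := carries_chain_c s (a + RtoC (INR p)) (b + RtoC (INR q)) _ x Hx Hc2).
  rewrite (hvec_comm b), (hvec_comm (b + RtoC (INR q))) in H2.
  assert (H := carries_comp _ _ _ _ _ _ _ _ _ (carries_comp _ _ _ _ _ _ _ _ _ H1 H2) H3).
  eapply carries_eq; [exact H| | |reflexivity|].
  - rewrite !Cprod_mult, !Cprod_const, !Cpoch_add, !Cpow_add_r. unfold Cpoch.
    rewrite (Cprod_ext (fun i => c + RtoC (INR p) + RtoC (INR i) - (a + RtoC (INR p)))%C
      (fun i => c - a + RtoC (INR i))%C) by (intros; ring).
    rewrite (Cprod_ext (fun i => c + RtoC (INR i) - b)%C (fun i => c - b + RtoC (INR i))%C) by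
        (intros; ring).
    rewrite (Cprod_ext (fun i => c + RtoC (INR p) + RtoC (INR q) + RtoC (INR i) - (a + RtoC
        (INR p)))%C
      (fun i => c - a + RtoC (INR q) + RtoC (INR i))%C) by (intros; ring).
    rewrite (Cprod_ext (fun i => c + RtoC (INR p) + RtoC (INR q) + RtoC (INR i) - (b + RtoC
        (INR q)))%C
      (fun i => c - b + RtoC (INR p) + RtoC (INR i))%C) by (intros; ring).
    ring.
  - rewrite !Cpoch_add, RtoC_INR_add. f_equal. f_equal. ring.
  - rewrite !RtoC_INR_add. f_equal. ring.
Qed.

(** Each step in [c] alone contributes [(1 - (c + k)) (1 - x)], while the Pochhammer symbol collects
    [c + k - 1]. The signs left over form [(-1)^s]; here the parity of [r - p - q] enters. *)
Lemma dual_carries_shift (p q s : nat) (a b c : C) (x : R) :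
  0 < x < 1 -> ~ nonpos_int (2 - (c + RtoC (INR (p + q + s))))%C ->
  carries (shift_mat p q s a b c x)
    ((- (1 - RtoC x)) ^ s * Cpoch (c - 1) (p + q + s)) 1 (dual_hvec a b c x)
    (dual_hvec (a + RtoC (INR p)) (b + RtoC (INR q)) (c + RtoC (INR (p + q + s))) x).
Proof.
  intros Hx Hc.
  assert (Hs : forall z k, ~ nonpos_int z -> ~ nonpos_int (z + RtoC (INR k))%C)
    by (intros z k Hz E; apply Hz; eapply nonpos_int_sub; exact E).
  assert (Hc2 : ~ nonpos_int (2 - (c + RtoC (INR p) + RtoC (INR q)))%C).
  { apply (Hs _ s) in Hc. intro E; apply Hc. rewrite !RtoC_INR_add.
    replace (2 - (c + (RtoC (INR p) + RtoC (INR q) + RtoC (INR s))) + RtoC (INR s))%C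
      with (2 - (c + RtoC (INR p) + RtoC (INR q)))%C by ring. exact E. }
  assert (Hc1 : ~ nonpos_int (2 - (c + RtoC (INR p)))%C).
  { apply (Hs _ q) in Hc2. intro E; apply Hc2.
    replace (2 - (c + RtoC (INR p) + RtoC (INR q)) + RtoC (INR q))%C
      with (2 - (c + RtoC (INR p)))%C by ring. exact E. }
  assert (H1 := dual_carries_chain_ac p a b c x Hx Hc1).
  assert (H2 := dual_carries_chain_ac q b (a + RtoC (INR p)) (c + RtoC (INR p)) x Hx Hc2).
  assert (H3 := dual_carries_chain_c s (a + RtoC (INR p)) (b + RtoC (INR q))
     (c + RtoC (INR p) + RtoC (INR q)) x Hx).
  rewrite (dual_hvec_comm b), (dual_hvec_comm (b + RtoC (INR q))) in H2.
  assert (Hc' : ~ nonpos_int (2 - (c + RtoC (INR p) + RtoC (INR q) + RtoC (INR s)))%C).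
  { rewrite !RtoC_INR_add in Hc. intro E; apply Hc.
    replace (2 - (c + (RtoC (INR p) + RtoC (INR q) + RtoC (INR s))))%C
      with (2 - (c + RtoC (INR p) + RtoC (INR q) + RtoC (INR s)))%C by ring. exact E. }
  specialize (H3 Hc').
  assert (H := carries_comp _ _ _ _ _ _ _ _ _ (carries_comp _ _ _ _ _ _ _ _ _ H1 H2) H3).
  eapply carries_eq; [exact H| | |reflexivity|].
  - rewrite !Cpoch_add. unfold Cpoch.
    rewrite (Cprod_ext (fun k => (1 - (c + RtoC (INR p) + RtoC (INR q) + RtoC (INR k))) * (1 -
        RtoC x))%C
      (fun k => (- (1 - RtoC x)) * (c - 1 + RtoC (INR (p + q)) + RtoC (INR k)))%C)
      by (intros; rewrite RtoC_INR_add; ring).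
    rewrite Cprod_scal.
    rewrite (Cprod_ext (fun k => c + RtoC (INR k) - 1)%C (fun k => c - 1 + RtoC (INR k))%C) by
        (intros; ring).
    rewrite (Cprod_ext (fun k => c + RtoC (INR p) + RtoC (INR k) - 1)%C
      (fun k => c - 1 + RtoC (INR p) + RtoC (INR k))%C) by (intros; ring).
    ring.
  - ring.
  - rewrite !RtoC_INR_add. f_equal. ring.
Qed.

(** * Polynomial functions *)

(** Generated by closure rules, so that polynomiality is checked by following the syntax.
    Coefficients are extracted only for leading terms and for Problem II. *)
Inductive is_poly : (C -> C) -> Prop :=
| is_poly_const c : is_poly (fun _ => c)
| is_poly_id : is_poly (fun w => w)
| is_poly_add f g : is_poly f -> is_poly g -> is_poly (fun w => f w + g w)%C
| is_poly_mul f g : is_poly f -> is_poly g -> is_poly (fun w => f w * g w)%C.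

Lemma is_poly_ext (f g : C -> C) : (forall w, f w = g w) -> is_poly f -> is_poly g.
Proof. intros H; replace g with f; [auto|]. now apply functional_extensionality. Qed.

Lemma is_poly_opp (f : C -> C) : is_poly f -> is_poly (fun w => - f w)%C.
Proof.
  intros H. apply is_poly_ext with (fun w => - (1) * f w)%C.
  - intros; ring.
  - apply is_poly_mul; [apply is_poly_const|exact H].
Qed.

Lemma is_poly_sub (f g : C -> C) : is_poly f -> is_poly g -> is_poly (fun w => f w - g w)%C.
Proof. intros; apply is_poly_add; [|apply is_poly_opp]; assumption. Qed.

Lemma is_poly_Cprod (f : nat -> C -> C) (n : nat) :
  (forall i, (i < n)%nat -> is_poly (f i)) -> is_poly (fun w => Cprod (fun i => f i w) n).
Proof.
  induction n as [|n IH]; intros H; simpl; [apply is_poly_const|].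
  apply is_poly_mul; [apply IH; intros; apply H; lia|apply H; lia].
Qed.

Lemma is_poly_comp (f g : C -> C) : is_poly f -> is_poly g -> is_poly (fun w => f (g w)).
Proof.
  intros Hf Hg. induction Hf.
  - apply is_poly_const.
  - exact Hg.
  - apply is_poly_add; assumption.
  - apply is_poly_mul; assumption.
Qed.

Lemma is_poly_pow (f : C -> C) (n : nat) : is_poly f -> is_poly (fun w => f w ^ n)%C.
Proof.
  intros Hf. induction n as [|n IH]; cbn [Cpow]; [apply is_poly_const|].
  apply is_poly_mul; assumption.
Qed.

Ltac poly := repeat first
  [ apply is_poly_const | apply is_poly_id | assumption
  | apply is_poly_sub | apply is_poly_add | apply is_poly_mul | apply is_poly_opp
  | apply is_poly_pow ].

Definition is_poly_mat (M : C -> mat2) : Prop :=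
  is_poly (fun w => m11 (M w)) /\ is_poly (fun w => m12 (M w)) /\
  is_poly (fun w => m21 (M w)) /\ is_poly (fun w => m22 (M w)).

Lemma is_poly_mat_mul (M N : C -> mat2) :
  is_poly_mat M -> is_poly_mat N -> is_poly_mat (fun w => mmul2 (M w) (N w)).
Proof.
  intros [H1 [H2 [H3 H4]]] [H5 [H6 [H7 H8]]].
  repeat split; simpl; poly.
Qed.

Lemma is_poly_chain_ac (n : nat) (a b c : C -> C) (x : R) :
  is_poly a -> is_poly b -> is_poly c ->
  is_poly_mat (fun w => chain_ac n (a w) (b w) (c w) x).
Proof.
  intros Ha Hb Hc. induction n as [|n IH].
  - repeat split; simpl; poly.
  - apply is_poly_mat_mul; [|exact IH]. repeat split; simpl; poly.
Qed.

Lemma is_poly_chain_c (n : nat) (a b c : C -> C) (x : R) :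
  is_poly a -> is_poly b -> is_poly c ->
  is_poly_mat (fun w => chain_c n (a w) (b w) (c w) x).
Proof.
  intros Ha Hb Hc. induction n as [|n IH].
  - repeat split; simpl; poly.
  - apply is_poly_mat_mul; [|exact IH]. repeat split; simpl; poly.
Qed.

Lemma is_poly_shift_mat (p q s : nat) (a b c : C -> C) (x : R) :
  is_poly a -> is_poly b -> is_poly c ->
  is_poly_mat (fun w => shift_mat p q s (a w) (b w) (c w) x).
Proof.
  intros Ha Hb Hc. unfold shift_mat.
  apply is_poly_mat_mul; [|apply is_poly_mat_mul].
  - apply (is_poly_chain_c s (fun w => a w + RtoC (INR p))%C (fun w => b w + RtoC (INR q))%C
      (fun w => c w + RtoC (INR p) + RtoC (INR q))%C); poly.
  - apply (is_poly_chain_ac q b (fun w => a w + RtoC (INR p))%C (fun w => c w + RtoC (INR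
      p))%C); poly.
  - apply is_poly_chain_ac; assumption.
Qed.

Lemma Cpoly_ext (c d : nat -> C) (N : nat) (w : C) :
  (forall k, (k <= N)%nat -> c k = d k) -> Cpoly c N w = Cpoly d N w.
Proof.
  intros H. unfold Cpoly. apply sum_n_ext_loc. intros k Hk. rewrite H by exact Hk. reflexivity.
Qed.

Lemma Cpoly_S (c : nat -> C) (N : nat) (w : C) :
  Cpoly c (S N) w = (Cpoly c N w + c (S N) * w ^ S N)%C.
Proof. unfold Cpoly. rewrite sum_Sn. reflexivity. Qed.

Lemma Cpoly_0 (c : nat -> C) (w : C) : Cpoly c 0 w = c 0%nat.
Proof. unfold Cpoly. rewrite sum_O. simpl. ring. Qed.

Lemma is_poly_Cpoly (c : nat -> C) (N : nat) : is_poly (Cpoly c N).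
Proof.
  induction N as [|N IH].
  - apply is_poly_ext with (fun _ => c 0%nat); [intros; rewrite Cpoly_0; reflexivity|poly].
  - apply is_poly_ext with (fun w => Cpoly c N w + c (S N) * w ^ S N)%C;
      [intros; rewrite Cpoly_S; reflexivity|poly].
Qed.

Definition Cpoly_like (f : C -> C) : Prop := exists c N, forall w, f w = Cpoly c N w.

Lemma Cpoly_pad (c : nat -> C) (N M : nat) (w : C) :
  (N <= M)%nat -> Cpoly (fun k => if (k <=? N)%nat then c k else RtoC 0) M w = Cpoly c N w.
Proof.
  intros H. induction M as [|M IH].
  - replace N with 0%nat by lia. apply Cpoly_ext. intros k Hk.
    replace k with 0%nat by lia. reflexivity.
  - destruct (Nat.eq_dec N (S M)) as [->|Hne].
    + apply Cpoly_ext. intros k Hk. apply Nat.leb_le in Hk. rewrite Hk. reflexivity.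
    + rewrite Cpoly_S, IH by lia.
      replace (S M <=? N)%nat with false by (symmetry; apply Nat.leb_gt; lia). ring.
Qed.

Lemma Cpoly_like_add (f g : C -> C) :
  Cpoly_like f -> Cpoly_like g -> Cpoly_like (fun w => f w + g w)%C.
Proof.
  intros [c [N Hc]] [d [M Hd]].
  exists (fun k => (if (k <=? N)%nat then c k else RtoC 0) + (if (k <=? M)%nat then d k else
      RtoC 0))%C, (max N M).
  intros w. rewrite Hc, Hd.
  rewrite <- (Cpoly_pad c N (max N M) w) by lia. rewrite <- (Cpoly_pad d M (max N M) w) by lia.
  generalize (max N M) as L. intros L. induction L as [|L IH].
  - rewrite !Cpoly_0. reflexivity.
  - rewrite !Cpoly_S, <- IH. ring.
Qed.

Lemma Cpoly_like_scal (k : C) (f : C -> C) : Cpoly_like f -> Cpoly_like (fun w => k * f w)%C.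
Proof.
  intros [c [N Hc]]. exists (fun i => k * c i)%C, N. intros w. rewrite Hc.
  induction N as [|N IH] in Hc |- *.
  - rewrite !Cpoly_0. reflexivity.
  - clear Hc. rewrite !Cpoly_S.
    replace (k * (Cpoly c N w + c (S N) * w ^ S N))%C
      with (k * Cpoly c N w + k * c (S N) * w ^ S N)%C by ring.
    f_equal. clear IH. induction N as [|N IH].
    + rewrite !Cpoly_0. reflexivity.
    + rewrite !Cpoly_S, <- IH. ring.
Qed.

Lemma Cpoly_like_X (f : C -> C) : Cpoly_like f -> Cpoly_like (fun w => w * f w)%C.
Proof.
  intros [c [N Hc]]. exists (fun i => match i with O => RtoC 0 | S j => c j end), (S N).
  intros w. rewrite Hc. clear Hc. induction N as [|N IH].
  - rewrite Cpoly_S, !Cpoly_0. simpl. ring.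
  - rewrite Cpoly_S, (Cpoly_S _ (S N)), <- IH. cbn [Cpow]. ring.
Qed.

Lemma Cpoly_like_ext (f g : C -> C) : (forall w, f w = g w) -> Cpoly_like f -> Cpoly_like g.
Proof. intros H [c [N Hc]]; exists c, N; intros; rewrite <- H; apply Hc. Qed.

Lemma Cpoly_like_mul_pow (f : C -> C) (n : nat) :
  Cpoly_like f -> Cpoly_like (fun w => w ^ n * f w)%C.
Proof.
  intros Hf. induction n as [|n IH].
  - eapply Cpoly_like_ext; [|exact Hf]. intros; cbn [Cpow]; ring.
  - eapply Cpoly_like_ext; [|apply Cpoly_like_X, IH]. intros; cbn [Cpow]; ring.
Qed.

Lemma is_poly_Cpoly_like (f : C -> C) : is_poly f -> Cpoly_like f.
Proof.
  intros H. induction H as [c| |f g Hf IHf Hg IHg|f g Hf IHf Hg IHg].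
  - exists (fun _ => c), 0%nat. intros; rewrite Cpoly_0; reflexivity.
  - exists (fun k => match k with O => RtoC 0 | S _ => RtoC 1 end), 1%nat.
    intros w. rewrite Cpoly_S, Cpoly_0. simpl. ring.
  - apply Cpoly_like_add; assumption.
  - destruct IHf as [c [N Hc]].
    apply Cpoly_like_ext with (fun w => Cpoly c N w * g w)%C; [intros; rewrite Hc; reflexivity|].
    clear Hc. induction N as [|N IH].
    + eapply Cpoly_like_ext; [|apply (Cpoly_like_scal (c 0%nat)), IHg].
      intros; rewrite Cpoly_0; reflexivity.
    + eapply Cpoly_like_ext; [|apply Cpoly_like_add; [exact IH|]].
      2:{ apply (Cpoly_like_scal (c (S N))), (Cpoly_like_mul_pow g (S N)), IHg. }
      intros; rewrite Cpoly_S. ring.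
Qed.

Lemma Cpoly_leading (c : nat -> C) (N : nat) :
  (forall k, (k <= N)%nat -> c k = 0) \/
  exists e v K, v <> RtoC 0 /\ 0 <= K /\ forall w, 1 <= Cmod w ->
    Cmod (Cpoly c N w - v * w ^ e) * Cmod w <= K * Cmod w ^ e.
Proof.
  assert (HB : forall M, exists K, 0 <= K /\ forall w, 1 <= Cmod w -> Cmod (Cpoly c M w) <= K *
      Cmod w ^ M).
  { induction M as [|M [K [HK IH]]].
    - exists (Cmod (c 0%nat)). split; [apply Cmod_ge_0|]. intros w _. rewrite Cpoly_0. simpl. lra.
    - exists (K + Cmod (c (S M))). split; [generalize (Cmod_ge_0 (c (S M))); lra|].
      intros w Hw. rewrite Cpoly_S. eapply Rle_trans; [apply Cmod_triangle|].
      rewrite Cmod_mult, Cmod_pow, Rmult_plus_distr_r. apply Rplus_le_compat_r.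
      eapply Rle_trans; [apply IH, Hw|]. apply Rmult_le_compat_l; [exact HK|].
      simpl. rewrite <- (Rmult_1_l (Cmod w ^ M)) at 1.
      apply Rmult_le_compat_r; [apply pow_le; lra|lra]. }
  induction N as [|N IH].
  - destruct (Ceq_dec (c 0%nat) 0) as [E|E].
    + left. intros k Hk. replace k with 0%nat by lia. exact E.
    + right. exists 0%nat, (c 0%nat), 0. split; [exact E|]. split; [lra|]. intros w _.
      rewrite Cpoly_0. simpl. replace (c 0%nat - c 0%nat * 1)%C with (RtoC 0) by ring.
      rewrite Cmod_0. lra.
  - destruct (Ceq_dec (c (S N)) 0) as [E|E].
    + destruct IH as [IH|[e [v [K [Hv [HK IH]]]]]].
      * left. intros k Hk. destruct (Nat.eq_dec k (S N)) as [->|Hne]; [exact E|apply IH; lia].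
      * right. exists e, v, K. split; [exact Hv|]. split; [exact HK|]. intros w Hw.
        rewrite Cpoly_S, E. replace (Cpoly c N w + 0 * w ^ S N)%C with (Cpoly c N w) by ring.
        apply IH, Hw.
    + right. destruct (HB N) as [K [HK H]]. exists (S N), (c (S N)), K.
      split; [exact E|]. split; [exact HK|]. intros w Hw. rewrite Cpoly_S.
      replace (Cpoly c N w + c (S N) * w ^ S N - c (S N) * w ^ S N)%C with (Cpoly c N w) by ring.
      simpl. rewrite (Rmult_comm (Cmod w)), <- Rmult_assoc.
      apply Rmult_le_compat_r; [lra|]. apply H, Hw.
Qed.

Lemma Cpoly_all_0 (c : nat -> C) (N : nat) (w : C) :
  (forall k, (k <= N)%nat -> c k = 0) -> Cpoly c N w = 0.
Proof.
  induction N as [|N IH]; intros H.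
  - rewrite Cpoly_0. apply H; lia.
  - rewrite Cpoly_S, IH, H by (intros; try apply H; lia). ring.
Qed.

Lemma is_poly_leading (f : C -> C) :
  is_poly f ->
  (forall w, f w = 0) \/
  exists e v K, v <> RtoC 0 /\ 0 <= K /\ forall w, 1 <= Cmod w ->
    Cmod (f w / w ^ e - v) <= K / Cmod w.
Proof.
  intros Hf. destruct (is_poly_Cpoly_like f Hf) as [c [N Hc]].
  destruct (Cpoly_leading c N) as [H|[e [v [K [Hv [HK H]]]]]].
  - left. intros w. rewrite Hc. apply Cpoly_all_0, H.
  - right. exists e, v, K. split; [exact Hv|]. split; [exact HK|]. intros w Hw.
    assert (Hw0 : w <> 0) by (intro E; rewrite E, Cmod_0 in Hw; lra).
    assert (Hwe : (w ^ e)%C <> 0) by (apply Cpow_nz, Hw0).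
    rewrite Hc. replace (Cpoly c N w / w ^ e - v)%C with ((Cpoly c N w - v * w ^ e) / w ^ e)%C
        by (field; exact Hwe).
    rewrite Cmod_div, Cmod_pow by exact Hwe.
    assert (Hp : 0 < Cmod w ^ e) by (apply pow_lt; lra).
    apply Rmult_le_reg_r with (Cmod w ^ e * Cmod w); [apply Rmult_lt_0_compat; lra|].
    replace (Cmod (Cpoly c N w - v * w ^ e) / Cmod w ^ e * (Cmod w ^ e * Cmod w))
      with (Cmod (Cpoly c N w - v * w ^ e) * Cmod w) by (field; lra).
    replace (K / Cmod w * (Cmod w ^ e * Cmod w)) with (K * Cmod w ^ e) by (field; lra).
    apply H, Hw.
Qed.

Lemma is_poly_large_neq_0 (f : C -> C) :
  is_poly f -> ~ (forall w, f w = 0) -> exists M, forall w, M < Cmod w -> f w <> 0.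
Proof.
  intros Hf Hne. destruct (is_poly_leading f Hf) as [H|[e [v [K [Hv [HK H]]]]]]; [contradiction|].
  apply Cmod_gt_0 in Hv.
  exists (Rmax 1 (K / Cmod v)). intros w Hw E.
  assert (H1 := Rmax_l 1 (K / Cmod v)). assert (H2 := Rmax_r 1 (K / Cmod v)).
  specialize (H w ltac:(lra)). rewrite E in H.
  replace (0 / w ^ e - v)%C with (- v)%C in H by (unfold Cdiv; ring).
  rewrite Cmod_opp in H. apply (Rmult_le_compat_r (Cmod w)) in H; [|lra].
  replace (K / Cmod w * Cmod w) with K in H by (field; lra).
  assert (K / Cmod v * Cmod v < Cmod w * Cmod v) by (apply Rmult_lt_compat_r; lra).
  replace (K / Cmod v * Cmod v) with K in H0 by (field; lra). lra.
Qed.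

(** An identity is first obtained at large natural numbers, where [hgf] is positive and can be
    cancelled; this extends it to all of C. *)
Lemma is_poly_eventually_0 (f : C -> C) :
  is_poly f -> eventually (fun n => f (RtoC (INR n)) = 0) -> forall w, f w = 0.
Proof.
  intros Hf [N HN]. destruct (classic (forall w, f w = 0)) as [H|H]; [exact H|].
  destruct (is_poly_large_neq_0 f Hf H) as [M HM].
  destruct (eventually_INR_gt M) as [N1 HN1].
  exfalso. apply (HM (RtoC (INR (max N N1)))).
  - rewrite Cmod_R, Rabs_pos_eq by apply pos_INR. apply HN1; lia.
  - apply HN; lia.
Qed.

Lemma is_poly_mul_neq_0 (f g : C -> C) :
  is_poly f -> is_poly g -> ~ (forall w, f w = 0) -> ~ (forall w, g w = 0) ->
  ~ (forall w, (f w * g w)%C = 0).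
Proof.
  intros Hf Hg Hf0 Hg0 H.
  destruct (is_poly_large_neq_0 f Hf Hf0) as [M1 HM1].
  destruct (is_poly_large_neq_0 g Hg Hg0) as [M2 HM2].
  set (t := Rmax 0 (Rmax M1 M2) + 1).
  assert (B1 := Rmax_l 0 (Rmax M1 M2)). assert (B2 := Rmax_r 0 (Rmax M1 M2)).
  assert (B3 := Rmax_l M1 M2). assert (B4 := Rmax_r M1 M2).
  assert (Ht : Cmod (RtoC t) = t) by (rewrite Cmod_R, Rabs_pos_eq; unfold t; lra).
  apply (Cmult_neq_0 (f (RtoC t)) (g (RtoC t))); [apply HM1|apply HM2|apply H]; rewrite Ht;
      unfold t; lra.
Qed.

(** * Concentration of the terms at large positive parameters *)

(** Defined through the quotient of consecutive terms, so that signs propagate by induction on the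
    index. *)
Fixpoint rterm (A B D x : R) (k : nat) : R :=
  match k with
  | O => 1
  | S j => rterm A B D x j * (x * (A + INR j) * (B + INR j) / ((INR j + 1) * (D + INR j)))
  end.

Definition rmom (m : nat) (A B D x : R) : R :=
  Series (fun k => INR k ^ m * rterm A B D x k).

Lemma real_not_nonpos_int (D : R) : ~ nonpos_int (RtoC D) -> forall k, D + INR k <> 0.
Proof.
  intros H k E. apply H. exists k. f_equal. lra.
Qed.

Lemma pos_not_nonpos_int (z : C) : 0 < Re z -> ~ nonpos_int z.
Proof.
  intros Hz [k E]. rewrite E in Hz. simpl in Hz. generalize (pos_INR k); lra.
Qed.

Lemma hterm_RtoC (A B D x : R) (k : nat) :
  ~ nonpos_int (RtoC D) ->
  hterm (RtoC A) (RtoC B) (RtoC D) x k = RtoC (rterm A B D x k).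
Proof.
  intros HD. induction k as [|k IH].
  - unfold hterm, Cpoch; simpl. field.
  - assert (E := hterm_S (RtoC A) (RtoC B) (RtoC D) x k HD). rewrite IH in E.
    assert (Hk : D + INR k <> 0) by (apply real_not_nonpos_int, HD).
    assert (HC : (RtoC (INR (S k)) * (RtoC D + RtoC (INR k)))%C <> 0).
    { apply Cmult_neq_0; [rewrite RtoC_INR_S; apply INR_S_C_neq_0|apply nonpos_int_neq, HD]. }
    transitivity ((RtoC (INR (S k)) * (RtoC D + RtoC (INR k)) * hterm (RtoC A) (RtoC B) (RtoC
        D) x (S k))
      / (RtoC (INR (S k)) * (RtoC D + RtoC (INR k))))%C.
    { field. split; [apply nonpos_int_neq, HD|rewrite RtoC_INR_S; apply INR_S_C_neq_0]. }
    rewrite E. cbn [rterm]. rewrite S_INR in *.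
    rewrite <- !RtoC_plus, <- !RtoC_mult in *. rewrite <- RtoC_div.
    + f_equal. field. generalize (pos_INR k); intros; split; [exact Hk|lra].
    + intro E0. apply HC. rewrite E0. reflexivity.
Qed.

Lemma rmom_correct (m : nat) (A B D x : R) :
  0 < x < 1 -> ~ nonpos_int (RtoC D) ->
  is_series (fun k => INR k ^ m * rterm A B D x k) (rmom m A B D x) /\
  hmom m (RtoC A) (RtoC B) (RtoC D) x = RtoC (rmom m A B D x).
Proof.
  intros Hx HD.
  assert (H := hmom_correct m (RtoC A) (RtoC B) (RtoC D) x Hx HD).
  assert (H' : is_Cseries (fun k => RtoC (INR k ^ m * rterm A B D x k)) (hmom m (RtoC A) (RtoC
      B) (RtoC D) x)).
  { eapply is_Cseries_ext; [|exact H]. intros k. cbv beta.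
    rewrite hterm_RtoC by exact HD. rewrite RtoC_mult. reflexivity. }
  destruct H' as [H1 H2]. simpl in H1.
  assert (E : is_series (fun k => INR k ^ m * rterm A B D x k) (rmom m A B D x)).
  { apply Series_correct. eexists. exact H1. }
  split; [exact E|].
  apply (is_Cseries_unique (fun k => RtoC (INR k ^ m * rterm A B D x k))).
  - split; assumption.
  - apply is_Cseries_RtoC, E.
Qed.

Lemma rterm_pos (A B D x : R) (k : nat) :
  0 < A -> 0 < B -> 0 < D -> 0 < x -> 0 < rterm A B D x k.
Proof.
  intros HA HB HD Hx. induction k as [|k IH]; simpl; [lra|].
  generalize (pos_INR k); intro Hk.
  apply Rmult_lt_0_compat; [exact IH|]. apply Rdiv_lt_0_compat; repeat apply Rmult_lt_0_compat; lra.
Qed.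

Lemma Series_nonneg (u : nat -> R) : ex_series u -> (forall n, 0 <= u n) -> 0 <= Series u.
Proof.
  intros H Hu. rewrite <- (Rmult_0_l (Series u)), <- Series_scal_l.
  apply Series_le; [|exact H]. intros n. specialize (Hu n). lra.
Qed.

(** The terms are positive weights, so every cubic that is nonnegative on the naturals yields an
    inequality between moments. The inequalities used later come from squares, possibly multiplied
    by the index. *)
Lemma rmom_nonneg (A B D x c0 c1 c2 c3 : R) :
  0 < A -> 0 < B -> 0 < D -> 0 < x < 1 ->
  (forall k : nat, 0 <= c0 + c1 * INR k + c2 * INR k ^ 2 + c3 * INR k ^ 3) ->
  0 <= c0 * rmom 0 A B D x + c1 * rmom 1 A B D x + c2 * rmom 2 A B D x + c3 * rmom 3 A B D x.
Proof.
  intros HA HB HD Hx Hc.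
  assert (HD' : ~ nonpos_int (RtoC D)) by (apply pos_not_nonpos_int; simpl; exact HD).
  assert (H : forall m, is_series (fun k => INR k ^ m * rterm A B D x k) (rmom m A B D x))
    by (intros m; apply rmom_correct; assumption).
  assert (HS := is_series_plus _ _ _ _ (is_series_plus _ _ _ _ (is_series_plus _ _ _ _
    (is_series_scal c0 _ _ (H 0%nat)) (is_series_scal c1 _ _ (H 1%nat)))
    (is_series_scal c2 _ _ (H 2%nat))) (is_series_scal c3 _ _ (H 3%nat))).
  assert (HS' : is_series (fun k => (c0 + c1 * INR k + c2 * INR k ^ 2 + c3 * INR k ^ 3) * rterm
      A B D x k)
     (c0 * rmom 0 A B D x + c1 * rmom 1 A B D x + c2 * rmom 2 A B D x + c3 * rmom 3 A B D x)).
  { eapply is_series_ext; [|exact HS]. intros k. unfold plus, scal; simpl. unfold mult; simpl.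
  ring. }
  rewrite <- (is_series_unique _ _ HS').
  apply Series_nonneg; [eexists; exact HS'|]. intros k.
  apply Rmult_le_pos; [apply Hc|]. apply Rlt_le, rterm_pos; lra.
Qed.

Lemma rmom_0_pos (A B D x : R) :
  0 < A -> 0 < B -> 0 < D -> 0 < x < 1 -> 0 < rmom 0 A B D x.
Proof.
  intros HA HB HD Hx.
  assert (HD' : ~ nonpos_int (RtoC D)) by (apply pos_not_nonpos_int; simpl; exact HD).
  destruct (rmom_correct 0 A B D x Hx HD') as [H _].
  rewrite <- (is_series_unique _ _ H).
  rewrite Series_incr_1 by (eexists; exact H).
  assert (0 <= Series (fun k => INR (S k) ^ 0 * rterm A B D x (S k))).
  { apply Series_nonneg.
    - apply (ex_series_incr_1 (fun k => INR k ^ 0 * rterm A B D x k)). eexists; exact H.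
    - intros k. assert (0 < rterm A B D x (S k)) by (apply rterm_pos; lra). simpl pow. lra. }
  simpl (rterm A B D x 0) in *. simpl pow in *. lra.
Qed.

(** The instance of [hmom_rec] with weight [k - 1] in place of 1. *)
Lemma hmom3 (a b c : C) (x : R) :
  0 < x < 1 -> ~ nonpos_int c ->
  ((1 - RtoC x) * hmom 3 a b c x)%C =
  ((RtoC x * (a + b) - c + 2) * hmom 2 a b c x + (a * b * RtoC x + c - 1) * hmom 1 a b c x)%C.
Proof.
  intros Hx Hc.
  assert (H1 := hmom_correct 1 a b c x Hx Hc).
  assert (H2 := hmom_correct 2 a b c x Hx Hc).
  assert (H3 := hmom_correct 3 a b c x Hx Hc).
  set (T3 := hmom 3 a b c x) in *. set (T1 := hmom 1 a b c x) in *. set (T2 := hmom 2 a b c x) in *.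
  assert (E : (- (c - 1) * T1 + (c - 2) * T2 + 1 * T3 = RtoC x * a * b * T1 + RtoC x * (a + b)
      * T2 + RtoC x * T3)%C).
  { apply (hmom_rec (fun k => RtoC (INR k) - 1)%C _ _ a b c x Hc);
      eapply is_Cseries_lin3; [exact H1|exact H2|exact H3| |exact H1|exact H2|exact H3|];
      intros k; cbv beta; rewrite !RtoC_pow_INR; cbn [Cpow];
      rewrite ?RtoC_INR_S, ?(RtoC_plus 1 1 : RtoC 2 = _); ring. }
  assert (E2 : (T3 = RtoC x * T3 + (RtoC x * a * b * T1 + RtoC x * (a + b) * T2 + (c - 1) * T1
      - (c - 2) * T2))%C).
  { replace T3 with (- (c - 1) * T1 + (c - 2) * T2 + 1 * T3 + ((c - 1) * T1 - (c - 2) * T2))%C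
      at 1 by ring.
    rewrite E. ring. }
  replace ((1 - RtoC x) * T3)%C with (T3 - RtoC x * T3)%C by ring. rewrite E2 at 1. ring.
Qed.

Lemma rmom2 (A B D x : R) :
  0 < x < 1 -> ~ nonpos_int (RtoC D) ->
  (1 - x) * rmom 2 A B D x = (x * (A + B) - D + 1) * rmom 1 A B D x + A * B * x * rmom 0 A B D x.
Proof.
  intros Hx HD. assert (E := hmom2 (RtoC A) (RtoC B) (RtoC D) x Hx HD).
  rewrite !(fun m => proj2 (rmom_correct m A B D x Hx HD)) in E.
  apply RtoC_inj. rewrite ?RtoC_plus, ?RtoC_mult, ?RtoC_minus, ?RtoC_plus, ?RtoC_mult,
      ?RtoC_minus, ?RtoC_plus, ?RtoC_mult, ?RtoC_plus. exact E.
Qed.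

Lemma rmom3 (A B D x : R) :
  0 < x < 1 -> ~ nonpos_int (RtoC D) ->
  (1 - x) * rmom 3 A B D x = (x * (A + B) - D + 2) * rmom 2 A B D x + (A * B * x + D - 1) *
      rmom 1 A B D x.
Proof.
  intros Hx HD. assert (E := hmom3 (RtoC A) (RtoC B) (RtoC D) x Hx HD).
  rewrite !(fun m => proj2 (rmom_correct m A B D x Hx HD)) in E.
  apply RtoC_inj. rewrite ?RtoC_plus, ?RtoC_mult, ?RtoC_minus, ?RtoC_plus, ?RtoC_mult,
      ?RtoC_minus, ?RtoC_plus, ?RtoC_mult, ?RtoC_minus, ?RtoC_plus, ?RtoC_mult, ?RtoC_plus. exact E.
Qed.

(* The positive root of (1-x) k^2 = (x(p+q)-r) k + pqx: the terms at w = n peak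
   near the index [kappa * n]. *)
Definition kappa (p q r x : R) : R :=
  let s := x * (p + q) - r in
  (s + sqrt (s ^ 2 + 4 * (1 - x) * (p * q * x))) / (2 * (1 - x)).

(** Vieta's formulas: the product of the two roots is negative, so one root is positive and the
    other negative. *)
Lemma kappa_spec (p q r x : R) :
  0 < p -> 0 < q -> 0 < x < 1 ->
  exists k', 0 < kappa p q r x /\ k' < 0 /\
    (1 - x) * (kappa p q r x + k') = x * (p + q) - r /\
    (1 - x) * (kappa p q r x * k') = - (p * q * x).
Proof.
  intros Hp Hq Hx. unfold kappa. set (s := x * (p + q) - r). set (m := p * q * x).
  assert (Hm : 0 < m) by (unfold m; repeat apply Rmult_lt_0_compat; lra).
  set (d := sqrt (s ^ 2 + 4 * (1 - x) * m)).
  assert (Hd2 : d * d = s ^ 2 + 4 * (1 - x) * m).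
  { apply sqrt_sqrt. assert (0 <= s ^ 2) by apply pow2_ge_0. nra. }
  assert (Hd0 : 0 <= d) by apply sqrt_pos.
  assert (Hsd : Rabs s < d).
  { rewrite <- (Rabs_pos_eq d) by exact Hd0. apply Rsqr_lt_abs_0.
    unfold Rsqr. nra. }
  apply Rabs_def2 in Hsd.
  exists ((s - d) / (2 * (1 - x))). repeat split.
  - apply Rdiv_lt_0_compat; lra.
  - apply Ropp_lt_cancel. rewrite Ropp_0.
    replace (- ((s - d) / (2 * (1 - x)))) with ((d - s) / (2 * (1 - x))) by (field; lra).
    apply Rdiv_lt_0_compat; lra.
  - field; lra.
  - replace ((s + d) / (2 * (1 - x)) * ((s - d) / (2 * (1 - x))))
      with ((s ^ 2 - d * d) / (4 * (1 - x) ^ 2)) by (field; lra).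
    rewrite Hd2. field; lra.
Qed.

Lemma eventually_affine_ge (p a : R) :
  0 < p -> exists N, forall n, (N <= n)%nat -> p / 2 * INR n < p * INR n + a.
Proof.
  intros Hp. destruct (eventually_INR_gt (2 * Rabs a / p)) as [N HN].
  exists N. intros n Hn. specialize (HN n Hn).
  apply (Rmult_lt_compat_l p) in HN; [|exact Hp].
  replace (p * (2 * Rabs a / p)) with (2 * Rabs a) in HN by (field; lra).
  assert (H := Rle_abs (- a)). rewrite Rabs_Ropp in H. lra.
Qed.

(* The moment recursions bound E[(y-k)^2 (y-k')], y the rescaled index and k' < 0
   the other root, by O(1/n) E[1+y^2]: a second-moment method without any
   estimate on individual terms. *)
Lemma concentration (p q r a b x : R) :
  0 < p -> 0 < q -> 0 < r -> 0 < x < 1 ->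
  exists K N, 0 <= K /\ forall n, (N <= n)%nat ->
    let n' := INR n in let k0 := kappa p q r x in
    let T m := rmom m (p * n' + a) (q * n' + b) (r * n') x in
    1 <= n' /\ p / 2 * n' < p * n' + a /\ q / 2 * n' < q * n' + b /\
    T 2%nat - 2 * k0 * n' * T 1%nat + k0 ^ 2 * n' ^ 2 * T 0%nat <= K * n' * T 0%nat.
Proof.
  intros Hp Hq Hr Hx.
  destruct (kappa_spec p q r x Hp Hq Hx) as [k' [Hk0 [Hk' [Esum Eprod]]]].
  set (k0 := kappa p q r x) in *.
  set (s1 := x * (a + b) + 1). set (m1 := x * (p * b + q * a)). set (m2 := x * a * b).
  (* [c0] dominates the coefficients of [T2], [n' T1] and [n'^2 T0] on the right of [Emain]. *)
  set (c0 := Rabs (s1 + 1) + (Rabs m1 + Rabs m2 + r + 1) + k0 * Rabs s1 + k0 * (Rabs m1 + Rabs m2)).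
  assert (Hc0 : 0 < c0).
  { unfold c0. generalize (Rabs_pos (s1 + 1)) (Rabs_pos m1) (Rabs_pos m2) (Rabs_pos s1);
      intros. nra. }
  set (g := (1 - x) * - k'). assert (Hg : 0 < g) by (unfold g; apply Rmult_lt_0_compat; lra).
  destruct (eventually_affine_ge p a Hp) as [N1 HN1].
  destruct (eventually_affine_ge q b Hq) as [N2 HN2].
  (* Makes [g n'] at least [8 c0], so that the term [4 c0 V] in [R2] is at most half of [g n' V]. *)
  destruct (eventually_INR_gt (8 * c0 / g + 1)) as [N3 HN3].
  set (K := 4 * c0 * (2 * k0 ^ 2 + 1) / g).
  exists K, (max N1 (max N2 N3)).
  assert (HK : 0 <= K).
  { unfold K. apply Rmult_le_pos; [|apply Rlt_le, Rinv_0_lt_compat, Hg].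
    generalize (pow2_ge_0 k0); intro. apply Rmult_le_pos; lra. }
  split; [exact HK|]. intros n Hn. cbv zeta.
  specialize (HN1 n ltac:(lia)). specialize (HN2 n ltac:(lia)). specialize (HN3 n ltac:(lia)).
  set (n' := INR n) in *.
  assert (H8 : 0 < 8 * c0 / g) by (apply Rdiv_lt_0_compat; lra).
  assert (Hn1 : 1 <= n') by lra.
  assert (Hgn : 8 * c0 <= g * n').
  { apply Rle_trans with (g * (8 * c0 / g)); [right; field; lra|]. apply Rmult_le_compat_l; lra. }
  repeat split; try assumption.
  set (A := p * n' + a) in *. set (B := q * n' + b) in *. set (D := r * n') in *.
  assert (HA : 0 < A) by nra. assert (HB : 0 < B) by nra. assert (HD : 0 < D) by (unfold D; nra).
  assert (HD' : ~ nonpos_int (RtoC D)) by (apply pos_not_nonpos_int; simpl; exact HD).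
  assert (E2 := rmom2 A B D x Hx HD'). assert (E3 := rmom3 A B D x Hx HD').
  assert (HT := rmom_nonneg A B D x).
  set (T0 := rmom 0 A B D x) in *. set (T1 := rmom 1 A B D x) in *.
  set (T2 := rmom 2 A B D x) in *. set (T3 := rmom 3 A B D x) in *.
  assert (P0 : 0 < T0) by (apply rmom_0_pos; assumption).
  assert (P1 : 0 <= T1).
  { generalize (HT 0 1 0 0 HA HB HD Hx). intros H. lapply H; [lra|]. intros k.
  generalize (pos_INR k); lra. }
  assert (P2 : 0 <= T2).
  { generalize (HT 0 0 1 0 HA HB HD Hx). intros H. lapply H; [lra|]. intros k.
  generalize (pow2_ge_0 (INR k)); lra. }
  assert (PV : 0 <= k0 ^ 2 * n' ^ 2 * T0 + (- (2 * k0 * n')) * T1 + 1 * T2 + 0 * T3).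
  { apply HT; auto. intros k.
    replace (k0 ^ 2 * n' ^ 2 + - (2 * k0 * n') * INR k + 1 * INR k ^ 2 + 0 * INR k ^ 3)
      with ((INR k - k0 * n') ^ 2) by ring. apply pow2_ge_0. }
  assert (PW : 0 <= 0 * T0 + k0 ^ 2 * n' ^ 2 * T1 + (- (2 * k0 * n')) * T2 + 1 * T3).
  { apply HT; auto. intros k.
    replace (0 + k0 ^ 2 * n' ^ 2 * INR k + - (2 * k0 * n') * INR k ^ 2 + 1 * INR k ^ 3)
      with (INR k * (INR k - k0 * n') ^ 2) by ring.
    apply Rmult_le_pos; [apply pos_INR|apply pow2_ge_0]. }
  assert (PN : 0 <= n' ^ 2 * T0 + (- (2 * n')) * T1 + 1 * T2 + 0 * T3).
  { apply HT; auto. intros k.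
    replace (n' ^ 2 + - (2 * n') * INR k + 1 * INR k ^ 2 + 0 * INR k ^ 3)
      with ((INR k - n') ^ 2) by ring. apply pow2_ge_0. }
  assert (P4 : 0 <= 4 * k0 ^ 2 * n' ^ 2 * T0 + (- (4 * k0 * n')) * T1 + 1 * T2 + 0 * T3).
  { apply HT; auto. intros k.
    replace (4 * k0 ^ 2 * n' ^ 2 + - (4 * k0 * n') * INR k + 1 * INR k ^ 2 + 0 * INR k ^ 3)
      with ((INR k - 2 * k0 * n') ^ 2) by ring. apply pow2_ge_0. }
  set (V := T2 - 2 * k0 * n' * T1 + k0 ^ 2 * n' ^ 2 * T0).
  set (W := T3 - 2 * k0 * n' * T2 + k0 ^ 2 * n' ^ 2 * T1).
  assert (HV : 0 <= V) by (unfold V; lra). assert (HW : 0 <= W) by (unfold W; lra).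
  (* The left side is [1 - x] times the sum of the terms weighted by [(k - k0 n')^2 (k - k' n')]. As
     [k0] and [k'] are the roots of the limiting quadratic, the recursions cancel the leading order,
     and what remains is smaller by one power of [n']. *)
  assert (Emain : (1 - x) * W + g * n' * V =
    (s1 + 1) * T2 + (m1 * n' + m2 + r * n' - 1) * T1 - k0 * n' * (s1 * T1 + (m1 * n' + m2) * T0)).
  { replace ((1 - x) * W + g * n' * V)
      with ((1 - x) * T3 - ((1 - x) * (k0 + k')) * n' * T2 + ((1 - x) * (k0 * k')) * n' ^ 2 * T1
            - k0 * n' * ((1 - x) * T2 - ((1 - x) * (k0 + k')) * n' * T1 + ((1 - x) * (k0 * k'))
                * n' ^ 2 * T0))
      by (unfold W, V, g; ring).
    rewrite Esum, Eprod, E2, E3. unfold s1, m1, m2, A, B, D. ring. }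
  assert (Hle : forall u v, 0 <= v -> u * v <= Rabs u * v)
    by (intros u v Hv; apply Rmult_le_compat_r; [exact Hv|apply Rle_abs]).
  assert (Hle' : forall u v, 0 <= v -> - (u * v) <= Rabs u * v).
  { intros u v Hv. rewrite <- Rabs_Ropp. replace (- (u * v)) with (- u * v) by ring.
  apply Hle, Hv. }
  assert (NT1 : 0 <= n' * T1) by (apply Rmult_le_pos; lra).
  assert (NT0 : 0 <= n' * T0) by (apply Rmult_le_pos; lra).
  assert (T1N : T1 <= n' * T1) by nra.
  assert (N2T0 : n' * T0 <= n' ^ 2 * T0) by (simpl; nra).
  assert (B1 : (s1 + 1) * T2 <= Rabs (s1 + 1) * T2) by (apply Hle, P2).
  assert (B2 : m1 * (n' * T1) <= Rabs m1 * (n' * T1)) by (apply Hle, NT1).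
  assert (B3 : m2 * T1 <= Rabs m2 * (n' * T1)).
  { eapply Rle_trans; [apply Hle, P1|]. apply Rmult_le_compat_l; [apply Rabs_pos|exact T1N]. }
  assert (B4 : - (s1 * (n' * T1)) <= Rabs s1 * (n' * T1)) by (apply Hle', NT1).
  assert (B5 : - (m1 * (n' ^ 2 * T0)) <= Rabs m1 * (n' ^ 2 * T0)) by (apply Hle'; lra).
  assert (B6 : - (m2 * (n' * T0)) <= Rabs m2 * (n' ^ 2 * T0)).
  { eapply Rle_trans; [apply Hle', NT0|]. apply Rmult_le_compat_l; [apply Rabs_pos|exact N2T0]. }
  assert (R1 : (1 - x) * W + g * n' * V <= c0 * (T2 + n' * T1 + n' ^ 2 * T0)).
  { rewrite Emain.
    assert (k0 * (- (s1 * (n' * T1)) - m1 * (n' ^ 2 * T0) - m2 * (n' * T0))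
      <= k0 * (Rabs s1 * (n' * T1) + Rabs m1 * (n' ^ 2 * T0) + Rabs m2 * (n' ^ 2 * T0)))
      by (apply Rmult_le_compat_l; lra).
    assert (Hs : 0 <= Rabs (s1 + 1)) by apply Rabs_pos.
    assert (Ha1 : 0 <= Rabs s1) by apply Rabs_pos.
    assert (Ha2 : 0 <= Rabs m1) by apply Rabs_pos.
    assert (Ha3 : 0 <= Rabs m2) by apply Rabs_pos.
    assert (Z1 : 0 <= (c0 - Rabs (s1 + 1)) * T2).
    { apply Rmult_le_pos; [unfold c0; nra|exact P2]. }
    assert (Z2 : 0 <= (c0 - (Rabs m1 + Rabs m2 + r) - k0 * Rabs s1) * (n' * T1)).
    { apply Rmult_le_pos; [unfold c0; nra|exact NT1]. }
    assert (Z3 : 0 <= (c0 - k0 * (Rabs m1 + Rabs m2)) * (n' ^ 2 * T0)).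
    { apply Rmult_le_pos; [unfold c0; nra|lra]. }
    lra. }
  (* [W] is dropped, being nonnegative; [T1] is absorbed by [PN], and [T2] is bounded in terms of
     [V] by [P4]. *)
  assert (R2 : g * n' * V <= 2 * c0 * (2 * V + (2 * k0 ^ 2 + 1) * (n' ^ 2 * T0))).
  { assert (0 <= (1 - x) * W) by (apply Rmult_le_pos; lra).
    assert (T2 + n' * T1 + n' ^ 2 * T0 <= 2 * (T2 + n' ^ 2 * T0)) by lra.
    assert (c0 * (T2 + n' * T1 + n' ^ 2 * T0) <= c0 * (2 * (T2 + n' ^ 2 * T0))) by (apply
        Rmult_le_compat_l; lra).
    assert (T2 <= 2 * V + 2 * k0 ^ 2 * n' ^ 2 * T0) by (unfold V; lra).
    assert (c0 * (2 * (T2 + n' ^ 2 * T0)) <= c0 * (2 * (2 * V + 2 * k0 ^ 2 * n' ^ 2 * T0 + n' ^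
        2 * T0))) by (apply Rmult_le_compat_l; lra).
    lra. }
  fold V.
  assert (R3 : g * n' * V <= 4 * c0 * (2 * k0 ^ 2 + 1) * (n' ^ 2 * T0)).
  { assert (8 * c0 * V <= g * n' * V) by (apply Rmult_le_compat_r; assumption). lra. }
  apply Rmult_le_reg_l with (g * n'); [apply Rmult_lt_0_compat; lra|].
  eapply Rle_trans; [exact R3|]. right. unfold K. field. lra.
Qed.

(** * Asymptotics of f(n + w) / f(n) *)

(** The logarithm of [phi]. Moving the argument by [w] multiplies a term by about [((A+k)/A)^(p w)
    ((B+k)/B)^(q w) ((D+k)/D)^(-r w)], and at the peak [k = kappa n] the bases are close to
    [1 + kappa/p], [1 + kappa/q] and [1 + kappa/r]. *)
Definition log_growth (p q r x : R) : R :=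
  let k := kappa p q r x in
  p * ln (1 + k / p) + q * ln (1 + k / q) - r * ln (1 + k / r).

Lemma Cpoch_gauss_prod (z : C) (A : R) (k : nat) :
  0 < A ->
  Cpoch (RtoC A + z) k =
  (gauss_prod z A k * Cpoch (RtoC A) k * Cexp (z * RtoC (ln ((A + INR k) / A))))%C.
Proof.
  intros HA. rewrite gauss_prod_Cpoch by exact HA.
  replace (- z * RtoC (ln ((A + INR k) / A)))%C with (- (z * RtoC (ln ((A + INR k) / A))))%C by
      ring.
  rewrite Cexp_opp. field. split; [apply Cexp_neq_0|apply Cpoch_pos_neq_0, HA].
Qed.

Lemma hterm_ratio (A B D x : R) (z1 z2 z3 : C) (k : nat) :
  0 < A -> 0 < B -> 0 < D -> gauss_prod z3 D k <> 0 ->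
  hterm (RtoC A + z1) (RtoC B + z2) (RtoC D + z3) x k =
  (RtoC (rterm A B D x k) * (gauss_prod z1 A k * gauss_prod z2 B k / gauss_prod z3 D k *
    Cexp (z1 * RtoC (ln ((A + INR k) / A)) + z2 * RtoC (ln ((B + INR k) / B))
          - z3 * RtoC (ln ((D + INR k) / D)))))%C.
Proof.
  intros HA HB HD Hg.
  rewrite <- hterm_RtoC by (apply pos_not_nonpos_int; exact HD).
  unfold hterm. rewrite !Cpoch_gauss_prod by assumption.
  unfold Cminus. rewrite !Cexp_plus, Cexp_opp. field.
  repeat split; try apply Cexp_neq_0; try apply INR_fact_C_neq_0;
    try (apply Cpoch_pos_neq_0; assumption); assumption.
Qed.

Lemma near_1_quotient (u v w : C) (e : R) :
  e <= / 2 -> Cmod (u - 1) <= e -> Cmod (v - 1) <= e -> Cmod (w - 1) <= e ->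
  w <> 0 /\ Cmod (u * v / w - 1) <= 8 * e.
Proof.
  intros He Hu Hv Hw.
  assert (He0 : 0 <= e) by (eapply Rle_trans; [apply Cmod_ge_0|exact Hu]).
  assert (Hw2 : / 2 <= Cmod w).
  { assert (H := Cmod_triangle_inv 1 (w - 1)). rewrite Cmod_1 in H.
    replace (1 + (w - 1))%C with w in H by ring. lra. }
  assert (Hw0 : w <> 0) by (intro E; rewrite E, Cmod_0 in Hw2; lra).
  split; [exact Hw0|].
  assert (Hv2 : Cmod v <= 3 / 2).
  { assert (H := Cmod_triangle 1 (v - 1)). rewrite Cmod_1 in H.
    replace (1 + (v - 1))%C with v in H by ring. lra. }
  replace (u * v / w - 1)%C with (((u - 1) * v + ((v - 1) - (w - 1))) / w)%C by (field; exact Hw0).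
  rewrite Cmod_div by exact Hw0.
  apply Rmult_le_reg_r with (Cmod w); [lra|].
  unfold Rdiv. rewrite Rmult_assoc, Rinv_l, Rmult_1_r by lra.
  eapply Rle_trans; [apply Cmod_triangle|]. rewrite Cmod_mult.
  assert (H1 : Cmod (v - 1 - (w - 1)) <= 2 * e).
  { unfold Cminus at 1. eapply Rle_trans; [apply Cmod_triangle|]. rewrite Cmod_opp. lra. }
  assert (H2 : Cmod (u - 1) * Cmod v <= e * (3 / 2))
    by (apply Rmult_le_compat; try apply Cmod_ge_0; assumption).
  assert (8 * e * / 2 <= 8 * e * Cmod w) by (apply Rmult_le_compat_l; lra).
  lra.
Qed.

Lemma ln_1p_lipschitz (u v : R) : 0 <= u -> 0 <= v -> Rabs (ln (1 + u) - ln (1 + v)) <= Rabs (u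
    - v).
Proof.
  assert (H : forall u v, 0 <= v -> v <= u -> 0 <= ln (1 + u) - ln (1 + v) <= u - v).
  { intros a b Hb Hab. split.
    - assert (ln (1 + b) <= ln (1 + a)); [|lra]. apply ln_le; lra.
    - assert (E : ln (1 + a) = ln (1 + b) + ln ((1 + a) / (1 + b))).
      { rewrite <- ln_mult; [f_equal; field; lra|lra|apply Rdiv_lt_0_compat; lra]. }
      rewrite E. assert (H := ln_le_minus_1 ((1 + a) / (1 + b)) ltac:(apply Rdiv_lt_0_compat; lra)).
      replace ((1 + a) / (1 + b) - 1) with ((a - b) / (1 + b)) in H by (field; lra).
      assert ((a - b) / (1 + b) <= a - b); [|lra].
      apply Rmult_le_reg_r with (1 + b); [lra|]. unfold Rdiv.
      rewrite Rmult_assoc, Rinv_l by lra. nra. }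
  intros Hu Hv. destruct (Rle_dec v u) as [L|L].
  - specialize (H u v Hv L). rewrite !Rabs_pos_eq; lra.
  - specialize (H v u Hu ltac:(lra)). rewrite Rabs_minus_sym, (Rabs_minus_sym u).
  rewrite !Rabs_pos_eq; lra.
Qed.

Lemma log_factor_near (p a k0 n' k : R) :
  0 < p -> 0 < k0 -> 1 <= n' -> 0 <= k -> p / 2 * n' < p * n' + a ->
  Rabs (ln ((p * n' + a + k) / (p * n' + a)) - ln (1 + k0 / p))
    <= (2 / p * (1 + k0 * Rabs a / p)) * ((Rabs (k - k0 * n') + 1) / n').
Proof.
  intros Hp Hk0 Hn Hk HA. set (A := p * n' + a) in *.
  assert (HA0 : 0 < A) by nra.
  replace ((A + k) / A) with (1 + k / A) by (field; lra).
  eapply Rle_trans.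
  { apply ln_1p_lipschitz.
    - apply Rmult_le_pos; [exact Hk|apply Rlt_le, Rinv_0_lt_compat, HA0].
    - apply Rlt_le, Rdiv_lt_0_compat; assumption. }
  replace (k / A - k0 / p) with (((k - k0 * n') - k0 * a / p) * / A)
    by (unfold A; field; split; [lra|]; fold A; lra).
  rewrite Rabs_mult, (Rabs_pos_eq (/ A)) by (apply Rlt_le, Rinv_0_lt_compat, HA0).
  assert (Hka : Rabs (k0 * a / p) = k0 * Rabs a / p).
  { unfold Rdiv. rewrite !Rabs_mult, (Rabs_pos_eq k0), (Rabs_pos_eq (/ p)); [reflexivity| |lra].
    apply Rlt_le, Rinv_0_lt_compat, Hp. }
  assert (H1 : Rabs (k - k0 * n' - k0 * a / p) <= Rabs (k - k0 * n') + k0 * Rabs a / p).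
  { eapply Rle_trans; [apply Rabs_triang|]. rewrite Rabs_Ropp, Hka. lra. }
  assert (H2 : / A <= 2 / p * / n').
  { replace (2 / p * / n') with (/ (p / 2 * n')) by (field; lra).
    apply Rinv_le_contravar; [|lra]. nra. }
  assert (HB : 0 <= k0 * Rabs a / p).
  { rewrite <- Hka; apply Rabs_pos. }
  set (B := k0 * Rabs a / p) in *. set (d := Rabs (k - k0 * n')) in *.
  assert (Hd : 0 <= d) by apply Rabs_pos.
  apply Rle_trans with ((d + B) * (2 / p * / n')).
  - apply Rmult_le_compat; [apply Rabs_pos|apply Rlt_le, Rinv_0_lt_compat, HA0|exact H1|exact H2].
  - replace (2 / p * (1 + B) * ((d + 1) / n')) with ((1 + B) * (d + 1) * (2 / p * / n')) by
      (field; lra).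
    apply Rmult_le_compat_r.
    + apply Rlt_le, Rmult_lt_0_compat; [apply Rdiv_lt_0_compat; lra|apply Rinv_0_lt_compat; lra].
    + nra.
Qed.

(** A bound uniform in [k], for the terms far from the peak: the growth of a numerator factor is
    charged to the denominator factor. When [p + q <= r] the latter can pay for both numerator
    factors. *)
Lemma log_factor_le (p a r n' k : R) :
  0 < p -> 0 < r -> 1 <= n' -> 0 <= k -> p / 2 * n' < p * n' + a ->
  ln ((p * n' + a + k) / (p * n' + a)) <= ln (1 + 2 * r / p) + ln ((r * n' + k) / (r * n')).
Proof.
  intros Hp Hr Hn Hk HA. set (A := p * n' + a) in *.
  assert (HA0 : 0 < A) by nra. assert (HD : 0 < r * n') by nra.
  assert (H2 : 0 < 2 * r / p) by (apply Rdiv_lt_0_compat; lra).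
  rewrite <- ln_mult; [|lra|apply Rdiv_lt_0_compat; lra].
  apply ln_le; [apply Rdiv_lt_0_compat; lra|].
  replace ((A + k) / A) with (1 + k / A) by (field; lra).
  replace ((r * n' + k) / (r * n')) with (1 + k / (r * n')) by (field; split; lra).
  assert (H1 : k / A <= (2 * r / p) * (k / (r * n'))).
  { replace ((2 * r / p) * (k / (r * n'))) with (k / (p / 2 * n')) by (field; repeat split; lra).
    apply Rmult_le_compat_l; [exact Hk|]. apply Rinv_le_contravar; [nra|lra]. }
  assert (H3 : 0 <= k / (r * n')) by (apply Rmult_le_pos; [exact Hk|apply Rlt_le,
      Rinv_0_lt_compat, HD]).
  nra.
Qed.

Lemma hgf_hmom (p q r a b x : R) (w : C) :
  hgf (Data p q r a b x) w =
  hmom 0 (RtoC p * w + RtoC a) (RtoC q * w + RtoC b) (RtoC r * w) x.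
Proof. unfold hgf. cbn [dp dq dr da db dx]. rewrite hyp2F1_hmom. reflexivity. Qed.

Lemma hgf_real (p q r a b x n' : R) :
  0 < x < 1 -> 0 < r * n' ->
  hgf (Data p q r a b x) (RtoC n') = RtoC (rmom 0 (p * n' + a) (q * n' + b) (r * n') x).
Proof.
  intros Hx HD. rewrite hgf_hmom, <- !RtoC_mult, <- !RtoC_plus.
  apply rmom_correct; [exact Hx|]. apply pos_not_nonpos_int. exact HD.
Qed.

Lemma is_lim_seq_inv_sqrt_INR (K : R) : is_lim_seq (fun n => K * / sqrt (INR n)) 0.
Proof.
  replace (Finite 0) with (Rbar_mult K 0) by (simpl; f_equal; ring).
  apply is_lim_seq_scal_l.
  apply is_lim_seq_spec. intros eps.
  destruct (eventually_INR_gt (/ eps * / eps)) as [N HN]. exists N. intros n Hn.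
  specialize (HN n Hn). destruct eps as [eps He]. simpl in *.
  assert (Hi : 0 < / eps) by (apply Rinv_0_lt_compat; exact He).
  assert (Hs : / eps < sqrt (INR n)).
  { rewrite <- (sqrt_Rsqr (/ eps)) by lra. apply sqrt_lt_1; unfold Rsqr; nra. }
  rewrite Rminus_0_r, Rabs_pos_eq by (apply Rlt_le, Rinv_0_lt_compat; lra).
  rewrite <- (Rinv_inv eps). apply Rinv_lt_contravar; [nra|exact Hs].
Qed.

(** The exponent [th] of a term is bounded above uniformly in the index, but tends to -oo with the
    index when [p + q < r]; hence the restriction to [Re w >= 0]. Each term misses its limit by a
    relative error of order [(|k - k0 n| + 1) / n], and the second moment about the peak turns this
    into a total error of order [1 / sqrt n]. *)
Lemma ratio_limit_halfplane (p q r a b x : R) (w : C) :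
  0 < p -> 0 < q -> 0 < r -> p + q <= r -> 0 < x < 1 -> 0 <= Re w ->
  Cconv (fun n => hgf (Data p q r a b x) (RtoC (INR n) + w) / hgf (Data p q r a b x) (RtoC (INR
      n)))%C
    (Cexp (w * RtoC (log_growth p q r x))).
Proof.
  intros Hp Hq Hr Hpq Hx Hw.
  destruct (concentration p q r a b x Hp Hq Hr Hx) as [K [N [HK HN]]].
  destruct (kappa_spec p q r x Hp Hq Hx) as [_k' [Hk0 _]]. clear _k'.
  set (k0 := kappa p q r x) in *.
  destruct (gauss_prod_near_1 (RtoC p * w)) as [Kp [Sp [HKp [HSp Gp]]]].
  destruct (gauss_prod_near_1 (RtoC q * w)) as [Kq [Sq [HKq [HSq Gq]]]].
  destruct (gauss_prod_near_1 (RtoC r * w)) as [Kr [Sr [HKr [HSr Gr]]]].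
  set (cp := 2 / p * (1 + k0 * Rabs a / p)). set (cq := 2 / q * (1 + k0 * Rabs b / q)).
  set (cr := 2 / r * (1 + k0 * Rabs 0 / r)).
  set (L := log_growth p q r x).
  set (Th := p * ln (1 + 2 * r / p) + q * ln (1 + 2 * r / q)).
  set (Ke := 2 * Kp / p + 2 * Kq / q + 2 * Kr / r).
  assert (HKe : 0 <= Ke).
  { unfold Ke. assert (H : forall u v, 0 <= u -> 0 < v -> 0 <= 2 * u / v).
    { intros u v Hu Hv. apply Rmult_le_pos; [lra|apply Rlt_le, Rinv_0_lt_compat, Hv]. }
    generalize (H Kp p HKp Hp) (H Kq q HKq Hq) (H Kr r HKr Hr). lra. }
  set (cL := p * cp + q * cq + r * cr).
  assert (Hc : forall u v, 0 < u -> 0 <= 2 / u * (1 + k0 * Rabs v / u)).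
  { intros u v Hu. apply Rmult_le_pos; [apply Rlt_le, Rdiv_lt_0_compat; lra|].
    assert (0 <= k0 * Rabs v / u); [|lra].
    apply Rmult_le_pos; [apply Rmult_le_pos; [lra|apply Rabs_pos]|apply Rlt_le,
        Rinv_0_lt_compat, Hu]. }
  assert (HcL : 0 <= cL).
  { unfold cL. assert (0 <= p * cp) by (apply Rmult_le_pos; [lra|apply Hc, Hp]).
    assert (0 <= q * cq) by (apply Rmult_le_pos; [lra|apply Hc, Hq]).
    assert (0 <= r * cr) by (apply Rmult_le_pos; [lra|apply Hc, Hr]). lra. }
  set (M := exp (Re w * Th)).
  assert (HM : 0 < M) by apply exp_pos.
  set (K1 := M * (8 * Ke) + Cmod w * cL * (3 * exp (Re w * L) + M)).
  assert (HK1 : 0 <= K1).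
  { unfold K1. generalize (Cmod_ge_0 w) (exp_pos (Re w * L)); intros.
    assert (0 <= M * (8 * Ke)) by (apply Rmult_le_pos; lra).
    assert (0 <= Cmod w * cL * (3 * exp (Re w * L) + M))
      by (apply Rmult_le_pos; [apply Rmult_le_pos; assumption|lra]).
    lra. }
  destruct (eventually_INR_gt (2 * Sp / p + 2 * Sq / q + 2 * Sr / r + 2 * Ke)) as [N1 HN1].
  assert (Main : forall n, (max N N1 <= n)%nat -> forall k,
    Cmod (hterm (RtoC p * (RtoC (INR n) + w) + RtoC a) (RtoC q * (RtoC (INR n) + w) + RtoC b)
        (RtoC r * (RtoC (INR n) + w)) x k
      - Cexp (w * RtoC L) * RtoC (rterm (p * INR n + a) (q * INR n + b) (r * INR n) x k))
    <= rterm (p * INR n + a) (q * INR n + b) (r * INR n) x k * (K1 * ((Rabs (INR k - k0 * INR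
        n) + 1) / INR n))).
  { intros n Hn k. destruct (HN n ltac:(lia)) as [Hn1 [HA [HB _]]]. specialize (HN1 n ltac:(lia)).
    set (n' := INR n) in *. set (A := p * n' + a) in *. set (B := q * n' + b) in *.
    set (D := r * n') in *.
    assert (HA0 : 0 < A) by nra. assert (HB0 : 0 < B) by nra.
    assert (HD0 : 0 < D) by (unfold D; nra).
    assert (HD : r / 2 * n' < r * n' + 0) by nra.
    assert (Hdiv : forall u v, 0 <= u -> 0 < v -> 0 <= 2 * u / v).
    { intros u v Hu Hv. apply Rmult_le_pos; [lra|apply Rlt_le, Rinv_0_lt_compat, Hv]. }
    assert (G1 := Hdiv Sp p ltac:(lra) Hp). assert (G2 := Hdiv Sq q ltac:(lra) Hq).
    assert (G3 := Hdiv Sr r ltac:(lra) Hr).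
    assert (Hge : forall u S, 0 < u -> 2 * S / u <= n' -> S <= u / 2 * n').
    { intros u S Hu H. apply Rle_trans with (u / 2 * (2 * S / u)); [right; field; lra|].
      apply Rmult_le_compat_l; lra. }
    assert (S1 : Sp <= A) by (generalize (Hge p Sp Hp ltac:(lra)); lra).
    assert (S2 : Sq <= B) by (generalize (Hge q Sq Hq ltac:(lra)); lra).
    assert (S3 : Sr <= D) by (generalize (Hge r Sr Hr ltac:(lra)); unfold D; lra).
    assert (Hfr : forall u A' K', 0 < u -> 0 <= K' -> u / 2 * n' < A' -> K' / A' <= 2 * K' / u
        / n').
    { intros u A' K' Hu HK' HA'.
    replace (2 * K' / u / n') with (K' * / (u / 2 * n')) by (field; lra).
      apply Rmult_le_compat_l; [exact HK'|]. apply Rinv_le_contravar; [nra|lra]. }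
    assert (Q1 := Hdiv Kp p HKp Hp). assert (Q2 := Hdiv Kq q HKq Hq).
    assert (Q3 := Hdiv Kr r HKr Hr).
    assert (Hin : 0 < / n') by (apply Rinv_0_lt_compat; lra).
    assert (e1 : Kp / A <= Ke / n').
    { eapply Rle_trans; [apply (Hfr p); assumption|]. apply Rmult_le_compat_r; unfold Ke; lra. }
    assert (e2 : Kq / B <= Ke / n').
    { eapply Rle_trans; [apply (Hfr q); assumption|]. apply Rmult_le_compat_r; unfold Ke; lra. }
    assert (e3 : Kr / D <= Ke / n').
    { eapply Rle_trans; [apply (Hfr r); [assumption..|unfold D; lra]|].
    apply Rmult_le_compat_r; unfold Ke; lra. }
    assert (ee : Ke / n' <= / 2).
    { apply Rmult_le_reg_r with n'; [lra|]. unfold Rdiv. rewrite Rmult_assoc, Rinv_l by lra. lra. }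
    destruct (near_1_quotient (gauss_prod (RtoC p * w) A k) (gauss_prod (RtoC q * w) B k)
      (gauss_prod (RtoC r * w) D k) (Ke / n') ee) as [Hg0 HG].
    { eapply Rle_trans; [apply Gp, S1|exact e1]. }
    { eapply Rle_trans; [apply Gq, S2|exact e2]. }
    { eapply Rle_trans; [apply Gr, S3|exact e3]. }
    set (G := (gauss_prod (RtoC p * w) A k * gauss_prod (RtoC q * w) B k / gauss_prod (RtoC r *
        w) D k)%C) in *.
    replace (RtoC p * (RtoC n' + w) + RtoC a)%C with (RtoC A + RtoC p * w)%C
      by (unfold A; rewrite RtoC_plus, RtoC_mult; ring).
    replace (RtoC q * (RtoC n' + w) + RtoC b)%C with (RtoC B + RtoC q * w)%C
      by (unfold B; rewrite RtoC_plus, RtoC_mult; ring).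
    replace (RtoC r * (RtoC n' + w))%C with (RtoC D + RtoC r * w)%C
      by (unfold D; rewrite RtoC_mult; ring).
    rewrite hterm_ratio by assumption. fold G.
    set (lA := ln ((A + INR k) / A)). set (lB := ln ((B + INR k) / B)).
    set (lD := ln ((D + INR k) / D)).
    set (th := p * lA + q * lB - r * lD).
    replace (RtoC p * w * RtoC lA + RtoC q * w * RtoC lB - RtoC r * w * RtoC lD)%C with (w *
        RtoC th)%C
      by (unfold th; rewrite RtoC_minus, RtoC_plus, !RtoC_mult; ring).
    assert (Ht := rterm_pos A B D x k HA0 HB0 HD0 ltac:(lra)).
    set (t := rterm A B D x k) in *.
    replace (RtoC t * (G * Cexp (w * RtoC th)) - Cexp (w * RtoC L) * RtoC t)%C
      with (RtoC t * (Cexp (w * RtoC th) * (G - 1) + (Cexp (w * RtoC th) - Cexp (w * RtoC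
          L))))%C by ring.
    rewrite Cmod_mult, Cmod_R, (Rabs_pos_eq t) by lra.
    apply Rmult_le_compat_l; [lra|].
    assert (Hk := pos_INR k).
    assert (Lth : th <= Th).
    { assert (F1 := log_factor_le p a r n' (INR k) Hp Hr Hn1 Hk HA).
      assert (F2 := log_factor_le q b r n' (INR k) Hq Hr Hn1 Hk HB).
      fold A D lA lD in F1. fold B D lB lD in F2.
      assert (F3 : 0 <= lD).
      { rewrite <- ln_1. unfold lD. apply ln_le; [lra|].
        apply Rmult_le_reg_r with D; [lra|]. unfold Rdiv. rewrite Rmult_assoc, Rinv_l by lra. lra. }
      apply (Rmult_le_compat_l p) in F1; [|lra]. apply (Rmult_le_compat_l q) in F2; [|lra].
      unfold th, Th. nra. }
    set (d := (Rabs (INR k - k0 * n') + 1) / n').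
    assert (Hd : / n' <= d).
    { unfold d, Rdiv. rewrite <- (Rmult_1_l (/ n')) at 1. apply Rmult_le_compat_r; [lra|].
      generalize (Rabs_pos (INR k - k0 * n')); lra. }
    assert (LL : Rabs (th - L) <= cL * d).
    { assert (F1 := log_factor_near p a k0 n' (INR k) Hp Hk0 Hn1 Hk HA).
      assert (F2 := log_factor_near q b k0 n' (INR k) Hq Hk0 Hn1 Hk HB).
      assert (F3 := log_factor_near r 0 k0 n' (INR k) Hr Hk0 Hn1 Hk HD).
      rewrite Rplus_0_r in F3. fold A lA cp d in F1. fold B lB cq d in F2. fold D lD cr d in F3.
      unfold L, log_growth. cbv zeta. fold k0.
      replace (th - (p * ln (1 + k0 / p) + q * ln (1 + k0 / q) - r * ln (1 + k0 / r)))
        with (p * (lA - ln (1 + k0 / p)) + q * (lB - ln (1 + k0 / q)) + - (r * (lD - ln (1 + k0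
            / r))))
        by (unfold th; ring).
      eapply Rle_trans; [apply Rabs_triang|].
      eapply Rle_trans; [apply Rplus_le_compat_r, Rabs_triang|].
      rewrite Rabs_Ropp, !Rabs_mult, (Rabs_pos_eq p), (Rabs_pos_eq q), (Rabs_pos_eq r) by lra.
      apply (Rmult_le_compat_l p) in F1; [|lra]. apply (Rmult_le_compat_l q) in F2; [|lra].
      apply (Rmult_le_compat_l r) in F3; [|lra]. unfold cL. lra. }
    assert (HReth : exp (Re w * th) <= M).
    { unfold M. assert (Re w * th <= Re w * Th) by (apply Rmult_le_compat_l; assumption).
      destruct H; [apply Rlt_le, exp_increasing; assumption|rewrite H; lra]. }
    assert (ReE : forall s : R, Re (w * RtoC s) = Re w * s) by (intros s; rewrite Re_mult;
        simpl; ring).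
    eapply Rle_trans; [apply Cmod_triangle|]. rewrite Cmod_mult, Cmod_Cexp, ReE.
    replace (Cexp (w * RtoC th) - Cexp (w * RtoC L))%C
      with (Cexp (w * RtoC L) * (Cexp (w * RtoC (th - L)) - 1))%C.
    2:{ replace (w * RtoC th)%C with (w * RtoC L + w * RtoC (th - L))%C by (rewrite RtoC_minus;
        ring).
        rewrite Cexp_plus. ring. }
    rewrite Cmod_mult, Cmod_Cexp, ReE.
    assert (J1 := Cexp_minus_1_le (w * RtoC (th - L))). rewrite ReE, Cmod_mult, Cmod_R in J1.
    assert (X1 : exp (Re w * th) * Cmod (G - 1) <= M * (8 * Ke) * d).
    { rewrite Rmult_assoc.
      apply Rmult_le_compat; [apply Rlt_le, exp_pos|apply Cmod_ge_0|exact HReth|].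
      eapply Rle_trans; [exact HG|]. replace (8 * (Ke / n')) with (8 * Ke * / n') by (field; lra).
      apply Rmult_le_compat_l; lra. }
    assert (X2 : exp (Re w * L) * Cmod (Cexp (w * RtoC (th - L)) - 1)
       <= Cmod w * cL * (3 * exp (Re w * L) + M) * d).
    { apply Rle_trans with (exp (Re w * L) * (Cmod w * Rabs (th - L) * (3 + exp (Re w * (th -
        L))))).
      - apply Rmult_le_compat_l; [apply Rlt_le, exp_pos|exact J1].
      - replace (exp (Re w * L) * (Cmod w * Rabs (th - L) * (3 + exp (Re w * (th - L)))))
          with (Cmod w * Rabs (th - L) * (3 * exp (Re w * L) + exp (Re w * L + Re w * (th - L))))
          by (rewrite exp_plus; ring).
        replace (Re w * L + Re w * (th - L)) with (Re w * th) by ring.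
        replace (Cmod w * cL * (3 * exp (Re w * L) + M) * d) with (Cmod w * (cL * d) * (3 * exp
            (Re w * L) + M)) by ring.
        generalize (exp_pos (Re w * L)) (exp_pos (Re w * th)) (Cmod_ge_0 w) (Rabs_pos (th -
            L)); intros.
        apply Rmult_le_compat; [apply Rmult_le_pos; assumption|lra|apply Rmult_le_compat_l;
            assumption|lra]. }
    unfold K1. lra. }
  apply Cconv_le with (fun n => (2 * (K1 * (2 + K))) * / sqrt (INR n)).
  2:{ apply is_lim_seq_inv_sqrt_INR. }
  exists (max N N1). intros n Hn. specialize (Main n Hn).
  destruct (HN n ltac:(lia)) as [Hn1 [HA [HB HV]]]. clear HN1.
  set (n' := INR n) in *. set (A := p * n' + a) in *. set (B := q * n' + b) in *.
  set (D := r * n') in *.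
  assert (HA0 : 0 < A) by nra. assert (HB0 : 0 < B) by nra. assert (HD0 : 0 < D) by (unfold D; nra).
  assert (HD' : ~ nonpos_int (RtoC D)) by (apply pos_not_nonpos_int; exact HD0).
  rewrite hgf_real by assumption. fold A B D. fold A B D in HV.
  assert (P0 : 0 < rmom 0 A B D x) by (apply rmom_0_pos; assumption).
  set (T0 := rmom 0 A B D x) in *.
  assert (HT0 : RtoC T0 <> 0) by (intro E; apply RtoC_inj in E; lra).
  set (F := hgf (Data p q r a b x) (RtoC n' + w)).
  replace (F / RtoC T0 - Cexp (w * RtoC L))%C with ((F - Cexp (w * RtoC L) * RtoC T0) / RtoC
      T0)%C by (field; exact HT0).
  rewrite Cmod_div, Cmod_R, Rabs_pos_eq by (try exact HT0; lra).
  apply Rmult_le_reg_r with T0; [exact P0|]. unfold Rdiv.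
  rewrite Rmult_assoc, Rinv_l, Rmult_1_r by lra.
  set (sn := sqrt n'). assert (Hsn : sn * sn = n') by (apply sqrt_sqrt; lra).
  assert (Hsn1 : 1 <= sn) by (unfold sn; rewrite <- sqrt_1; apply sqrt_le_1; lra).
  (* [(k - k0 n')^2 + 3 n'] bounds [2 sqrt n' (|k - k0 n'| + 1)], by the inequality of the means and
     [sqrt n' <= n']. By [concentration] its weighted sum is at most [(K + 3) n' T0]. *)
  assert (HS : is_series (fun k => (INR k ^ 2 - 2 * k0 * n' * INR k + k0 ^ 2 * n' ^ 2 + 3 * n')
      * rterm A B D x k)
     (rmom 2 A B D x - 2 * k0 * n' * rmom 1 A B D x + (k0 ^ 2 * n' ^ 2 + 3 * n') * T0)).
  { assert (Hm : forall m, is_series (fun k => INR k ^ m * rterm A B D x k) (rmom m A B D x))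
      by (intros m; apply rmom_correct; assumption).
    assert (E := is_series_plus _ _ _ _ (is_series_plus _ _ _ _ (Hm 2%nat)
      (is_series_scal (- (2 * k0 * n')) _ _ (Hm 1%nat))) (is_series_scal (k0 ^ 2 * n' ^ 2 + 3 *
          n') _ _ (Hm 0%nat))).
    replace (rmom 2 A B D x - 2 * k0 * n' * rmom 1 A B D x + (k0 ^ 2 * n' ^ 2 + 3 * n') * T0)
      with (plus (plus (rmom 2 A B D x) (scal (- (2 * k0 * n')) (rmom 1 A B D x)))
            (scal (k0 ^ 2 * n' ^ 2 + 3 * n') (rmom 0 A B D x))).
    - eapply is_series_ext; [|exact E]. intros k. unfold plus, scal; simpl. unfold mult; simpl.
    ring.
    - unfold plus, scal; simpl. unfold mult; simpl. unfold T0. ring. }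
  assert (HS2 := is_series_scal (K1 / (2 * n' * sn)) _ _ HS).
  apply Rle_trans with (2 * (K1 / (2 * n' * sn) * (rmom 2 A B D x - 2 * k0 * n' * rmom 1 A B D
      x + (k0 ^ 2 * n' ^ 2 + 3 * n') * T0))).
  - apply is_Cseries_Cmod_le with
      (u := fun k => (hterm (RtoC p * (RtoC n' + w) + RtoC a) (RtoC q * (RtoC n' + w) + RtoC b)
          (RtoC r * (RtoC n' + w)) x k
      - Cexp (w * RtoC L) * RtoC (rterm A B D x k))%C)
      (M := fun k => K1 / (2 * n' * sn) * ((INR k ^ 2 - 2 * k0 * n' * INR k + k0 ^ 2 * n' ^ 2 +
          3 * n') * rterm A B D x k)).
    + intros k. eapply Rle_trans; [apply Main|].
      assert (Ht := rterm_pos A B D x k HA0 HB0 HD0 ltac:(lra)).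
      set (y := INR k ^ 2 - 2 * k0 * n' * INR k + k0 ^ 2 * n' ^ 2 + 3 * n').
      replace (K1 / (2 * n' * sn) * (y * rterm A B D x k))
        with (rterm A B D x k * (K1 / (2 * n' * sn) * y)) by ring.
      unfold y.
      apply Rmult_le_compat_l; [lra|].
      replace (K1 * ((Rabs (INR k - k0 * n') + 1) / n'))
        with (K1 / (2 * n' * sn) * (2 * sn * (Rabs (INR k - k0 * n') + 1))) by (field; lra).
      apply Rmult_le_compat_l.
      { apply Rmult_le_pos; [exact HK1|]. apply Rlt_le, Rinv_0_lt_compat. nra. }
      replace (INR k ^ 2 - 2 * k0 * n' * INR k + k0 ^ 2 * n' ^ 2)
        with (Rabs (INR k - k0 * n') ^ 2) by (rewrite pow2_abs; ring).
      generalize (pow2_ge_0 (Rabs (INR k - k0 * n') - sn)); intro. nra.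
    + apply is_Cseries_minus.
      * assert (Hreg : ~ nonpos_int (RtoC r * (RtoC n' + w))%C).
        { apply pos_not_nonpos_int. rewrite Re_mult, Re_plus. simpl. nra. }
        unfold F. rewrite hgf_hmom.
        eapply is_Cseries_ext; [|apply hmom_correct; assumption].
        intros k. cbv beta. simpl pow. ring.
      * apply is_Cseries_scal.
        apply is_Cseries_RtoC. eapply is_series_ext; [|apply (rmom_correct 0 A B D x Hx HD')].
        intros k. simpl. ring.
    + exact HS2.
  - replace (2 * (K1 * (2 + K)) * / sn * T0) with (2 * (K1 / (2 * n' * sn) * (2 * (2 + K) * n'
      * T0))) by (field; lra).
    apply Rmult_le_compat_l; [lra|]. apply Rmult_le_compat_l.
    { apply Rmult_le_pos; [exact HK1|]. apply Rlt_le, Rinv_0_lt_compat. nra. }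
    assert (0 <= K * n' * T0) by (apply Rmult_le_pos; [apply Rmult_le_pos; lra|lra]).
    assert (0 <= n' * T0) by nra.
    lra.
Qed.

(** For large [m] both [w + m] and [m] lie in the half-plane. The quotient of the two limits is the
    limit of the ratio along [n + m], and a shift of the index does not change a limit. *)
Lemma ratio_limit (p q r a b x : R) (w : C) :
  0 < p -> 0 < q -> 0 < r -> p + q <= r -> 0 < x < 1 ->
  Cconv (fun n => hgf (Data p q r a b x) (RtoC (INR n) + w) / hgf (Data p q r a b x) (RtoC (INR
      n)))%C
    (Cexp (w * RtoC (log_growth p q r x))).
Proof.
  intros Hp Hq Hr Hpq Hx.
  destruct (eventually_INR_gt (- Re w)) as [m Hm]. specialize (Hm m (le_n m)).
  set (L := log_growth p q r x). set (f := hgf (Data p q r a b x)).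
  assert (H1 := ratio_limit_halfplane p q r a b x (w + RtoC (INR m)) Hp Hq Hr Hpq Hx
    ltac:(rewrite Re_plus; simpl; lra)).
  assert (H2 := ratio_limit_halfplane p q r a b x (RtoC (INR m)) Hp Hq Hr Hpq Hx (pos_INR m)).
  fold L f in H1, H2.
  assert (H3 := Cconv_mult _ _ _ _ H1 (Cconv_inv _ _ (Cexp_neq_0 _) H2)).
  rewrite <- Cexp_opp, <- Cexp_plus in H3.
  replace ((w + RtoC (INR m)) * RtoC L + - (RtoC (INR m) * RtoC L))%C with (w * RtoC L)%C in H3
      by ring.
  assert (H4 : Cconv (fun n => f (RtoC (INR (n + m)) + w) / f (RtoC (INR (n + m))))%C (Cexp (w
      * RtoC L))).
  { destruct (concentration p q r a b x Hp Hq Hr Hx) as [K [N [_ HN]]].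
    eapply Cconv_ext_loc; [|exact H3]. exists N. intros n Hn. cbv beta.
    rewrite RtoC_INR_add.
    replace (RtoC (INR n) + (w + RtoC (INR m)))%C with (RtoC (INR n) + RtoC (INR m) + w)%C by ring.
    assert (Hpos : forall j, (N <= j)%nat -> f (RtoC (INR j)) <> 0).
    { intros j Hj. destruct (HN j Hj) as [Hj1 [HA [HB _]]]. unfold f.
      rewrite hgf_real by nra. intro E; apply RtoC_inj in E.
      assert (0 < rmom 0 (p * INR j + a) (q * INR j + b) (r * INR j) x) by (apply rmom_0_pos;
          nra). lra. }
    assert (E1 := Hpos n Hn). assert (E2 := Hpos (n + m)%nat ltac:(lia)).
    rewrite RtoC_INR_add in E2.
    field. split; assumption. }
  destruct H4 as [H5 H6]. split.
  - apply (is_lim_seq_incr_n (fun n => Re (f (RtoC (INR n) + w) / f (RtoC (INR n)))%C) m). exact H5.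
  - apply (is_lim_seq_incr_n (fun n => Im (f (RtoC (INR n) + w) / f (RtoC (INR n)))%C) m). exact H6.
Qed.

(** * Vanishing of the off-diagonal contiguity coefficient *)

(** [s = r - p - q] is taken as the parameter: it counts the steps that raise [c] alone, and its
    positivity and parity express the conditions on [r]. *)
Definition int_data (p q s : nat) (a b x : R) : data :=
  Data (INR p) (INR q) (INR (p + q + s)) a b x.

Definition hgf_euler (p q r a b x : R) (w : C) : C :=
  hmom 1 (RtoC p * w + RtoC a) (RtoC q * w + RtoC b) (RtoC r * w) x.

Definition contig_mat (p q s : nat) (a b x : R) (w : C) : mat2 :=
  shift_mat p q s (RtoC (INR p) * w + RtoC a) (RtoC (INR q) * w + RtoC b)
    (RtoC (INR (p + q + s)) * w) x.

Definition contig_den (p q s : nat) (a b x : R) (w : C) : C :=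
  let A := (RtoC (INR p) * w + RtoC a)%C in
  let B := (RtoC (INR q) * w + RtoC b)%C in
  let D := (RtoC (INR (p + q + s)) * w)%C in
  (RtoC x ^ (p + q + s) * Cpoch A p * Cpoch B q * Cpoch (D - A) (q + s) * Cpoch (D - B) (p + s))%C.

Lemma hgf_contiguity (p q s : nat) (a b x : R) (w : C) :
  0 < x < 1 -> regular (int_data p q s a b x) w ->
  let f := hgf (int_data p q s a b x) in
  (contig_den p q s a b x w * f (w + 1))%C =
  (Cpoch (RtoC (INR (p + q + s)) * w) (p + q + s) *
    (m11 (contig_mat p q s a b x w) * f w +
     m12 (contig_mat p q s a b x w) * hgf_euler (INR p) (INR q) (INR (p + q + s)) a b x w))%C.
Proof.
  intros Hx Hw. cbv zeta. unfold int_data. rewrite !hgf_hmom.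
  assert (H := carries_shift p q s (RtoC (INR p) * w + RtoC a) (RtoC (INR q) * w + RtoC b) _ x
      Hx Hw).
  destruct H as [H _]. cbn [fst snd hvec dr int_data] in H.
  unfold contig_den, contig_mat, hgf_euler.
  rewrite <- H. f_equal. f_equal; ring.
Qed.

Lemma is_poly_Cpoch (f : C -> C) (n : nat) : is_poly f -> is_poly (fun w => Cpoch (f w) n).
Proof.
  intros Hf. unfold Cpoch. apply (is_poly_Cprod (fun i w => f w + RtoC (INR i))%C).
  intros; poly.
Qed.

Lemma is_poly_contig_den (p q s : nat) (a b x : R) : is_poly (contig_den p q s a b x).
Proof.
  unfold contig_den. cbv zeta.
  repeat apply is_poly_mul; try apply is_poly_const; apply is_poly_Cpoch; poly.
Qed.

Lemma is_poly_contig_mat (p q s : nat) (a b x : R) : is_poly_mat (contig_mat p q s a b x).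
Proof. apply (is_poly_shift_mat p q s); poly. Qed.

Lemma regular_succ (lam : data) (w : C) (k : nat) :
  dr lam = INR k -> regular lam w -> regular lam (w + 1)%C.
Proof.
  intros Hk H E. apply H. rewrite Hk in *.
  apply nonpos_int_sub with k.
  replace (RtoC (INR k) * w + RtoC (INR k))%C with (RtoC (INR k) * (w + 1))%C by ring.
  exact E.
Qed.

(* The common consequence of Problems I and II that the argument needs: it avoids
   the zeros and poles excluded by either formulation. *)
Definition rational_ratio_on_axis (lam : data) : Prop :=
  exists (P Q : C -> C) (N : nat),
    is_poly P /\ is_poly Q /\ ~ (forall w, Q w = 0) /\
    (forall n, (N <= n)%nat ->
      (Q (RtoC (INR n)) * hgf lam (RtoC (INR n) + 1) = P (RtoC (INR n)) * hgf lam (RtoC (INR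
          n)))%C) /\
    (forall t0 : R, t0 < - INR N -> exists d, 0 < d /\ forall t, 0 < t < d ->
      let w := RtoC (t0 + t) in
      regular lam w -> hgf lam w <> 0 -> (Q w * hgf lam (w + 1) = P w * hgf lam w)%C).

Lemma hgf_nat_pos (p q r a b x : R) :
  0 < p -> 0 < q -> 0 < r -> 0 < x < 1 ->
  exists N, forall n, (N <= n)%nat ->
    exists F, 0 < F /\ hgf (Data p q r a b x) (RtoC (INR n)) = RtoC F.
Proof.
  intros Hp Hq Hr Hx. destruct (concentration p q r a b x Hp Hq Hr Hx) as [K [N [_ HN]]].
  exists N. intros n Hn. destruct (HN n Hn) as [H1 [HA [HB _]]].
  exists (rmom 0 (p * INR n + a) (q * INR n + b) (r * INR n) x). split.
  - apply rmom_0_pos; nra.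
  - apply hgf_real; [exact Hx|nra].
Qed.

Lemma regular_pos (lam : data) (w : C) : 0 < dr lam -> 0 < Re w -> regular lam w.
Proof.
  intros Hr Hw. apply pos_not_nonpos_int. rewrite Re_mult. simpl. nra.
Qed.

Lemma problem_II_on_axis (p q s : nat) (a b x : R) :
  (0 < p)%nat -> (0 < q)%nat -> 0 < x < 1 ->
  problem_II (int_data p q s a b x) -> rational_ratio_on_axis (int_data p q s a b x).
Proof.
  intros Hp Hq Hx [cP [cQ [M [N [[k [Hk HQk]] H]]]]].
  (* A polynomial with a nonzero coefficient is not the zero function, as its leading term would
     otherwise be bounded by a term of lower order. *)
  assert (HQ0 : ~ (forall w, Cpoly cQ N w = 0)).
  { intros E. destruct (Cpoly_leading cQ N) as [H0|[e [v [K [Hv [HK HL]]]]]].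
    - apply HQk, H0, Hk.
    - apply Cmod_gt_0 in Hv.
      set (t := Rmax 1 (K / Cmod v + 1)).
      assert (T1 := Rmax_l 1 (K / Cmod v + 1)). assert (T2 := Rmax_r 1 (K / Cmod v + 1)).
      fold t in T1, T2.
      assert (Ht : Cmod (RtoC t) = t) by (rewrite Cmod_R, Rabs_pos_eq; lra).
      specialize (HL (RtoC t)). rewrite Ht, E in HL. specialize (HL T1).
      replace (0 - v * RtoC t ^ e)%C with (- (v * RtoC t ^ e))%C in HL by ring.
      rewrite Cmod_opp, Cmod_mult, Cmod_pow, Ht in HL.
      assert (Hte : 0 < t ^ e) by (apply pow_lt; lra).
      assert (Cmod v * t <= K).
      { apply Rmult_le_reg_r with (t ^ e); [exact Hte|]. lra. }
      assert (Cmod v * (K / Cmod v + 1) <= Cmod v * t) by (apply Rmult_le_compat_l; lra).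
      replace (Cmod v * (K / Cmod v + 1)) with (K + Cmod v) in H1 by (field; lra). lra. }
  destruct (is_poly_large_neq_0 _ (is_poly_Cpoly cQ N) HQ0) as [B HB].
  destruct (eventually_INR_gt (Rmax 1 (B + 1))) as [N1 HN1].
  apply lt_0_INR in Hp, Hq.
  assert (Hr : 0 < INR (p + q + s)) by (rewrite !plus_INR; generalize (pos_INR s); lra).
  destruct (hgf_nat_pos (INR p) (INR q) (INR (p + q + s)) a b x Hp Hq Hr Hx) as [N2 HN2].
  assert (R1 := Rmax_l 1 (B + 1)). assert (R2 := Rmax_r 1 (B + 1)).
  assert (Gen : forall w, regular (int_data p q s a b x) w -> hgf (int_data p q s a b x) w <> 0 ->
     B < Cmod w -> (Cpoly cQ N w * hgf (int_data p q s a b x) (w + 1) = Cpoly cP M w * hgf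
         (int_data p q s a b x) w)%C).
  { intros w Hw Hf HBw. assert (Hq0 := HB w HBw).
    assert (E := H w Hw (regular_succ (int_data p q s a b x) w (p + q + s) eq_refl Hw) Hf Hq0).
    transitivity (hgf (int_data p q s a b x) (w + 1) / hgf (int_data p q s a b x) w * (Cpoly cQ
        N w * hgf (int_data p q s a b x) w))%C.
    - field. exact Hf.
    - rewrite E. field. exact Hq0. }
  exists (Cpoly cP M), (Cpoly cQ N), (max N1 N2).
  split; [apply is_poly_Cpoly|]. split; [apply is_poly_Cpoly|]. split; [exact HQ0|]. split.
  - intros n Hn. specialize (HN1 n ltac:(lia)). destruct (HN2 n ltac:(lia)) as [F [HF EF]].
    apply Gen.
    + apply regular_pos; simpl; [exact Hr|lra].
    + unfold int_data. rewrite EF. intro E; apply RtoC_inj in E; lra.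
    + rewrite Cmod_R, Rabs_pos_eq by apply pos_INR. lra.
  - intros t0 Ht0. exists 1. split; [lra|]. intros t Ht w Hw Hf.
    apply Gen; [exact Hw|exact Hf|]. unfold w. rewrite Cmod_R.
    assert (HNb : INR N1 <= INR (max N1 N2)) by (apply le_INR; lia).
    specialize (HN1 N1 (le_n _)). rewrite Rabs_left; lra.
Qed.

(** Two exceptional values of [t] differ by an integer, so there is at most one between 0 and 1. *)
Lemma avoid_nonpos_int (z : C) :
  exists d, 0 < d /\ forall t, 0 < t < d -> ~ nonpos_int (z + RtoC t)%C.
Proof.
  destruct (classic (exists t, 0 < t < 1 /\ nonpos_int (z + RtoC t)%C)) as [[t1 [Ht1 [k1 E1]]]|H].
  - exists t1. split; [lra|]. intros t Ht [k E].
    assert (E2 : RtoC (t1 - t) = RtoC (INR k - INR k1)).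
    { rewrite !RtoC_minus.
      replace (RtoC t1 - RtoC t)%C with ((z + RtoC t1) - (z + RtoC t))%C by ring.
      rewrite E, E1, !RtoC_opp. ring. }
    apply RtoC_inj in E2.
    rewrite !INR_IZR_INZ, <- minus_IZR in E2.
    assert (0 < IZR (Z.of_nat k - Z.of_nat k1) < 1) by lra.
    destruct H as [H1 H2]. apply lt_IZR in H1, H2. lia.
  - exists 1. split; [lra|]. intros t Ht E. apply H. exists t. split; assumption.
Qed.

Lemma avoid_nonpos_ints (m : nat) (u : nat -> C) (t0 : R) :
  exists d, 0 < d /\ forall t, 0 < t < d ->
    forall i, (i < m)%nat -> ~ nonpos_int (RtoC (t0 + t) + u i)%C.
Proof.
  induction m as [|m [d [Hd H]]].
  - exists 1. split; [lra|]. intros; lia.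
  - destruct (avoid_nonpos_int (RtoC t0 + u m)%C) as [d' [Hd' H']].
    exists (Rmin d d'). split; [apply Rmin_pos; assumption|].
    intros t Ht i Hi. assert (M1 := Rmin_l d d'). assert (M2 := Rmin_r d d').
    destruct (Nat.eq_dec i m) as [->|Hne].
    + replace (RtoC (t0 + t) + u m)%C with (RtoC t0 + u m + RtoC t)%C by (rewrite RtoC_plus; ring).
      apply H'; lra.
    + apply H; [lra|lia].
Qed.

Lemma eventually_not_nonpos_ints (m : nat) (u : nat -> C) :
  eventually (fun n => forall i, (i < m)%nat -> ~ nonpos_int (RtoC (INR n) + u i)%C).
Proof.
  induction m as [|m [N HN]].
  - exists 0%nat. intros; lia.
  - destruct (eventually_INR_gt (- Re (u m))) as [N1 HN1].
    exists (max N N1). intros n Hn i Hi.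
    destruct (Nat.eq_dec i m) as [->|Hne].
    + apply pos_not_nonpos_int. rewrite Re_plus. simpl. specialize (HN1 n ltac:(lia)). lra.
    + apply HN; lia.
Qed.

(** Cross-multiplied, since the factors [w + v i] may vanish while the gamma factors are finite by
    hypothesis. *)
Lemma gamma_product_ratio (lam : data) (r : nat) (A delta : C) (m : nat) (u : nat -> C)
    (n : nat) (v : nat -> C) (w : C) :
  dr lam = INR r -> gamma_product_formula lam A delta m u n v ->
  regular lam w -> (forall i, (i < m)%nat -> ~ nonpos_int (w + u i)%C) ->
  (Cprod (fun i => w + v i) n * hgf lam (w + 1))%C =
  (Cexp delta * Cprod (fun i => w + u i) m * hgf lam w)%C.
Proof.
  intros Hr HG Hw Hu.
  assert (Hu1 : forall i, (i < m)%nat -> ~ nonpos_int (w + 1 + u i)%C).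
  { intros i Hi E. apply (Hu i Hi), nonpos_int_pred.
    replace (w + u i + 1)%C with (w + 1 + u i)%C by ring. exact E. }
  rewrite (HG w Hw Hu), (HG (w + 1)%C (regular_succ lam w r Hr Hw) Hu1).
  rewrite (Cprod_ext (fun i => Cgamma (w + 1 + u i)) (fun i => (w + u i) * Cgamma (w + u i))%C).
  2:{ intros i Hi. rewrite <- Cgamma_succ by (apply Hu, Hi). f_equal. ring. }
  rewrite (Cprod_ext (fun i => Crgamma (w + v i)) (fun i => (w + v i) * Crgamma (w + 1 + v i))%C).
  2:{ intros i Hi. rewrite Crgamma_succ. do 2 f_equal. ring. }
  rewrite !Cprod_mult, Cmult_plus_distr_r, Cexp_plus, Cmult_1_l. ring.
Qed.

Lemma problem_I_on_axis (lam : data) (r : nat) :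
  (0 < r)%nat -> dr lam = INR r -> problem_I lam -> rational_ratio_on_axis lam.
Proof.
  intros Hr0 Hr [A [d [ld [m [n [u [v [_ [_ [_ HG]]]]]]]]]].
  assert (Hr' : 0 < dr lam) by (rewrite Hr; apply lt_0_INR, Hr0).
  assert (HR := fun w => gamma_product_ratio lam r A ld m u n v w Hr HG).
  destruct (eventually_not_nonpos_ints m u) as [N HN].
  exists (fun w => Cexp ld * Cprod (fun i => w + u i) m)%C, (fun w => Cprod (fun i => w + v
      i)%C n), (max 1 N).
  assert (Hprod : forall k (z : nat -> C), is_poly (fun w => Cprod (fun i => w + z i)%C k)).
  { intros k z. apply (is_poly_Cprod (fun i w => w + z i)%C). intros; poly. }
  split; [apply is_poly_mul; [apply is_poly_const|apply Hprod]|].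
  split; [apply Hprod|]. split.
  - intros E. destruct (eventually_not_nonpos_ints n v) as [N1 HN1].
    specialize (E (RtoC (INR N1))). revert E. apply Cprod_neq_0. intros i Hi E.
    apply (HN1 N1 (le_n _) i Hi). exists 0%nat. rewrite E; simpl; f_equal; ring.
  - split.
    + intros k Hk. apply HR.
      * apply regular_pos; [exact Hr'|]. simpl. apply lt_0_INR. lia.
      * apply HN. lia.
    + intros t0 _. destruct (avoid_nonpos_ints m u t0) as [e [He H]].
      exists e. split; [exact He|]. intros t Ht w Hw _. apply HR; [exact Hw|].
      intros i Hi. apply H; assumption.
Qed.

(* A covering of the integers by two residue classes of moduli at least 2 has both
   moduli 2, which here would mean p = q = r/2. *)
Lemma good_residue (p q r a b : R) :
  0 < p -> 0 < q -> p + q < r ->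
  exists k : nat, (forall z : Z, p * INR k / r - a <> IZR z) /\ (forall z : Z, q * INR k / r -
      b <> IZR z).
Proof.
  intros Hp Hq Hr.
  set (Bp := fun k : nat => exists z : Z, p * INR k / r - a = IZR z).
  set (Bq := fun k : nat => exists z : Z, q * INR k / r - b = IZR z).
  assert (Gap1 : forall u c, 0 < u < r -> forall k, (exists z, u * INR k / r - c = IZR z) ->
     (exists z, u * INR (S k) / r - c = IZR z) -> False).
  { intros u c Hu k [z1 E1] [z2 E2]. rewrite S_INR in E2.
    assert (E : u / r = IZR (z2 - z1)).
    { rewrite minus_IZR, <- E1, <- E2. field; lra. }
    assert (0 < u / r < 1).
    { split; [apply Rdiv_lt_0_compat; lra|]. apply Rmult_lt_reg_r with r; [lra|].
      unfold Rdiv. rewrite Rmult_assoc, Rinv_l; lra. }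
    rewrite E in H. destruct H as [H1 H2]. apply lt_IZR in H1, H2. lia. }
  assert (Gap2 : forall u c, 0 < u < r -> forall k, (exists z, u * INR k / r - c = IZR z) ->
     (exists z, u * INR (S (S k)) / r - c = IZR z) -> 2 * u = r).
  { intros u c Hu k [z1 E1] [z2 E2]. rewrite !S_INR in E2.
    assert (E : 2 * u / r = IZR (z2 - z1)).
    { rewrite minus_IZR, <- E1, <- E2. field; lra. }
    assert (0 < 2 * u / r < 2).
    { split; [apply Rdiv_lt_0_compat; lra|]. apply Rmult_lt_reg_r with r; [lra|].
      unfold Rdiv. rewrite Rmult_assoc, Rinv_l; lra. }
    rewrite E in H. destruct H as [H1 H2]. apply lt_IZR in H1, H2.
    assert (z2 - z1 = 1)%Z by lia. rewrite H in E.
    apply (f_equal (fun y => y * r)) in E.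
    replace (2 * u / r * r) with (2 * u) in E by (field; lra). lra. }
  apply NNPP. intros HN.
  assert (All : forall k, Bp k \/ Bq k).
  { intros k. apply NNPP. intros Hk. apply HN. exists k.
    split; intros z E; apply Hk; [left|right]; exists z; exact E. }
  assert (Hpr : 0 < p < r) by lra. assert (Hqr : 0 < q < r) by lra.
  assert (P1 := fun k => Gap1 p a Hpr k). assert (Q1 := fun k => Gap1 q b Hqr k).
  assert (P2 := fun k => Gap2 p a Hpr k). assert (Q2 := fun k => Gap2 q b Hqr k).
  destruct (All 0%nat) as [H0|H0], (All 1%nat) as [H1|H1], (All 2%nat) as [H2|H2], (All 3%nat)
      as [H3|H3];
    try (apply (P1 0%nat); assumption); try (apply (P1 1%nat); assumption); try (apply (P1
        2%nat); assumption);
    try (apply (Q1 0%nat); assumption); try (apply (Q1 1%nat); assumption); try (apply (Q1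
        2%nat); assumption);
    [assert (E1 := P2 0%nat H0 H2); assert (E2 := Q2 1%nat H1 H3)
    |assert (E1 := Q2 0%nat H0 H2); assert (E2 := P2 1%nat H1 H3)]; lra.
Qed.

Lemma rterm_continuous (p q r A0 B0 D0 x : R) (k : nat) :
  (forall j, (j < k)%nat -> D0 + INR j <> 0) ->
  continuity_pt (fun t => rterm (A0 + p * t) (B0 + q * t) (D0 + r * t) x k) 0.
Proof.
  assert (Haff : forall c m j, continuity_pt (fun t => c + m * t + j) 0).
  { intros c m j. apply derivable_continuous_pt. apply ex_derive_Reals_0. auto_derive. trivial. }
  induction k as [|k IH]; intros H; simpl.
  - apply continuity_pt_const. intros y z; reflexivity.
  - apply continuity_pt_mult; [apply IH; intros; apply H; lia|].
    apply continuity_pt_div.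
    + apply continuity_pt_mult; [apply continuity_pt_mult|]; [|apply Haff|apply Haff].
      apply continuity_pt_const. intros y z; reflexivity.
    + apply continuity_pt_mult; [|apply Haff].
      apply continuity_pt_const. intros y z; reflexivity.
    + generalize (pos_INR k) (H k ltac:(lia)); intros. apply Rmult_integral_contrapositive.
      split; [lra|]. rewrite Rmult_0_r, Rplus_0_r. assumption.
Qed.

Lemma rterm_neq_0 (A B D x : R) (k : nat) :
  0 < x -> (forall j, (j < k)%nat -> A + INR j <> 0 /\ B + INR j <> 0 /\ D + INR j <> 0) ->
  rterm A B D x k <> 0.
Proof.
  intros Hx. induction k as [|k IH]; intros H; simpl; [lra|].
  destruct (H k ltac:(lia)) as [H1 [H2 H3]].
  apply Rmult_integral_contrapositive. split; [apply IH; intros; apply H; lia|].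
  unfold Rdiv. generalize (pos_INR k); intro.
  repeat (apply Rmult_integral_contrapositive; split); try assumption; try lra.
  apply Rinv_neq_0_compat. apply Rmult_integral_contrapositive. split; lra.
Qed.

Lemma continuity_pt_sum (f : nat -> R -> R) (n : nat) (y : R) :
  (forall k, (k <= n)%nat -> continuity_pt (f k) y) ->
  continuity_pt (fun t => sum_f_R0 (fun k => f k t) n) y.
Proof.
  induction n as [|n IH]; intros H; simpl; [apply H; lia|].
  apply continuity_pt_plus; [apply IH; intros; apply H; lia|apply H; lia].
Qed.

Lemma sum_f_R0_abs_bound (u v : nat -> R) (n : nat) :
  (forall k, (k <= n)%nat -> Rabs (u k) <= v k) -> Rabs (sum_f_R0 u n) <= sum_f_R0 v n.
Proof.
  induction n as [|n IH]; intros H; simpl; [apply H; lia|].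
  eapply Rle_trans; [apply Rabs_triang|].
  apply Rplus_le_compat; [apply IH; intros; apply H; lia|apply H; lia].
Qed.

(* Just to the right of the pole D = -k0 the term of index k0+1 dominates all the
   earlier ones, and all the later ones have its sign. *)
Lemma moments_same_sign_near_pole (p q r A0 B0 x : R) (k0 : nat) :
  0 < p -> 0 < q -> 0 < r -> 0 < x < 1 ->
  (forall j : nat, A0 + INR j <> 0) -> (forall j : nat, B0 + INR j <> 0) ->
  0 < A0 + INR k0 + 1 -> 0 < B0 + INR k0 + 1 ->
  exists d, 0 < d /\ forall t, 0 < t < d ->
    ~ nonpos_int (RtoC (- INR k0 + r * t)) /\
    0 < rmom 0 (A0 + p * t) (B0 + q * t) (- INR k0 + r * t) x *
        rmom 1 (A0 + p * t) (B0 + q * t) (- INR k0 + r * t) x.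
Proof.
  intros Hp Hq Hr Hx HA HB HA1 HB1.
  set (R_ := fun t k => rterm (A0 + p * t) (B0 + q * t) (- INR k0 + r * t) x k).
  (* [num t] is [t] times the term of index [k0 + 1], with the simple pole at [t = 0] cancelled. It
     does not vanish at 0, whereas [t * H t] does. *)
  set (num := fun t => R_ t k0 * (x * (A0 + p * t + INR k0) * (B0 + q * t + INR k0) / ((INR k0
      + 1) * r))).
  (* The weight [INR k + 1] dominates [INR k ^ m] for both moments, [m = 0] and [m = 1]. *)
  set (H := fun t => sum_f_R0 (fun k => (INR k + 1) * Rabs (R_ t k)) k0).
  assert (Hcont : forall k, (k <= k0)%nat -> continuity_pt (fun t => R_ t k) 0).
  { intros k Hk. apply rterm_continuous. intros j Hj.
    assert (INR j < INR k0) by (apply lt_INR; lia). lra. }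
  assert (Haff : forall c m j, continuity_pt (fun t => c + m * t + j) 0).
  { intros c m j. apply derivable_continuous_pt. apply ex_derive_Reals_0. auto_derive. trivial. }
  assert (Hid : continuity_pt (fun t => t) 0) by apply derivable_continuous_pt, derivable_pt_id.
  assert (Hcst : forall c, continuity_pt (fun _ => c) 0)
    by (intros c; apply continuity_pt_const; intros y z; reflexivity).
  assert (Cphi : continuity_pt (fun t => Rabs (num t) - t * H t) 0).
  { apply continuity_pt_minus.
    - apply (continuity_pt_comp num Rabs); [|apply Rcontinuity_abs].
      unfold num. apply continuity_pt_mult; [apply Hcont; lia|].
      unfold Rdiv. repeat apply continuity_pt_mult; auto.
    - apply continuity_pt_mult; [exact Hid|]. unfold H.
      apply (continuity_pt_sum (fun k t => (INR k + 1) * Rabs (R_ t k))).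
      intros k Hk. apply continuity_pt_mult; [apply Hcst|].
      apply (continuity_pt_comp (fun t => R_ t k) Rabs); [apply Hcont, Hk|apply Rcontinuity_abs]. }
  assert (Hphi0 : 0 < Rabs (num 0)).
  { apply Rabs_pos_lt. unfold num. generalize (pos_INR k0); intro.
    apply Rmult_integral_contrapositive. split.
    - apply rterm_neq_0; [lra|]. intros j Hj. rewrite !Rmult_0_r, !Rplus_0_r.
      repeat split; [apply HA|apply HB|]. assert (INR j < INR k0) by (apply lt_INR; lia). lra.
    - unfold Rdiv. rewrite !Rmult_0_r, !Rplus_0_r.
      repeat (apply Rmult_integral_contrapositive; split); try apply HA; try apply HB; try lra.
      apply Rinv_neq_0_compat. apply Rmult_integral_contrapositive. split; lra. }
  destruct (Cphi (Rabs (num 0)) Hphi0) as [d [Hd Hphi]].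
  (* [t < 1 / r] keeps [D + k0 = r t] strictly between 0 and 1: no denominator vanishes, and all
     factors after index [k0] are positive. *)
  exists (Rmin d (/ r)). split; [apply Rmin_pos; [exact Hd|apply Rinv_0_lt_compat, Hr]|].
  intros t Ht. assert (M1 := Rmin_l d (/ r)). assert (M2 := Rmin_r d (/ r)).
  assert (Hrt : 0 < r * t < 1).
  { split; [nra|]. apply Rmult_lt_reg_l with (/ r); [apply Rinv_0_lt_compat, Hr|].
    rewrite <- Rmult_assoc, Rinv_l by lra. lra. }
  assert (HD : ~ nonpos_int (RtoC (- INR k0 + r * t))).
  { intros [k E]. apply RtoC_inj in E.
    assert (E2 : r * t = IZR (Z.of_nat k0 - Z.of_nat k)) by (rewrite minus_IZR, <-
        !INR_IZR_INZ; lra).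
    rewrite E2 in Hrt. destruct Hrt as [H1 H2]. apply lt_IZR in H1, H2. lia. }
  split; [exact HD|].
  assert (Hdom : t * H t < Rabs (num t)).
  { assert (Hb := Hphi t). simpl in Hb. unfold R_dist, D_x, no_cond in Hb.
    rewrite Rmult_0_l, !Rminus_0_r in Hb.
    lapply Hb; [|split; [split; [trivial|lra]|rewrite Rabs_pos_eq; lra]].
    intros Hb2. apply Rabs_def2 in Hb2. lra. }
  clear Hphi Cphi Hcont Haff Hid Hcst Hphi0.
  set (A := A0 + p * t) in *. set (B := B0 + q * t) in *. set (D := - INR k0 + r * t) in *.
  set (tau := rterm A B D x (S k0)).
  assert (Etau : tau * t = num t).
  { unfold tau, num, R_. cbn [rterm]. fold A B D. unfold D at 2.
    replace (- INR k0 + r * t + INR k0) with (r * t) by ring.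
    generalize (pos_INR k0); intro. field. repeat split; lra. }
  assert (Hdom2 : H t < Rabs tau).
  { apply Rmult_lt_reg_l with t; [lra|].
    rewrite <- Etau, Rabs_mult, (Rabs_pos_eq t) in Hdom by lra. lra. }
  assert (HH0 : 0 <= H t).
  { unfold H. apply cond_pos_sum. intros k.
  apply Rmult_le_pos; [generalize (pos_INR k); lra|apply Rabs_pos]. }
  assert (Htail : forall j, 0 <= tau * rterm A B D x (S k0 + j)).
  { induction j as [|j IH].
    - rewrite Nat.add_0_r. fold tau. nra.
    - rewrite Nat.add_succ_r. cbn [rterm]. rewrite <- Rmult_assoc.
      apply Rmult_le_pos; [exact IH|].
      rewrite plus_INR, S_INR. generalize (pos_INR k0) (pos_INR j); intros.
      assert (0 < p * t) by nra. assert (0 < q * t) by nra.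
      apply Rlt_le, Rdiv_lt_0_compat; repeat apply Rmult_lt_0_compat; try lra; unfold A, B, D;
          lra. }
  (* Multiplying by [tau] normalizes the sign: the tail then contributes at least [tau^2], and the
     terms up to [k0] strictly less in absolute value. *)
  assert (Key : forall m, (m <= 1)%nat -> 0 < tau * rmom m A B D x).
  { intros m Hm. destruct (rmom_correct m A B D x Hx HD) as [HS _].
    rewrite <- (is_series_unique _ _ HS).
    assert (Hex : ex_series (fun k => INR k ^ m * rterm A B D x k)) by (eexists; exact HS).
    rewrite (Series_incr_n _ (S k0)) by (try exact Hex; lia). cbn [Init.Nat.pred].
    assert (Hex2 : ex_series (fun k => INR (S k0 + k) ^ m * rterm A B D x (S k0 + k)))
      by (apply (ex_series_incr_n (fun k => INR k ^ m * rterm A B D x k) (S k0)); exact Hex).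
    rewrite Rmult_plus_distr_l.
    assert (T1 : tau * tau <= tau * Series (fun k => INR (S k0 + k) ^ m * rterm A B D x (S k0 +
        k))).
    { rewrite <- Series_scal_l.
    rewrite Series_incr_1 by (apply (ex_series_scal tau (fun k => INR (S k0 + k) ^ m * rterm A
        B D x (S k0 + k))); exact Hex2).
      rewrite Nat.add_0_r. fold tau.
      assert (Hpw : forall k, 1 <= INR (S k0 + k) ^ m).
      { intros k. apply pow_R1_Rle. rewrite <- INR_1. apply le_INR. lia. }
      assert (Z1 : 0 <= Series (fun k => tau * (INR (S k0 + S k) ^ m * rterm A B D x (S k0 + S
          k)))).
      { apply Series_nonneg.
        - apply (ex_series_incr_1 (fun k => tau * (INR (S k0 + k) ^ m * rterm A B D x (S k0 + k)))).
          apply (ex_series_scal tau (fun k => INR (S k0 + k) ^ m * rterm A B D x (S k0 + k)));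
              exact Hex2.
        - intros k. replace (tau * (INR (S k0 + S k) ^ m * rterm A B D x (S k0 + S k)))
            with (INR (S k0 + S k) ^ m * (tau * rterm A B D x (S k0 + S k))) by ring.
          apply Rmult_le_pos; [specialize (Hpw (S k)); lra|apply Htail]. }
      specialize (Hpw 0%nat). rewrite Nat.add_0_r in Hpw.
      assert (0 <= tau * tau) by nra. nra. }
    assert (T2 : Rabs (tau * sum_f_R0 (fun k => INR k ^ m * rterm A B D x k) k0) <= Rabs tau * H t).
    { rewrite Rabs_mult. apply Rmult_le_compat_l; [apply Rabs_pos|].
      apply sum_f_R0_abs_bound. intros k Hk. rewrite Rabs_mult.
      apply Rmult_le_compat_r; [apply Rabs_pos|]. generalize (pos_INR k); intro.
      rewrite Rabs_pos_eq by (apply pow_le; lra).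
      destruct m as [|[|m]]; simpl; [lra|lra|lia]. }
    assert (T3 : Rabs tau * H t < Rabs tau * Rabs tau) by (apply Rmult_lt_compat_l; lra).
    assert (T4 : Rabs tau * Rabs tau = tau * tau) by (rewrite <- Rabs_mult; apply Rabs_pos_eq; nra).
    generalize (Rle_abs (- (tau * sum_f_R0 (fun k => INR k ^ m * rterm A B D x k) k0))).
    rewrite Rabs_Ropp. lra. }
  assert (K0 := Key 0%nat ltac:(lia)). assert (K1 := Key 1%nat ltac:(lia)).
  assert (K2 : 0 < (tau * tau) * (rmom 0 A B D x * rmom 1 A B D x)).
  { replace ((tau * tau) * (rmom 0 A B D x * rmom 1 A B D x)) with ((tau * rmom 0 A B D x) *
      (tau * rmom 1 A B D x)) by ring.
    apply Rmult_lt_0_compat; assumption. }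
  assert (0 <= tau * tau) by nra. nra.
Qed.

(** [T1 / T0] is the mean index, close to [kappa n] by concentration; linear bounds from both sides
    are what the contradiction takes. *)
Lemma mean_index_bounds (p q r a b x : R) :
  0 < p -> 0 < q -> 0 < r -> 0 < x < 1 ->
  exists c1 c2 N, 0 < c1 /\ forall n, (N <= n)%nat ->
    let n' := INR n in
    let T m := rmom m (p * n' + a) (q * n' + b) (r * n') x in
    1 <= n' /\ 0 < T 0%nat /\ c1 * n' * T 0%nat <= T 1%nat <= c2 * n' * T 0%nat.
Proof.
  intros Hp Hq Hr Hx.
  destruct (concentration p q r a b x Hp Hq Hr Hx) as [K [N [HK HN]]].
  destruct (kappa_spec p q r x Hp Hq Hx) as [_k' [Hk0 _]]. clear _k'.
  set (k0 := kappa p q r x) in *.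
  destruct (eventually_INR_gt (2 * K / k0 ^ 2)) as [N1 HN1].
  (* Dropping [T2] in [concentration] gives [2 k0 n' T1 >= (k0^2 n'^2 - K n') T0], and
     [n' >= 2 K / k0^2] leaves half of the square. The upper constant comes from
     [2 n' T1 <= T2 + n'^2 T0]. *)
  exists (k0 / 4), (K + k0 ^ 2 + 1), (max N N1). split; [lra|].
  intros n Hn. cbv zeta. destruct (HN n ltac:(lia)) as [Hn1 [HA [HB HV]]].
  specialize (HN1 n ltac:(lia)).
  set (n' := INR n) in *. set (A := p * n' + a) in *. set (B := q * n' + b) in *.
  set (D := r * n') in *.
  assert (HA0 : 0 < A) by nra. assert (HB0 : 0 < B) by nra. assert (HD0 : 0 < D) by (unfold D; nra).
  assert (P0 : 0 < rmom 0 A B D x) by (apply rmom_0_pos; assumption).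
  assert (HT := rmom_nonneg A B D x).
  set (T0 := rmom 0 A B D x) in *. set (T1 := rmom 1 A B D x) in *.
  set (T2 := rmom 2 A B D x) in *. set (T3 := rmom 3 A B D x) in *.
  split; [exact Hn1|]. split; [exact P0|].
  assert (P2 : 0 <= 0 * T0 + 0 * T1 + 1 * T2 + 0 * T3).
  { apply HT; auto. intros k. generalize (pow2_ge_0 (INR k)); lra. }
  assert (PN : 0 <= n' ^ 2 * T0 + (- (2 * n')) * T1 + 1 * T2 + 0 * T3).
  { apply HT; auto. intros k.
    replace (n' ^ 2 + - (2 * n') * INR k + 1 * INR k ^ 2 + 0 * INR k ^ 3)
      with ((INR k - n') ^ 2) by ring. apply pow2_ge_0. }
  assert (P4 : 0 <= 4 * k0 ^ 2 * n' ^ 2 * T0 + (- (4 * k0 * n')) * T1 + 1 * T2 + 0 * T3).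
  { apply HT; auto. intros k.
    replace (4 * k0 ^ 2 * n' ^ 2 + - (4 * k0 * n') * INR k + 1 * INR k ^ 2 + 0 * INR k ^ 3)
      with ((INR k - 2 * k0 * n') ^ 2) by ring. apply pow2_ge_0. }
  assert (HT0n : 0 < n' * T0) by (apply Rmult_lt_0_compat; lra).
  split.
  - assert (Hk2 : 0 < k0 ^ 2) by (apply pow_lt; exact Hk0).
    assert (HKn : 2 * K <= k0 ^ 2 * n').
    { apply Rle_trans with (k0 ^ 2 * (2 * K / k0 ^ 2)); [right; field; lra|].
    apply Rmult_le_compat_l; lra. }
    assert (2 * K * (n' * T0) <= k0 ^ 2 * n' * (n' * T0)) by (apply Rmult_le_compat_r; lra).
    apply Rmult_le_reg_l with (2 * k0 * n'); [apply Rmult_lt_0_compat; lra|].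
    replace (2 * k0 * n' * (k0 / 4 * n' * T0)) with (k0 ^ 2 * n' * (n' * T0) / 2) by field. lra.
  - apply Rmult_le_reg_l with (2 * n'); [lra|].
    assert (n' * T0 <= n' * n' * T0) by nra.
    assert (K * (n' * T0) <= K * (n' * n' * T0)) by (apply Rmult_le_compat_l; lra).
    assert (0 <= n' * n' * T0) by nra.
    replace (2 * n' * ((K + k0 ^ 2 + 1) * n' * T0))
      with (2 * (K * (n' * n' * T0)) + 2 * k0 ^ 2 * (n' * n' * T0) + 2 * (n' * n' * T0)) by ring.
    assert (T2 <= 2 * (K * n' * T0) + 2 * k0 ^ 2 * n' ^ 2 * T0) by lra.
    lra.
Qed.

Lemma Rdiv_le_compat (a a' b b' : R) : 0 <= a -> a <= a' -> 0 < b' -> b' <= b -> a / b <= a' / b'.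
Proof.
  intros Ha Haa Hb Hbb. unfold Rdiv. apply Rmult_le_compat; try assumption.
  - apply Rlt_le, Rinv_0_lt_compat; lra.
  - apply Rinv_le_contravar; assumption.
Qed.

(* The quotient U/V would be asymptotic to c w with c > 0 at +oo and c <= 0 at -oo. *)
Lemma no_rational_mean (U V : C -> C) (c1 c2 : R) (N : nat) :
  is_poly U -> is_poly V -> ~ (forall w, V w = 0) -> 0 < c1 ->
  (forall n, (N <= n)%nat -> exists m : R, c1 * INR n <= m <= c2 * INR n /\
     U (RtoC (INR n)) = (V (RtoC (INR n)) * RtoC m)%C) ->
  (forall M : R, exists t m : R, t < - M /\ 0 < m /\ U (RtoC t) = (V (RtoC t) * RtoC m)%C) ->
  False.
Proof.
  intros HU HV HV0 Hc1 Hright Hleft.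
  destruct (is_poly_large_neq_0 V HV HV0) as [MV HMV].
  destruct (is_poly_leading V HV) as [H|[e' [v [K' [Hv [HK' LV]]]]]]; [contradiction|].
  destruct (is_poly_leading U HU) as [H|[e [u [K [Hu [HK LU]]]]]].
  { destruct (eventually_INR_gt (Rmax 1 MV)) as [N1 HN1]. set (n := max N N1).
    specialize (HN1 n ltac:(unfold n; lia)).
    assert (R1 := Rmax_l 1 MV). assert (R2 := Rmax_r 1 MV).
    destruct (Hright n ltac:(unfold n; lia)) as [m [Hm E]]. rewrite H in E.
    symmetry in E. revert E. apply Cmult_neq_0.
    - apply HMV. rewrite Cmod_R, Rabs_pos_eq by apply pos_INR. lra.
    - intro E. apply RtoC_inj in E. nra. }
  set (rho := (u / v)%C).
  assert (Hvp := proj1 (Cmod_gt_0 v) Hv). assert (Hup := proj1 (Cmod_gt_0 u) Hu).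
  set (K2 := (K * Cmod v + Cmod u * K') / (Cmod v * (Cmod v / 2))).
  assert (HK2 : 0 <= K2).
  { unfold K2. apply Rmult_le_pos; [nra|]. apply Rlt_le, Rinv_0_lt_compat. nra. }
  set (M0 := Rmax 1 (Rmax MV (2 * K' / Cmod v))).
  assert (M1 := Rmax_l 1 (Rmax MV (2 * K' / Cmod v))). fold M0 in M1.
  assert (M2 := Rmax_r 1 (Rmax MV (2 * K' / Cmod v))). fold M0 in M2.
  assert (M3 := Rmax_l MV (2 * K' / Cmod v)). assert (M4 := Rmax_r MV (2 * K' / Cmod v)).
  (* On the real axis [m = U / V]. Dividing by the leading powers compares [m t^(e' - e)] with the
     quotient [rho] of the leading coefficients, on both half-lines at once. *)
  assert (Q : forall t m : R, M0 < Rabs t -> U (RtoC t) = (V (RtoC t) * RtoC m)%C ->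
     Cmod (RtoC (m * t ^ e' / t ^ e) - rho) <= K2 / Rabs t).
  { intros t m Ht E.
    assert (Ht0 : t <> 0) by (intro E0; rewrite E0, Rabs_R0 in Ht; lra).
    assert (HC : Cmod (RtoC t) = Rabs t) by apply Cmod_R.
    specialize (LU (RtoC t)). specialize (LV (RtoC t)). rewrite HC in LU, LV.
    specialize (LU ltac:(lra)). specialize (LV ltac:(lra)).
    assert (HVt : V (RtoC t) <> 0) by (apply HMV; rewrite HC; lra).
    assert (Hte : (RtoC t ^ e)%C <> 0) by (apply Cpow_nz; intro E0; apply RtoC_inj in E0;
        contradiction).
    assert (Hte' : (RtoC t ^ e')%C <> 0) by (apply Cpow_nz; intro E0; apply RtoC_inj in E0;
        contradiction).
    set (al := (U (RtoC t) / RtoC t ^ e)%C) in *. set (be := (V (RtoC t) / RtoC t ^ e')%C) in *.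
    assert (Hbe : Cmod v / 2 <= Cmod be).
    { assert (H := Cmod_triangle_inv v (be - v)). replace (v + (be - v))%C with be in H by ring.
      assert (K' / Rabs t <= Cmod v / 2); [|lra].
      apply Rmult_le_reg_r with (Rabs t); [lra|]. unfold Rdiv at 1.
      rewrite Rmult_assoc, Rinv_l by lra.
      assert (Cmod v / 2 * (2 * K' / Cmod v) <= Cmod v / 2 * Rabs t) by (apply
          Rmult_le_compat_l; lra).
      replace (Cmod v / 2 * (2 * K' / Cmod v)) with K' in H0 by (field; lra). lra. }
    assert (Hbe0 : be <> 0) by (intro E0; rewrite E0, Cmod_0 in Hbe; lra).
    replace (RtoC (m * t ^ e' / t ^ e)) with (al / be)%C.
    2:{ unfold al, be. rewrite E, RtoC_div, RtoC_mult, !RtoC_pow by (apply pow_nonzero, Ht0).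
        field. repeat split; assumption. }
    replace (al / be - rho)%C with (((al - u) * v - u * (be - v)) / (v * be))%C
      by (unfold rho; field; split; assumption).
    rewrite Cmod_div by (apply Cmult_neq_0; assumption).
    apply Rle_trans with (((K * Cmod v + Cmod u * K') / Rabs t) / (Cmod v * (Cmod v / 2))).
    2:{ right. unfold K2. field. split; lra. }
    apply Rdiv_le_compat.
    - apply Cmod_ge_0.
    - unfold Cminus at 1. eapply Rle_trans; [apply Cmod_triangle|]. rewrite Cmod_opp, !Cmod_mult.
      replace ((K * Cmod v + Cmod u * K') / Rabs t) with (K / Rabs t * Cmod v + Cmod u * (K' /
          Rabs t)) by (field; lra).
      apply Rplus_le_compat; [apply Rmult_le_compat_r|apply Rmult_le_compat_l]; lra.
    - nra.
    - rewrite Cmod_mult. apply Rmult_le_compat_l; lra. }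
  assert (Hrho : 0 < Cmod rho) by (unfold rho; rewrite Cmod_div by exact Hv; apply
      Rdiv_lt_0_compat; assumption).
  set (c2' := Rabs c2).
  destruct (eventually_INR_gt (M0 + (Cmod rho + K2) / c1 + (c2' + K2) / Cmod rho + 2 * K2 /
      c1)) as [N1 HN1].
  set (n := max N N1). specialize (HN1 n ltac:(unfold n; lia)).
  destruct (Hright n ltac:(unfold n; lia)) as [m [Hm E]].
  set (n' := INR n) in *.
  assert (G1 : 0 <= (Cmod rho + K2) / c1) by (apply Rmult_le_pos; [lra|apply Rlt_le,
      Rinv_0_lt_compat, Hc1]).
  assert (G2 : 0 <= (c2' + K2) / Cmod rho)
    by (apply Rmult_le_pos; [generalize (Rabs_pos c2); unfold c2'; lra|apply Rlt_le,
        Rinv_0_lt_compat, Hrho]).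
  assert (G3 : 0 <= 2 * K2 / c1) by (apply Rmult_le_pos; [lra|apply Rlt_le, Rinv_0_lt_compat, Hc1]).
  assert (Hn1 : 1 < n') by lra.
  assert (Qn := Q n' m ltac:(rewrite Rabs_pos_eq; lra) E). rewrite (Rabs_pos_eq n') in Qn by lra.
  assert (F1 : Cmod rho + K2 < c1 * n').
  { apply Rle_lt_trans with (c1 * ((Cmod rho + K2) / c1)); [right; field; lra|].
  apply Rmult_lt_compat_l; lra. }
  assert (F2 : c2' + K2 < Cmod rho * n').
  { apply Rle_lt_trans with (Cmod rho * ((c2' + K2) / Cmod rho)); [right; field; lra|].
  apply Rmult_lt_compat_l; lra. }
  assert (F3 : 2 * K2 < c1 * n').
  { apply Rle_lt_trans with (c1 * (2 * K2 / c1)); [right; field; lra|].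
  apply Rmult_lt_compat_l; lra. }
  assert (K2n : K2 / n' <= K2).
  { apply Rmult_le_reg_r with n'; [lra|]. unfold Rdiv. rewrite Rmult_assoc, Rinv_l by lra. nra. }
  assert (Hm0 : 0 < m) by nra.
  (* The degree of [U / V]: at most 0 contradicts [m >= c1 n], at least 2 contradicts [m <= c2 n],
     and degree 1 forces the real part of [rho] above [c1 / 2], which a positive [m'] at a large
     negative [t] refutes. *)
  destruct (lt_eq_lt_dec e (S e')) as [[Hlt|Heq]|Hgt].
  - assert (Ey : m * n' ^ e' / n' ^ e = m * n' ^ (e' - e)).
    { replace e' with (e + (e' - e))%nat at 1 by lia. rewrite pow_add. field.
    apply pow_nonzero; lra. }
    rewrite Ey in Qn.
    assert (1 <= n' ^ (e' - e)) by (apply pow_R1_Rle; lra).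
    assert (m <= m * n' ^ (e' - e)) by nra.
    assert (H1 := Cmod_triangle_inv (RtoC (m * n' ^ (e' - e))) (- rho)).
    rewrite Cmod_opp, Cmod_R, Rabs_pos_eq in H1 by nra. unfold Cminus in Qn. lra.
  - rewrite Heq in *.
    assert (Ey : m * n' ^ e' / n' ^ S e' = m / n') by (simpl; field; repeat split; try apply
        pow_nonzero; lra).
    rewrite Ey in Qn.
    assert (Hre : c1 / 2 < Re rho).
    { assert (H1 := re_le_Cmod (RtoC (m / n') - rho)).
      change (Re (RtoC (m / n') - rho)) with (m / n' - Re rho) in H1.
      assert (c1 <= m / n').
      { apply Rmult_le_reg_r with n'; [lra|]. unfold Rdiv. rewrite Rmult_assoc, Rinv_l by lra.
      lra. }
      assert (K2 / n' < c1 / 2).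
      { apply Rmult_lt_reg_r with n'; [lra|]. unfold Rdiv at 1.
      rewrite Rmult_assoc, Rinv_l by lra. lra. }
      apply Rabs_le_between in H1.  lra. }
    destruct (Hleft (M0 + 2 * K2 / c1)) as [t [m' [Ht [Hm' E']]]].
    assert (Hta : Rabs t = - t) by (apply Rabs_left; lra).
    assert (Qt := Q t m' ltac:(rewrite Hta; lra) E'). rewrite Hta in Qt.
    assert (Ey' : m' * t ^ e' / t ^ S e' = m' / t) by (simpl; field; repeat split; try apply
        pow_nonzero; lra).
    rewrite Ey' in Qt.
    assert (H1 := re_le_Cmod (RtoC (m' / t) - rho)).
    change (Re (RtoC (m' / t) - rho)) with (m' / t - Re rho) in H1.
    assert (K2 / - t <= c1 / 2).
    { apply Rmult_le_reg_r with (- t); [lra|]. unfold Rdiv at 1. rewrite Rmult_assoc, Rinv_l by lra.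
      assert (c1 / 2 * (2 * K2 / c1) <= c1 / 2 * - t) by (apply Rmult_le_compat_l; lra).
      replace (c1 / 2 * (2 * K2 / c1)) with K2 in H by (field; lra). lra. }
    assert (m' / t < 0).
    { apply Ropp_lt_cancel. rewrite Ropp_0. replace (- (m' / t)) with (m' / - t) by (field; lra).
      apply Rdiv_lt_0_compat; lra. }
    apply Rabs_le_between in H1.  lra.
  - assert (Ey : m * n' ^ e' / n' ^ e = m / n' ^ (e - e')).
    { replace e with (e' + (e - e'))%nat at 1 by lia. rewrite pow_add. field.
    split; apply pow_nonzero; lra. }
    rewrite Ey in Qn.
    assert (Hpw : n' * n' <= n' ^ (e - e')).
    { replace (n' * n') with (n' ^ 2) by ring. apply Rle_pow; [lra|lia]. }
    assert (Hy : m / n' ^ (e - e') <= c2' / n').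
    { apply Rmult_le_reg_r with (n' ^ (e - e')); [nra|]. unfold Rdiv at 1.
      rewrite Rmult_assoc, Rinv_l, Rmult_1_r by (apply pow_nonzero; lra).
      apply Rle_trans with (c2' / n' * (n' * n')).
      - replace (c2' / n' * (n' * n')) with (c2' * n') by (field; lra).
        assert (c2 <= c2') by apply Rle_abs. nra.
      - apply Rmult_le_compat_l; [|exact Hpw].
      apply Rmult_le_pos; [apply Rabs_pos|apply Rlt_le, Rinv_0_lt_compat; lra]. }
    assert (Hy0 : 0 <= m / n' ^ (e - e')) by (apply Rlt_le, Rdiv_lt_0_compat; [exact Hm0|nra]).
    assert (H1 := Cmod_triangle_inv rho (RtoC (m / n' ^ (e - e')) - rho)).
    replace (rho + (RtoC (m / n' ^ (e - e')) - rho))%C with (RtoC (m / n' ^ (e - e'))) in H1 by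
        ring.
    rewrite Cmod_R, Rabs_pos_eq in H1 by exact Hy0.
    assert (Cmod rho <= c2' / n' + K2 / n') by lra.
    assert (Cmod rho * n' <= (c2' / n' + K2 / n') * n') by (apply Rmult_le_compat_r; lra).
    replace ((c2' / n' + K2 / n') * n') with (c2' + K2) in H0 by (field; lra). lra.
Qed.

Lemma Cpoch_not_identically_0 (c0 : C) (n : nat) (k : R) :
  0 < k -> 0 < Re c0 \/ c0 = 0 -> ~ (forall w, Cpoch (RtoC k * w + c0) n = 0).
Proof.
  intros Hk Hc H. specialize (H 1). revert H. apply Cpoch_neq_0, pos_not_nonpos_int.
  rewrite Re_plus, Re_mult. simpl. destruct Hc as [Hc| ->]; simpl; lra.
Qed.

(** Eliminating [f(w + 1)] between the contiguity relation and the rational ratio gives [U f = V g],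
    with [g] the Euler derivative, and [V] can vanish identically only if the entry does. At the
    chosen real points [g / f] has the sign and size that [no_rational_mean] excludes. *)
Lemma contig_m12_vanishes (p q s : nat) (a b x : R) :
  (0 < p)%nat -> (0 < q)%nat -> (0 < s)%nat -> 0 < x < 1 ->
  rational_ratio_on_axis (int_data p q s a b x) ->
  forall w, m12 (contig_mat p q s a b x w) = 0.
Proof.
  intros Hp Hq Hs Hx [P [Q [N [HP [HQ [HQ0 [Hpos Hneg]]]]]]].
  apply NNPP. intros Hm0.
  destruct (is_poly_contig_mat p q s a b x) as [Pm1 [Pm2 _]].
  set (r := (p + q + s)%nat) in *.
  assert (Rp := lt_0_INR p Hp). assert (Rq := lt_0_INR q Hq). assert (Rs := lt_0_INR s Hs).
  assert (Er : INR r = INR p + INR q + INR s) by (unfold r; rewrite !plus_INR; ring).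
  assert (Rr : 0 < INR r) by lra.
  set (Cc := fun w => Cpoch (RtoC (INR r) * w) r).
  assert (PC : is_poly Cc) by (apply is_poly_Cpoch; poly).
  assert (PD : is_poly (contig_den p q s a b x)) by apply is_poly_contig_den.
  assert (HC0 : ~ (forall w, Cc w = 0)).
  { intros E. apply (Cpoch_not_identically_0 0 r (INR r) Rr); [right; reflexivity|].
    intros w. rewrite Cplus_0_r. apply E. }
  set (V := fun w => (Cc w * Q w * m12 (contig_mat p q s a b x w))%C).
  set (U := fun w => (contig_den p q s a b x w * P w - Cc w * Q w * m11 (contig_mat p q s a b x
      w))%C).
  assert (PV : is_poly V) by (unfold V; repeat apply is_poly_mul; assumption).
  assert (PU : is_poly U).
  { unfold U. apply is_poly_sub; (apply is_poly_mul; [|assumption]); [exact PD|].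
    apply is_poly_mul; assumption. }
  assert (HV0 : ~ (forall w, V w = 0)).
  { unfold V. apply is_poly_mul_neq_0; [apply is_poly_mul| | |]; try assumption.
    apply is_poly_mul_neq_0; assumption. }
  assert (UV : forall (w : C) (F G : R), regular (int_data p q s a b x) w -> F <> 0 ->
    hgf (int_data p q s a b x) w = RtoC F ->
    hgf_euler (INR p) (INR q) (INR r) a b x w = RtoC G ->
    (Q w * hgf (int_data p q s a b x) (w + 1) = P w * hgf (int_data p q s a b x) w)%C ->
    U w = (V w * RtoC (G / F))%C).
  { intros w F G Hw HF EF EG EQ.
    assert (E := hgf_contiguity p q s a b x w Hx Hw). cbv zeta in E. fold r in E.
    rewrite EG, EF in E. rewrite EF in EQ.
    assert (HF' : RtoC F <> 0) by (intro E0; apply RtoC_inj in E0; contradiction).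
    rewrite RtoC_div by exact HF.
    assert (E3 : (contig_den p q s a b x w * (P w * RtoC F) =
      Cc w * Q w * (m11 (contig_mat p q s a b x w) * RtoC F + m12 (contig_mat p q s a b x w) *
          RtoC G))%C).
    { rewrite <- EQ.
      transitivity (Q w * (contig_den p q s a b x w * hgf (int_data p q s a b x) (w + 1)))%C;
          [ring|].
      rewrite E. unfold Cc. ring. }
    unfold U, V.
    transitivity ((contig_den p q s a b x w * (P w * RtoC F) - Cc w * Q w * m11 (contig_mat p q
        s a b x w) * RtoC F) / RtoC F)%C.
    { field. exact HF'. }
    rewrite E3. field. exact HF'. }
  destruct (mean_index_bounds (INR p) (INR q) (INR r) a b x Rp Rq Rr Hx) as [c1 [c2 [N1 [Hc1
      HN1]]]].
  apply (no_rational_mean U V c1 c2 (max N N1) PU PV HV0 Hc1).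
  - intros n Hn. destruct (HN1 n ltac:(lia)) as [Hn1 [HT0 [HB1 HB2]]].
    set (n' := INR n) in *.
    set (T0 := rmom 0 (INR p * n' + a) (INR q * n' + b) (INR r * n') x) in *.
    set (T1 := rmom 1 (INR p * n' + a) (INR q * n' + b) (INR r * n') x) in *.
    assert (HD : 0 < INR r * n') by nra.
    exists (T1 / T0). split; [split|].
    + apply Rmult_le_reg_r with T0; [exact HT0|]. unfold Rdiv.
    rewrite (Rmult_assoc T1), Rinv_l by lra. lra.
    + apply Rmult_le_reg_r with T0; [exact HT0|]. unfold Rdiv.
    rewrite (Rmult_assoc T1), Rinv_l by lra. lra.
    + apply UV.
      * apply regular_pos; simpl; fold r; lra.
      * lra.
      * unfold int_data. fold r. apply hgf_real; assumption.
      * unfold hgf_euler. rewrite <- !RtoC_mult, <- !RtoC_plus.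
        apply rmom_correct; [exact Hx|]. apply pos_not_nonpos_int. exact HD.
      * apply Hpos. lia.
  - intros M.
    (* The poles used are at [w = - n - k1 / r]. The residue [k1] is chosen so that neither
       [p w + a] nor [q w + b] is a nonpositive integer there; otherwise the terms past the pole
       could be killed by a zero numerator. *)
    destruct (good_residue (INR p) (INR q) (INR r) a b Rp Rq ltac:(lra)) as [k1 [Hgp Hgq]].
    set (e1 := INR k1 / INR r).
    assert (He1 : 0 <= e1) by (apply Rmult_le_pos; [apply pos_INR|apply Rlt_le,
        Rinv_0_lt_compat, Rr]).
    (* As [r > p] and [r > q], the numerator parameters increased by [k0 + 1] grow with [n] and
       become positive, so the tail past the pole has constant sign. *)
    destruct (eventually_affine_ge (INR r - INR p) (a + 1 + (INR k1 - INR p * e1)) ltac:(lra))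
        as [N2 HN2].
    destruct (eventually_affine_ge (INR r - INR q) (b + 1 + (INR k1 - INR q * e1)) ltac:(lra))
        as [N3 HN3].
    destruct (eventually_INR_gt (Rabs M + INR N + 1)) as [N4 HN4].
    set (n := max N2 (max N3 N4)).
    specialize (HN2 n ltac:(unfold n; lia)). specialize (HN3 n ltac:(unfold n; lia)).
    specialize (HN4 n ltac:(unfold n; lia)).
    set (n' := INR n) in *.
    assert (Hn0 : 0 < n') by (generalize (Rabs_pos M) (pos_INR N); lra).
    set (t0 := - (n' + e1)). set (k0 := (r * n + k1)%nat).
    assert (Ek0 : INR k0 = INR r * n' + INR k1) by (unfold k0; rewrite plus_INR, mult_INR;
        reflexivity).
    assert (Et0 : INR r * t0 = - INR k0).
    { unfold t0, e1. rewrite Ek0. field. lra. }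
    assert (Hz : forall (u : nat) (c : R), (forall z : Z, INR u * INR k1 / INR r - c <> IZR z) ->
       forall j : nat, INR u * t0 + c + INR j <> 0).
    { intros u c Hu j E.
      apply (Hu (Z.of_nat j - Z.of_nat u * Z.of_nat n)%Z).
      rewrite minus_IZR, mult_IZR, <- !INR_IZR_INZ. fold n'.
      unfold t0, e1 in E.
      replace (INR u * - (n' + INR k1 / INR r)) with (- (INR u * n') - INR u * INR k1 / INR r)
          in E by (field; lra).
      lra. }
    destruct (moments_same_sign_near_pole (INR p) (INR q) (INR r) (INR p * t0 + a) (INR q * t0
        + b) x k0
      Rp Rq Rr Hx (Hz p a Hgp) (Hz q b Hgq)) as [d [Hd Hsign]].
    { rewrite Ek0. unfold t0. nra. }
    { rewrite Ek0. unfold t0. nra. }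
    destruct (Hneg t0) as [d' [Hd' Hrat]].
    { unfold t0. generalize (Rabs_pos M); lra. }
    set (t := Rmin 1 (Rmin d d') / 2).
    assert (L1 := Rmin_l 1 (Rmin d d')). assert (L2 := Rmin_r 1 (Rmin d d')).
    assert (L3 := Rmin_l d d'). assert (L4 := Rmin_r d d').
    assert (L5 : 0 < Rmin 1 (Rmin d d')) by (repeat apply Rmin_pos; lra).
    assert (Ht : 0 < t) by (unfold t; lra).
    destruct (Hsign t ltac:(unfold t; lra)) as [Hreg Hs01].
    replace (INR p * t0 + a + INR p * t) with (INR p * (t0 + t) + a) in Hs01 by ring.
    replace (INR q * t0 + b + INR q * t) with (INR q * (t0 + t) + b) in Hs01 by ring.
    replace (- INR k0 + INR r * t) with (INR r * (t0 + t)) in * by (rewrite <- Et0; ring).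
    set (w := t0 + t) in *.
    set (T0 := rmom 0 (INR p * w + a) (INR q * w + b) (INR r * w) x) in *.
    set (T1 := rmom 1 (INR p * w + a) (INR q * w + b) (INR r * w) x) in *.
    assert (HT0 : T0 <> 0) by (intro E; rewrite E in Hs01; lra).
    assert (Hregw : regular (int_data p q s a b x) (RtoC w)).
    { unfold regular, int_data. cbn [dr]. fold r. rewrite <- RtoC_mult. exact Hreg. }
    assert (EF : hgf (int_data p q s a b x) (RtoC w) = RtoC T0).
    { unfold int_data. fold r. rewrite hgf_hmom, <- !RtoC_mult, <- !RtoC_plus.
      apply rmom_correct; assumption. }
    assert (EG : hgf_euler (INR p) (INR q) (INR r) a b x (RtoC w) = RtoC T1).
    { unfold hgf_euler. rewrite <- !RtoC_mult, <- !RtoC_plus. apply rmom_correct; assumption. }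
    exists w, (T1 / T0). split; [|split].
    + unfold w, t0, t. generalize (Rle_abs M) (pos_INR N); lra.
    + replace (T1 / T0) with (T0 * T1 / (T0 * T0)) by (field; exact HT0).
      apply Rdiv_lt_0_compat; [exact Hs01|]. nra.
    + apply (UV _ T0 T1 Hregw HT0 EF EG).
      assert (Hne : hgf (int_data p q s a b x) (RtoC w) <> 0)
        by (rewrite EF; intro E; apply RtoC_inj in E; contradiction).
      exact (Hrat t ltac:(unfold t; lra) Hregw Hne).
Qed.

(** * Recovering a gamma product formula from its recurrence *)

Fixpoint Csum (f : nat -> C) (n : nat) : C :=
  match n with
  | O => RtoC 0
  | S k => (Csum f k + f k)%C
  end.

Lemma Cconv_lim_eq (u : nat -> C) (l m : C) : Cconv u l -> l = m -> Cconv u m.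
Proof. intros H <-; exact H. Qed.

Lemma Cprod_INR_ratio (u : nat -> C) (m : nat) :
  Cconv (fun n => Cprod (fun i => 1 + u i * RtoC (/ INR n))%C m) 1 /\
  Cconv (fun n => RtoC (INR n) * (Cprod (fun i => 1 + u i * RtoC (/ INR n)) m - 1))%C (Csum u m).
Proof.
  assert (Hi : Cconv (fun n => RtoC (/ INR n)) 0) by apply Cconv_RtoC, is_lim_seq_inv_INR.
  induction m as [|m [IH1 IH2]]; simpl.
  - split; [apply Cconv_const|].
    apply Cconv_ext with (fun _ => RtoC 0); [intros; ring|apply Cconv_const].
  - assert (Hu : Cconv (fun n => 1 + u m * RtoC (/ INR n))%C 1).
    { apply Cconv_lim_eq with (1 + u m * 0)%C; [|ring].
      apply Cconv_plus; [apply Cconv_const|]. apply Cconv_mult; [apply Cconv_const|exact Hi]. }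
    split.
    + apply Cconv_lim_eq with (1 * 1)%C; [|ring]. apply Cconv_mult; assumption.
    + apply Cconv_ext_loc with (fun n => RtoC (INR n) * (Cprod (fun i => 1 + u i * RtoC (/ INR
        n)) m - 1)
        * (1 + u m * RtoC (/ INR n)) + u m)%C.
      * exists 1%nat. intros n Hn. apply lt_0_INR in Hn.
        assert (RtoC (INR n) <> 0) by (intro E; apply RtoC_inj in E; lra).
        rewrite RtoC_inv by lra. field. assumption.
      * apply Cconv_plus; [|apply Cconv_const].
        replace (Csum u m) with (Csum u m * 1)%C by ring. apply Cconv_mult; assumption.
Qed.

Lemma Cprod_INR_factor (u : nat -> C) (m n : nat) :
  (0 < n)%nat ->
  Cprod (fun i => RtoC (INR n) + u i)%C m =
  (RtoC (INR n) ^ m * Cprod (fun i => 1 + u i * RtoC (/ INR n)) m)%C.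
Proof.
  intros Hn. apply lt_0_INR in Hn.
  assert (RtoC (INR n) <> 0) by (intro E; apply RtoC_inj in E; lra).
  rewrite <- Cprod_scal. apply Cprod_ext. intros i _. rewrite RtoC_inv by lra. field. assumption.
Qed.

Lemma Cprod_RtoC (u : nat -> R) (m : nat) :
  exists y, Cprod (fun i => RtoC (u i)) m = RtoC y /\ ((forall i, (i < m)%nat -> 0 < u i) -> 0 < y).
Proof.
  induction m as [|m [y [Ey Hy]]]; simpl.
  - exists 1. split; [reflexivity|intros; lra].
  - exists (y * u m). rewrite Ey, RtoC_mult. split; [reflexivity|].
    intros H. apply Rmult_lt_0_compat; [apply Hy; intros; apply H; lia|apply H; lia].
Qed.

(** The [v_i] are arbitrary complex numbers. A monic product that is real at all large [n] has a
    real second coefficient, and that coefficient is their sum; so the power of [N] in the final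
    limit has a real exponent. *)
Lemma Csum_real (u : nat -> C) (m : nat) :
  eventually (fun n => Im (Cprod (fun i => RtoC (INR n) + u i)%C m) = 0) -> Im (Csum u m) = 0.
Proof.
  intros [N HN]. destruct (Cprod_INR_ratio u m) as [_ [_ H]].
  assert (H0 : is_lim_seq (fun n => Im (RtoC (INR n) * (Cprod (fun i => 1 + u i * RtoC (/ INR
      n)) m - 1))%C) 0).
  { eapply is_lim_seq_ext_loc; [|apply is_lim_seq_const].
    exists (max 1 N). intros n Hn. symmetry. specialize (HN n ltac:(lia)).
    rewrite Cprod_INR_factor in HN by lia. rewrite <- RtoC_pow, Im_mult in HN.
    change (Re (RtoC (INR n ^ m))) with (INR n ^ m) in HN.
    change (Im (RtoC (INR n ^ m))) with 0 in HN.
    assert (HI : Im (Cprod (fun i => 1 + u i * RtoC (/ INR n))%C m) = 0).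
    { apply Rmult_eq_reg_l with (INR n ^ m); [|apply pow_nonzero, Rgt_not_eq, lt_0_INR; lia].
      lra. }
    rewrite Im_mult. unfold Cminus. rewrite Im_plus, HI. change (Im (RtoC (INR n))) with 0.
    change (Im (- (1))%C) with (- 0). ring. }
  apply is_lim_seq_unique in H, H0. rewrite H in H0. injection H0. auto.
Qed.

(** [w + i/r = - k] means [r w = - (r k + i)]: the poles of the numerator gammas are excluded
    together with those of the series. *)
Lemma regular_not_nonpos_int (lam : data) (r : nat) (w : C) (i : nat) :
  (0 < r)%nat -> dr lam = INR r -> regular lam w -> ~ nonpos_int (w + RtoC (INR i / INR r))%C.
Proof.
  intros Hr Er Hw [k E]. apply Hw. exists (r * k + i)%nat. rewrite Er.
  apply lt_0_INR in Hr.
  replace w with (w + RtoC (INR i / INR r) - RtoC (INR i / INR r))%C by ring. rewrite E.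
  rewrite <- RtoC_minus, <- RtoC_mult. f_equal. rewrite plus_INR, mult_INR. field. lra.
Qed.

Lemma regular_add (lam : data) (r : nat) (w : C) (k : nat) :
  dr lam = INR r -> regular lam w -> regular lam (w + RtoC (INR k))%C.
Proof.
  intros Er Hw. induction k as [|k IH].
  - simpl. rewrite Cplus_0_r. exact Hw.
  - rewrite RtoC_INR_S, Cplus_assoc. apply (regular_succ lam _ r Er IH).
Qed.

Lemma recurrence_iter (lam : data) (r : nat) (d : R) (v : nat -> C) :
  (0 < r)%nat -> dr lam = INR r ->
  (forall w, regular lam w ->
    (Cprod (fun i => w + v i) r * hgf lam (w + 1) =
     RtoC d * Cprod (fun i => w + RtoC (INR i / INR r)) r * hgf lam w)%C) ->
  forall w k, regular lam w ->
  (Cprod (fun j => Cprod (fun i => w + RtoC (INR j) + v i) r) k * hgf lam (w + RtoC (INR k)) =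
   RtoC d ^ k * Cprod (fun j => Cprod (fun i => w + RtoC (INR j) + RtoC (INR i / INR r)) r) k *
       hgf lam w)%C.
Proof.
  intros Hr Er Hrec w k Hw. induction k as [|k IH].
  - simpl. rewrite Cplus_0_r. ring.
  - rewrite !Cprod_S. rewrite RtoC_INR_S at 1.
    assert (E := Hrec _ (regular_add lam r w k Er Hw)).
    rewrite Cplus_assoc.
    transitivity (Cprod (fun j => Cprod (fun i => w + RtoC (INR j) + v i) r) k *
      (Cprod (fun i => w + RtoC (INR k) + v i) r * hgf lam (w + RtoC (INR k) + 1)))%C; [ring|].
    rewrite E.
    transitivity (RtoC d * Cprod (fun i => w + RtoC (INR k) + RtoC (INR i / INR r)) r *
      (Cprod (fun j => Cprod (fun i => w + RtoC (INR j) + v i) r) k * hgf lam (w + RtoC (INR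
          k))))%C; [ring|].
    rewrite IH. cbn [Cpow]. ring.
Qed.

(** Arranged so that the numerator is the double product that [recurrence_iter] produces. *)
Lemma Cprod_gauss_seq (u : nat -> C) (m : nat) (w : C) (N : nat) :
  Cprod (fun i => gauss_seq (w + u i) N) m =
  (Cprod (fun j => Cprod (fun i => w + RtoC (INR j) + u i) m) (S N) /
    (RtoC (INR (fact N)) ^ m * Cexp ((RtoC (INR m) * w + Csum u m) * RtoC (ln (INR N)))))%C.
Proof.
  induction m as [|m IH].
  - cbn [Cprod Csum Cpow]. change (INR 0) with 0.
    replace ((0 * w + 0) * RtoC (ln (INR N)))%C with (RtoC 0) by ring. rewrite Cexp_0.
    rewrite Cprod_const. rewrite <- (Cprod_const 1 N).
    replace (Cprod (fun _ => RtoC 1) N) with (RtoC 1); [field|].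
    clear. induction N as [|N IH]; simpl; [reflexivity|rewrite <- IH; ring].
  - rewrite Cprod_S, IH. unfold gauss_seq.
    rewrite (Cprod_ext (fun j => Cprod (fun i => w + RtoC (INR j) + u i) (S m))%C
       (fun j => Cprod (fun i => w + RtoC (INR j) + u i) m * (w + u m + RtoC (INR j)))%C).
    2:{ intros j _. rewrite Cprod_S. ring. }
    rewrite Cprod_mult. cbn [Csum].
    replace ((RtoC (INR (S m)) * w + (Csum u m + u m)) * RtoC (ln (INR N)))%C
      with ((RtoC (INR m) * w + Csum u m) * RtoC (ln (INR N)) + (w + u m) * RtoC (ln (INR N)))%C
      by (rewrite RtoC_INR_S; ring).
    rewrite Cexp_plus. cbn [Cpow].
    field. repeat split; try apply Cexp_neq_0; try apply INR_fact_C_neq_0; apply Cpow_nz,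
        INR_fact_C_neq_0.
Qed.

Lemma pow_C_neq_0 (d : R) (k : nat) : 0 < d -> (RtoC d ^ k)%C <> 0.
Proof. intros Hd. apply Cpow_nz. intro E; apply RtoC_inj in E; lra. Qed.

(* With F_N(w) = f(w+N+1) d^(-N-1) N^sigma the recurrence reads f(w) = F_N(w) G_N(w),
   G_N being Gauss's finite approximation of the gamma product; F_N(w)/F_N(n0)
   tends to d^(w-n0) by the ratio asymptotics. *)
Lemma special_gpf_of_recurrence (p q s : nat) (a b x : R) (v : nat -> C) :
  (0 < p)%nat -> (0 < q)%nat -> 0 < x < 1 ->
  let lam := int_data p q s a b x in
  let r := (p + q + s)%nat in
  let d := exp (log_growth (INR p) (INR q) (INR r) x) in
  (forall w, regular lam w ->
    (Cprod (fun i => w + v i) r * hgf lam (w + 1) =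
     RtoC d * Cprod (fun i => w + RtoC (INR i / INR r)) r * hgf lam w)%C) ->
  exists A : R, 0 < A /\ special_gpf lam r A d v.
Proof.
  intros Hp Hq Hx lam r d Hrec.
  assert (Rp := lt_0_INR p Hp). assert (Rq := lt_0_INR q Hq). assert (Rs := pos_INR s).
  assert (Er : INR r = INR p + INR q + INR s) by (unfold r; rewrite !plus_INR; ring).
  assert (Rr : 0 < INR r) by lra.
  assert (Hr : (0 < r)%nat) by (unfold r; lia).
  assert (Hdr : dr lam = INR r) by reflexivity.
  assert (Hd : 0 < d) by apply exp_pos.
  set (f := hgf lam) in *.
  assert (Ratio : forall w, Cconv (fun n => f (RtoC (INR n) + w) / f (RtoC (INR n)))%C
     (Cexp (w * RtoC (log_growth (INR p) (INR q) (INR r) x)))).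
  { intros w. apply ratio_limit; lra. }
  set (L := log_growth (INR p) (INR q) (INR r) x) in *.
  destruct (hgf_nat_pos (INR p) (INR q) (INR r) a b x Rp Rq Rr Hx) as [N0 HN0].
  change (Data (INR p) (INR q) (INR r) a b x) with lam in HN0. fold f in HN0.
  (* At large [n] the recurrence expresses the product of the [n + v_i] through real numbers. *)
  assert (Hsig : Im (Csum v r) = 0).
  { apply Csum_real. exists (max 1 N0). intros n Hn.
    destruct (HN0 n ltac:(lia)) as [F [HF EF]]. destruct (HN0 (S n) ltac:(lia)) as [F' [HF' EF']].
    rewrite RtoC_INR_S in EF'.
    assert (Hw : regular lam (RtoC (INR n))).
    { apply regular_pos; [exact Rr|]. simpl. apply lt_0_INR; lia. }
    assert (E := Hrec _ Hw). rewrite EF, EF' in E.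
    destruct (Cprod_RtoC (fun i => INR n + INR i / INR r) r) as [y [Ey _]].
    rewrite (Cprod_ext (fun i => RtoC (INR n) + RtoC (INR i / INR r))%C (fun i => RtoC (INR n +
        INR i / INR r))) in E
      by (intros; rewrite RtoC_plus; reflexivity).
    rewrite Ey, <- !RtoC_mult in E.
    assert (HF'C : RtoC F' <> 0) by (intro E0; apply RtoC_inj in E0; lra).
    replace (Cprod (fun i => RtoC (INR n) + v i)%C r) with (RtoC (d * y * F / F')).
    - reflexivity.
    - rewrite RtoC_div by lra. rewrite <- E. field. exact HF'C. }
  assert (Hsig2 : exists y, Csum (fun i => RtoC (INR i / INR r)) r = RtoC y).
  { generalize r at 2. intros m. induction m as [|m [y Ey]]; simpl.
    - exists 0. reflexivity.
    - exists (y + INR m / INR r). rewrite Ey, RtoC_plus. reflexivity. }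
  destruct Hsig2 as [s2 Es2].
  (* The two Gauss products carry powers of [N] whose exponents contain [- sum v_i] and [- sum i/r];
     [N^sigma] makes up the difference. *)
  set (sigma := Re (Csum v r) - s2).
  assert (Esig : (Csum v r - Csum (fun i => RtoC (INR i / INR r)) r)%C = RtoC sigma).
  { rewrite Es2. apply C_ext; simpl; [reflexivity|]. unfold Im in Hsig. rewrite Hsig. ring. }
  set (Phi := fun (w : C) (N : nat) => (f (w + RtoC (INR (S N))) / RtoC d ^ S N * RtoC (exp
      (sigma * ln (INR N))))%C).
  set (G1 := fun (w : C) (N : nat) => Cprod (fun i => gauss_seq (w + v i) N) r).
  set (G2 := fun (w : C) (N : nat) => Cprod (fun i => gauss_seq (w + RtoC (INR i / INR r)) N) r).
  assert (HG2 : forall w N, regular lam w -> G2 w N <> 0).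
  { intros w N Hw. unfold G2. apply Cprod_neq_0. intros i _. unfold gauss_seq.
    unfold Cdiv. apply Cmult_neq_0.
    - apply Cprod_neq_0. intros j _.
    apply nonpos_int_neq, (regular_not_nonpos_int lam r); assumption.
    - intro E. assert (HX : (RtoC (INR (fact N)) * Cexp ((w + RtoC (INR i / INR r)) * RtoC (ln
        (INR N))))%C <> 0)
        by (apply Cmult_neq_0; [apply INR_fact_C_neq_0|apply Cexp_neq_0]).
      apply C1_nz. rewrite <- (Cinv_r _ HX), E. ring. }
  assert (Fact : forall w N, regular lam w -> f w = (Phi w N * (G1 w N / G2 w N))%C).
  { intros w N Hw. assert (E := recurrence_iter lam r d v Hr Hdr Hrec w (S N) Hw). fold f in E.
    assert (H2 := HG2 w N Hw). revert H2.
    unfold Phi, G1, G2. rewrite !Cprod_gauss_seq.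
    set (X1 := Cprod (fun j => Cprod (fun i => w + RtoC (INR j) + v i) r)%C (S N)) in *.
    set (X2 := Cprod (fun j => Cprod (fun i => w + RtoC (INR j) + RtoC (INR i / INR r)) r)%C (S
        N)) in *.
    intros H2.
    assert (HX2 : X2 <> 0) by (intro E0; apply H2; rewrite E0; unfold Cdiv; ring).
    replace ((RtoC (INR r) * w + Csum v r) * RtoC (ln (INR N)))%C
      with ((RtoC (INR r) * w + Csum (fun i => RtoC (INR i / INR r)) r) * RtoC (ln (INR N)) +
          RtoC sigma * RtoC (ln (INR N)))%C
      by (rewrite <- Esig; ring).
    rewrite Cexp_plus, <- RtoC_mult, Cexp_RtoC.
    set (ex := exp (sigma * ln (INR N))).
    assert (Hex : RtoC ex <> 0) by (intro E0; apply RtoC_inj in E0; generalize (exp_pos (sigma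
        * ln (INR N))); fold ex; lra).
    assert (HdC := pow_C_neq_0 d (S N) Hd).
    set (fN := f (w + RtoC (INR (S N)))%C) in *. set (dN := (RtoC d ^ S N)%C) in *.
    transitivity (X1 * fN / (dN * X2))%C.
    - rewrite E. field. split; assumption.
    - field. repeat split; try assumption; try apply Cexp_neq_0; apply Cpow_nz, INR_fact_C_neq_0. }
  set (G := fun w => (Cprod (fun i => Crgamma (w + v i)) r / Cprod (fun i => Crgamma (w + RtoC
      (INR i / INR r))) r)%C).
  assert (HGconv : forall w, regular lam w -> Cconv (fun N => G1 w N / G2 w N)%C (G w)).
  { intros w Hw. apply Cconv_mult.
    - apply (Cconv_Cprod (fun N i => gauss_seq (w + v i) N)). intros i _. apply gauss_seq_conv.
    - apply Cconv_inv.
      + apply Cprod_neq_0. intros i _.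
      apply Crgamma_neq_0, (regular_not_nonpos_int lam r); assumption.
      + apply (Cconv_Cprod (fun N i => gauss_seq (w + RtoC (INR i / INR r)) N)). intros i _.
      apply gauss_seq_conv. }
  destruct (eventually_not_nonpos_ints r v) as [N1 HN1].
  set (n0 := max 1 (max N0 N1)).
  assert (Hn0 : regular lam (RtoC (INR n0))).
  { apply regular_pos; [exact Rr|]. simpl. apply lt_0_INR. unfold n0; lia. }
  assert (HGn0 : G (RtoC (INR n0)) <> 0).
  { unfold G, Cdiv. apply Cmult_neq_0.
    - apply Cprod_neq_0. intros i Hi. apply Crgamma_neq_0, HN1; [unfold n0; lia|exact Hi].
    - rewrite <- Cprod_inv.
      + apply Cprod_neq_0. intros i _ E.
        assert (HX : Crgamma (RtoC (INR n0) + RtoC (INR i / INR r)) <> 0)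
          by (apply Crgamma_neq_0, (regular_not_nonpos_int lam r); assumption).
        apply C1_nz. rewrite <- (Cinv_r _ HX), E. ring.
      + intros i _. apply Crgamma_neq_0, (regular_not_nonpos_int lam r); assumption. }
  destruct (HN0 n0 ltac:(unfold n0; lia)) as [F0 [HF0 EF0]].
  assert (HF0C : RtoC F0 <> 0) by (intro E0; apply RtoC_inj in E0; lra).
  set (K0 := (RtoC F0 / G (RtoC (INR n0)))%C).
  (* The asymptotics concern ratios of values of [f] only. At the single point [n0], convergence of
     [Phi] is read off the factorization, since [f] and the limit of [G1 / G2] are nonzero there. *)
  assert (HPhi0 : Cconv (Phi (RtoC (INR n0))) K0).
  { apply Cconv_ext with (fun N => f (RtoC (INR n0)) / (G1 (RtoC (INR n0)) N / G2 (RtoC (INR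
      n0)) N))%C.
    - intros N. assert (E := Fact _ N Hn0).
      set (g := (G1 (RtoC (INR n0)) N / G2 (RtoC (INR n0)) N)%C) in *.
      assert (Hg : g <> 0).
      { intro E0. rewrite E0, EF0 in E. apply HF0C. rewrite E. ring. }
      rewrite E. field. exact Hg.
    - rewrite EF0. unfold K0, Cdiv at 1 3. apply Cconv_mult; [apply Cconv_const|].
      apply Cconv_inv; [exact HGn0|]. apply HGconv, Hn0. }
  (* [K0] is a limit of positive reals, and it is not 0 because [f] does not vanish at [n0]. *)
  assert (HK0 : exists k0, 0 < k0 /\ K0 = RtoC k0).
  { assert (HP : forall N, exists y, 0 < y /\ Phi (RtoC (INR n0)) N = RtoC y).
    { intros N. destruct (HN0 (n0 + S N)%nat ltac:(unfold n0; lia)) as [F [HF EF]].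
      exists (F / d ^ S N * exp (sigma * ln (INR N))). split.
      - apply Rmult_lt_0_compat; [apply Rdiv_lt_0_compat; [exact HF|apply pow_lt, Hd]|apply
          exp_pos].
      - unfold Phi. rewrite <- RtoC_INR_add, EF, RtoC_mult, RtoC_div, RtoC_pow; [reflexivity|].
        apply pow_nonzero; lra. }
    destruct HPhi0 as [C1 C2].
    assert (I0 : Im K0 = 0).
    { assert (H0 : is_lim_seq (fun N => Im (Phi (RtoC (INR n0)) N)) 0).
      { eapply is_lim_seq_ext; [|apply is_lim_seq_const]. intros N.
        destruct (HP N) as [y [_ Ey]]. rewrite Ey. reflexivity. }
      apply is_lim_seq_unique in C2, H0. rewrite C2 in H0. injection H0. auto. }
    assert (R0 : 0 <= Re K0).
    { assert (Rbar_le 0 (Re K0)); [|assumption].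
      apply is_lim_seq_le with (fun _ => 0) (fun N => Re (Phi (RtoC (INR n0)) N)); [|apply
          is_lim_seq_const|exact C1].
      intros N. destruct (HP N) as [y [Hy Ey]]. rewrite Ey. simpl. lra. }
    exists (Re K0). split.
    - destruct R0 as [R0|R0]; [exact R0|]. exfalso.
      assert (EK : K0 = 0) by (apply C_ext; simpl; [symmetry; exact R0|exact I0]).
      apply HF0C. replace (RtoC F0) with (K0 * G (RtoC (INR n0)))%C by (unfold K0; field; exact
          HGn0).
      rewrite EK. ring.
    - apply C_ext; [reflexivity|exact I0]. }
  destruct HK0 as [k0 [Hk0 EK0]].
  exists (k0 * exp (- (INR n0 * L))). split; [apply Rmult_lt_0_compat; [exact Hk0|apply exp_pos]|].
  intros w Hw _.
  change (hgf lam w) with (f w).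
  replace (ln d) with L by (unfold d; rewrite ln_exp; reflexivity).
  (* [Phi w N / Phi n0 N] is a ratio governed by [ratio_limit], along [n = N + n0 + 1] and with
     shift [w - n0]. *)
  assert (HPhi : Cconv (Phi w) (K0 * Cexp ((w - RtoC (INR n0)) * RtoC L))).
  { assert (HR := Cconv_incr_n _ _ (n0 + 1) (Ratio (w - RtoC (INR n0))%C)).
    eapply Cconv_ext; [|exact (Cconv_mult _ _ _ _ HPhi0 HR)].
    intros N. cbv beta.
    destruct (HN0 (N + (n0 + 1))%nat ltac:(unfold n0; lia)) as [F [HF EF]].
    assert (HFC : RtoC F <> 0) by (intro E0; apply RtoC_inj in E0; lra).
    unfold Phi. rewrite EF.
    replace (RtoC (INR n0) + RtoC (INR (S N)))%C with (RtoC (INR (N + (n0 + 1))))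
      by (rewrite !RtoC_INR_add, (RtoC_INR_S N); change (INR 1) with 1; ring).
    rewrite EF.
    replace (RtoC (INR (N + (n0 + 1))) + (w - RtoC (INR n0)))%C with (w + RtoC (INR (S N)))%C
      by (rewrite !RtoC_INR_add, (RtoC_INR_S N); change (INR 1) with 1; ring).
    field. split; [apply pow_C_neq_0, Hd|exact HFC]. }
  transitivity (K0 * Cexp ((w - RtoC (INR n0)) * RtoC L) * G w)%C.
  - apply Cconv_unique with (fun _ : nat => f w); [apply Cconv_const|].
    eapply Cconv_ext; [intros N; symmetry; apply (Fact w N Hw)|].
    apply Cconv_mult; [exact HPhi|apply HGconv, Hw].
  - rewrite EK0, RtoC_mult, <- Cexp_RtoC.
    replace ((w - RtoC (INR n0)) * RtoC L)%C with (w * RtoC L + RtoC (- (INR n0 * L)))%C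
      by (rewrite RtoC_opp, RtoC_mult; ring).
    rewrite Cexp_plus. unfold G, Cdiv, Cgamma.
    rewrite (Cprod_inv (fun i => Crgamma (w + RtoC (INR i / INR r)))%C).
    + ring.
    + intros i _. apply Crgamma_neq_0, (regular_not_nonpos_int lam r); assumption.
Qed.

(** The two products in the recurrence are monic of the same degree, so its coefficient tends to
    [d], while [f(n + 1) / f(n)] tends to [phi]. *)
Lemma growth_rate_unique (p q s : nat) (a b x : R) (v : nat -> C) (d : R) :
  (0 < p)%nat -> (0 < q)%nat -> 0 < x < 1 ->
  let lam := int_data p q s a b x in
  let r := (p + q + s)%nat in
  (forall w, regular lam w ->
    (Cprod (fun i => w + v i) r * hgf lam (w + 1) =
     RtoC d * Cprod (fun i => w + RtoC (INR i / INR r)) r * hgf lam w)%C) ->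
  d = exp (log_growth (INR p) (INR q) (INR r) x).
Proof.
  intros Hp Hq Hx lam r Hrec.
  assert (Rp := lt_0_INR p Hp). assert (Rq := lt_0_INR q Hq). assert (Rs := pos_INR s).
  assert (Er : INR r = INR p + INR q + INR s) by (unfold r; rewrite !plus_INR; ring).
  assert (Rr : 0 < INR r) by lra.
  assert (Ratio : Cconv (fun n => hgf lam (RtoC (INR n) + 1) / hgf lam (RtoC (INR n)))%C
     (Cexp (1 * RtoC (log_growth (INR p) (INR q) (INR r) x)))) by (apply ratio_limit; lra).
  rewrite Cmult_1_l, Cexp_RtoC in Ratio.
  destruct (hgf_nat_pos (INR p) (INR q) (INR r) a b x Rp Rq Rr Hx) as [N0 HN0].
  change (Data (INR p) (INR q) (INR r) a b x) with lam in HN0.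
  destruct (eventually_not_nonpos_ints r v) as [N1 HN1].
  destruct (Cprod_INR_ratio v r) as [Hv _].
  destruct (Cprod_INR_ratio (fun i => RtoC (INR i / INR r)) r) as [Hu _].
  apply RtoC_inj. eapply Cconv_unique; [|exact Ratio].
  replace (RtoC d) with (RtoC d * 1 * / 1)%C by field.
  eapply Cconv_ext_loc; [|apply Cconv_mult; [apply Cconv_mult; [apply Cconv_const|exact Hu]|
    apply Cconv_inv; [exact C1_nz|exact Hv]]].
  exists (max 1 (max N0 N1)). intros n Hn. cbv beta.
  destruct (HN0 n ltac:(lia)) as [F [HF EF]].
  assert (HFC : RtoC F <> 0) by (intro E0; apply RtoC_inj in E0; lra).
  assert (Hn0 : (0 < n)%nat) by lia.
  assert (Hw : regular lam (RtoC (INR n))) by (apply regular_pos; [exact Rr|apply lt_0_INR, Hn0]).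
  assert (E := Hrec _ Hw). rewrite EF in *.
  assert (HV : Cprod (fun i => RtoC (INR n) + v i)%C r <> 0).
  { apply Cprod_neq_0. intros i Hi E0. apply (HN1 n ltac:(lia) i Hi). exists 0%nat.
  rewrite E0; simpl; f_equal; ring. }
  rewrite !Cprod_INR_factor in E by exact Hn0. rewrite Cprod_INR_factor in HV by exact Hn0.
  assert (HnC := pow_C_neq_0 (INR n) r (lt_0_INR n Hn0)).
  set (X := Cprod (fun i => 1 + v i * RtoC (/ INR n))%C r) in *.
  assert (HX : X <> 0) by (intro E0; apply HV; rewrite E0; ring).
  set (Y := Cprod (fun i => 1 + RtoC (INR i / INR r) * RtoC (/ INR n))%C r) in *.
  transitivity (RtoC d * (RtoC (INR n) ^ r * Y) * RtoC F / (RtoC (INR n) ^ r * X * RtoC F))%C.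
  - field. repeat split; assumption.
  - rewrite <- E. field. repeat split; assumption.
Qed.

(** * Duality *)

Lemma pos_IZR_INR (z : Z) : 0 < IZR z -> exists n : nat, (0 < n)%nat /\ z = Z.of_nat n.
Proof.
  intros H. apply lt_IZR in H. exists (Z.to_nat z). split; [lia|]. rewrite Z2Nat.id; lia.
Qed.

Lemma A_solution_int_data (lam : data) :
  A_solution lam ->
  exists (p q s : nat) (a b x : R),
    (0 < p)%nat /\ (0 < q)%nat /\ (0 < s)%nat /\ Nat.Even s /\ 0 < x < 1 /\
    lam = int_data p q s a b x /\ rational_ratio_on_axis lam.
Proof.
  intros [[[Hp [Hq [Hr [Hpq Hx]]]] Hsol] [p [q [r [Ep [Eq [Er Hev]]]]]]].
  destruct lam as [lp lq lr a b x]. cbn [dp dq dr dx] in *. subst lp lq lr.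
  destruct (pos_IZR_INR p Hp) as [p' [Hp' ->]]. destruct (pos_IZR_INR q Hq) as [q' [Hq' ->]].
  rewrite <- plus_IZR in Hpq. apply lt_IZR in Hpq.
  set (s := Z.to_nat (r - Z.of_nat p' - Z.of_nat q')).
  assert (Es : r = Z.of_nat (p' + q' + s)) by (unfold s; lia).
  assert (Hs : (0 < s)%nat) by (unfold s; lia).
  assert (Hs2 : Nat.Even s).
  { destruct Hev as [k Hk]. exists (Z.to_nat k). unfold s. lia. }
  clearbody s. subst r.
  exists p', q', s, a, b, x. unfold int_data. rewrite !INR_IZR_INZ in *.
  repeat split; try assumption; try apply Hx.
  rewrite <- !INR_IZR_INZ in *. fold (int_data p' q' s a b x) in *.
  destruct Hsol as [HI|HII].
  - apply problem_I_on_axis with (p' + q' + s)%nat; [lia|reflexivity|exact HI].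
  - apply problem_II_on_axis; assumption.
Qed.

Lemma hgf_triangular (p q s : nat) (a b x : R) (w : C) :
  0 < x < 1 -> (forall w, m12 (contig_mat p q s a b x w) = 0) ->
  regular (int_data p q s a b x) w ->
  (contig_den p q s a b x w * hgf (int_data p q s a b x) (w + 1))%C =
  (Cpoch (RtoC (INR (p + q + s)) * w) (p + q + s) * m11 (contig_mat p q s a b x w)
    * hgf (int_data p q s a b x) w)%C.
Proof.
  intros Hx H0 Hw. assert (H := hgf_contiguity p q s a b x w Hx Hw). cbv zeta in H.
  rewrite H, H0. ring.
Qed.

(** With [w = 2/r - 1 - w'] one has [2 - r (w + 1) = r w'], so the shift from [w] to [w + 1] takes
    the dual from [w' + 1] to [w']. The diagonal entry is therefore the denominator of the dual
    ratio. *)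
Lemma dual_triangular (p q s : nat) (a b x : R) (w' : C) :
  0 < x < 1 -> (forall w, m12 (contig_mat p q s a b x w) = 0) ->
  (0 < p + q + s)%nat ->
  let lam' := dual (int_data p q s a b x) in
  let r := (p + q + s)%nat in
  regular lam' w' ->
  let w := (RtoC (2 / INR r - 1) - w')%C in
  ((- (1 - RtoC x)) ^ s * Cpoch (RtoC (INR r) * w - 1) r * hgf lam' w')%C =
  (m11 (contig_mat p q s a b x w) * hgf lam' (w' + 1))%C.
Proof.
  intros Hx H0 Hr lam' r Hw w. apply lt_0_INR in Hr. fold r in Hr.
  assert (HrC : RtoC (INR r) <> 0) by (intro E; apply RtoC_inj in E; lra).
  assert (H2 : RtoC (2 / INR r - 1) = (2 / RtoC (INR r) - 1)%C)
    by (rewrite RtoC_minus, RtoC_div by lra; reflexivity).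
  assert (E2 : RtoC 2 = (1 + 1)%C) by (rewrite <- RtoC_plus; f_equal; ring).
  assert (H := dual_carries_shift p q s (RtoC (INR p) * w + RtoC a) (RtoC (INR q) * w + RtoC b)
      (RtoC (INR r) * w) x Hx).
  fold r in H.
  assert (Ew : (2 - (RtoC (INR r) * w + RtoC (INR r)))%C = (RtoC (INR r) * w')%C).
  { unfold w. rewrite H2. field. exact HrC. }
  lapply H; [clear H; intros [H _]|rewrite Ew; exact Hw].
  fold (contig_mat p q s a b x w) in H.
  cbn [fst snd dual_hvec hvec] in H.
  change (m12 (shift_mat p q s (RtoC (INR p) * w + RtoC a) (RtoC (INR q) * w + RtoC b) (RtoC
      (INR r) * w) x))
    with (m12 (contig_mat p q s a b x w)) in H.
  change (m11 (shift_mat p q s (RtoC (INR p) * w + RtoC a) (RtoC (INR q) * w + RtoC b) (RtoC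
      (INR r) * w) x))
    with (m11 (contig_mat p q s a b x w)) in H.
  rewrite H0 in H.
  assert (Hl : forall z, hgf lam' z = hmom 0 (RtoC (INR p) * z + RtoC (1 - 2 * INR p / INR r - a))
     (RtoC (INR q) * z + RtoC (1 - 2 * INR q / INR r - b)) (RtoC (INR r) * z) x)
    by (intros z; exact (hgf_hmom (INR p) (INR q) (INR r) (1 - 2 * INR p / INR r - a) (1 - 2 *
        INR q / INR r - b) x z)).
  assert (Ha : forall u c : R, RtoC (1 - 2 * u / INR r - c) = (1 - 2 * RtoC u / RtoC (INR r) -
      RtoC c)%C).
  { intros u c. rewrite !RtoC_minus, RtoC_div, RtoC_mult by lra. reflexivity. }
  rewrite !Hl, !Ha.
  replace (1 - (RtoC (INR p) * w + RtoC a + RtoC (INR p)))%C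
    with (RtoC (INR p) * w' + (1 - 2 * RtoC (INR p) / RtoC (INR r) - RtoC a))%C in H
    by (unfold w; rewrite H2; field; exact HrC).
  replace (1 - (RtoC (INR q) * w + RtoC b + RtoC (INR q)))%C
    with (RtoC (INR q) * w' + (1 - 2 * RtoC (INR q) / RtoC (INR r) - RtoC b))%C in H
    by (unfold w; rewrite H2; field; exact HrC).
  rewrite Ew in H.
  replace (1 - (RtoC (INR p) * w + RtoC a))%C
    with (RtoC (INR p) * (w' + 1) + (1 - 2 * RtoC (INR p) / RtoC (INR r) - RtoC a))%C in H
    by (unfold w; rewrite H2; field; exact HrC).
  replace (1 - (RtoC (INR q) * w + RtoC b))%C
    with (RtoC (INR q) * (w' + 1) + (1 - 2 * RtoC (INR q) / RtoC (INR r) - RtoC b))%C in H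
    by (unfold w; rewrite H2; field; exact HrC).
  replace (2 - RtoC (INR r) * w)%C with (RtoC (INR r) * (w' + 1))%C in H
    by (unfold w; rewrite H2; field; exact HrC).
  assert (Hx0 : (1 - RtoC x)%C <> 0).
  { rewrite <- RtoC_minus. intro E; apply RtoC_inj in E; lra. }
  set (h := hmom 0 (RtoC (INR p) * w' + _) _ _ x) in *.
  set (h1 := hmom 0 (RtoC (INR p) * (w' + 1) + _) _ _ x) in *.
  transitivity ((- (1 - RtoC x)) ^ s * Cpoch (RtoC (INR r) * w - 1) r * ((1 - RtoC x) * h) / (1
      - RtoC x))%C.
  { field. exact Hx0. }
  rewrite H. field. exact Hx0.
Qed.

Lemma contig_den_large_neq_0 (p q s : nat) (a b x : R) :
  (0 < p)%nat -> (0 < q)%nat -> (0 < s)%nat -> 0 < x < 1 ->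
  eventually (fun n => contig_den p q s a b x (RtoC (INR n)) <> 0).
Proof.
  intros Hp Hq Hs Hx.
  assert (Rp := lt_0_INR p Hp). assert (Rq := lt_0_INR q Hq). assert (Rs := lt_0_INR s Hs).
  assert (Er : INR (p + q + s) = INR p + INR q + INR s) by (rewrite !plus_INR; ring).
  destruct (eventually_affine_ge (INR p) a Rp) as [N1 H1].
  destruct (eventually_affine_ge (INR q) b Rq) as [N2 H2].
  destruct (eventually_affine_ge (INR q + INR s) (- a) ltac:(lra)) as [N3 H3].
  destruct (eventually_affine_ge (INR p + INR s) (- b) ltac:(lra)) as [N4 H4].
  exists (max (max N1 N2) (max N3 N4)). intros n Hn.
  specialize (H1 n ltac:(lia)). specialize (H2 n ltac:(lia)). specialize (H3 n ltac:(lia)).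
  specialize (H4 n ltac:(lia)).
  generalize (pos_INR n); intro Hn0.
  unfold contig_den. cbv zeta. rewrite Er.
  rewrite <- !RtoC_mult, <- !RtoC_plus, <- !RtoC_minus.
  repeat apply Cmult_neq_0; try (apply Cpoch_pos_neq_0; nra).
  apply Cpow_nz. intro E; apply RtoC_inj in E; lra.
Qed.

Lemma dual_problem_II (p q s : nat) (a b x : R) :
  (0 < p)%nat -> (0 < q)%nat -> (0 < s)%nat -> 0 < x < 1 ->
  (forall w, m12 (contig_mat p q s a b x w) = 0) ->
  problem_II (dual (int_data p q s a b x)).
Proof.
  intros Hp Hq Hs Hx H0.
  set (r := (p + q + s)%nat). set (e := (2 / INR r - 1)%R).
  assert (Rp := lt_0_INR p Hp). assert (Rq := lt_0_INR q Hq). assert (Rs := lt_0_INR s Hs).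
  assert (Rr : 0 < INR r) by (unfold r; rewrite !plus_INR; lra).
  set (fP := fun w' => ((- (1 - RtoC x)) ^ s * Cpoch (RtoC (INR r) * (RtoC e - w') - 1) r)%C).
  set (fQ := fun w' => m11 (contig_mat p q s a b x (RtoC e - w')%C)).
  destruct (is_poly_contig_mat p q s a b x) as [Pm1 _].
  assert (PP : is_poly fP).
  { apply is_poly_mul; [apply is_poly_const|]. apply is_poly_Cpoch. poly. }
  assert (PQ : is_poly fQ).
  { apply (is_poly_comp (fun w => m11 (contig_mat p q s a b x w)) (fun w' => RtoC e - w')%C
      Pm1). poly. }
  destruct (is_poly_Cpoly_like _ PP) as [cP [NP HcP]].
  destruct (is_poly_Cpoly_like _ PQ) as [cQ [NQ HcQ]].
  exists cP, cQ, NP, NQ. split.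
  (* If [m11] vanished identically, so would [f(n + 1)] for large [n], where it is positive. *)
  - apply NNPP. intros HN.
    assert (HQ : forall w, m11 (contig_mat p q s a b x w) = 0).
    { intros w. replace w with (RtoC e - (RtoC e - w))%C by ring.
      change (fQ (RtoC e - w)%C = 0). rewrite HcQ. apply Cpoly_all_0.
      intros k Hk. apply NNPP. intros Hk0. apply HN. exists k. split; assumption. }
    destruct (hgf_nat_pos (INR p) (INR q) (INR r) a b x Rp Rq Rr Hx) as [N1 HN1].
    destruct (contig_den_large_neq_0 p q s a b x Hp Hq Hs Hx) as [N2 HN2].
    set (n := max 1 (max N1 N2)).
    assert (Hw : regular (int_data p q s a b x) (RtoC (INR n))).
    { apply regular_pos; [exact Rr|]. simpl. apply lt_0_INR. unfold n; lia. }
    assert (E := hgf_triangular p q s a b x _ Hx H0 Hw). rewrite HQ in E.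
    destruct (HN1 (S n) ltac:(unfold n; lia)) as [F [HF EF]]. rewrite RtoC_INR_S in EF.
    change (Data (INR p) (INR q) (INR r) a b x) with (int_data p q s a b x) in EF.
    rewrite EF in E.
    assert (HX : (contig_den p q s a b x (RtoC (INR n)) * RtoC F)%C <> 0).
    { apply Cmult_neq_0; [apply HN2; unfold n; lia|intro E0; apply RtoC_inj in E0; lra]. }
    apply HX. rewrite E. ring.
  - intros w' Hw _ Hf HQ. rewrite <- HcQ in *. rewrite <- HcP.
    assert (E := dual_triangular p q s a b x w' Hx H0 ltac:(lia) Hw). cbv zeta in E. fold r e in E.
    unfold fP. set (F1 := hgf (dual (int_data p q s a b x)) (w' + 1)) in *.
    set (F := hgf (dual (int_data p q s a b x)) w') in *.
    change (m11 (contig_mat p q s a b x (RtoC e - w')%C)) with (fQ w') in E.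
    transitivity (fQ w' * F1 / (fQ w' * F))%C.
    + field. split; assumption.
    + rewrite <- E. field. split; assumption.
Qed.

Lemma dual_involutive (lam : data) : 0 < dr lam -> dual (dual lam) = lam.
Proof.
  destruct lam as [p q r a b x]. unfold dual. cbn [dp dq dr da db dx]. intros Hr. f_equal; ring.
Qed.

Lemma A_solution_dual (lam : data) : A_solution lam -> A_solution (dual lam) /\ dual (dual lam)
    = lam.
Proof.
  intros H.
  destruct (A_solution_int_data lam H) as [p [q [s [a [b [x [Hp [Hq [Hs [_ [Hx [E Hrat]]]]]]]]]]]].
  destruct H as [[HD _] Hint]. split; [|apply dual_involutive, HD].
  split; [split; [exact HD|]|exact Hint].
  right. subst lam. apply dual_problem_II; try assumption.
  apply contig_m12_vanishes; assumption.
Qed.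

(** * Comparison of the two recurrences *)

(** The leading coefficient of [contig_den] as a polynomial in [w]. *)
Definition den_const (p q s : nat) (x : R) : R :=
  x ^ (p + q + s) * INR p ^ p * INR q ^ q * INR (q + s) ^ (q + s) * INR (p + s) ^ (p + s).

Lemma Cpoch_affine (k : nat) (c : R) (w : C) :
  (0 < k)%nat ->
  Cpoch (RtoC (INR k) * w + RtoC c) k =
  (RtoC (INR k) ^ k * Cprod (fun i => w + RtoC ((INR i + c) / INR k)) k)%C.
Proof.
  intros Hk. apply lt_0_INR in Hk.
  assert (RtoC (INR k) <> 0) by (intro E; apply RtoC_inj in E; lra).
  rewrite <- Cprod_scal. apply Cprod_ext. intros i _.
  rewrite RtoC_div, RtoC_plus by lra. field. assumption.
Qed.

(** The four Pochhammer symbols are the four products that define the complementary numbers, because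
    [D - A = (r - p) w - a] and [D - B = (r - q) w - b]. *)
Lemma contig_den_complementary (p q s : nat) (a b x : R) (v vstar : nat -> C) (w : C) :
  (0 < p)%nat -> (0 < q)%nat -> (0 < s)%nat -> 0 < x < 1 ->
  complementary_numbers p q (p + q + s) a b v vstar ->
  contig_den p q s a b x w =
  (RtoC (den_const p q s x) * (Cprod (fun i => w + v i) (p + q + s) * Cprod (fun i => w + vstar
      i) (p + q + s)))%C.
Proof.
  intros Hp Hq Hs Hx Hc. rewrite Hc.
  replace (p + q + s - p)%nat with (q + s)%nat by lia.
  replace (p + q + s - q)%nat with (p + s)%nat by lia.
  unfold contig_den, den_const. cbv zeta.
  replace (RtoC (INR (p + q + s)) * w - (RtoC (INR p) * w + RtoC a))%C
    with (RtoC (INR (q + s)) * w + RtoC (- a))%C by (rewrite !RtoC_INR_add, RtoC_opp; ring).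
  replace (RtoC (INR (p + q + s)) * w - (RtoC (INR q) * w + RtoC b))%C
    with (RtoC (INR (p + s)) * w + RtoC (- b))%C by (rewrite !RtoC_INR_add, RtoC_opp; ring).
  rewrite !Cpoch_affine by lia. rewrite !RtoC_mult, !RtoC_pow. unfold Rminus. ring.
Qed.

(** Squaring removes the root, and the exponent [p + q - r = - s] of [1 - x] moves that power to the
    right. Both sides are then constants of the two contiguity relations. *)
Lemma dilation_int_data (p q s : nat) (a b x : R) :
  (0 < p)%nat -> (0 < q)%nat -> (0 < s)%nat -> 0 < x < 1 ->
  0 < dilation (int_data p q s a b x) /\
  dilation (int_data p q s a b x) ^ 2 * den_const p q s x =
    INR (p + q + s) ^ (2 * (p + q + s)) * (1 - x) ^ s.
Proof.
  intros Hp Hq Hs Hx.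
  assert (Rp := lt_0_INR p Hp). assert (Rq := lt_0_INR q Hq). assert (Rs := lt_0_INR s Hs).
  assert (Er : INR (p + q + s) = INR p + INR q + INR s) by (rewrite !plus_INR; ring).
  unfold dilation, int_data. cbn [dp dq dr dx].
  replace (INR (p + q + s) - INR p) with (INR (q + s)) by (rewrite !plus_INR; ring).
  replace (INR (p + q + s) - INR q) with (INR (p + s)) by (rewrite !plus_INR; ring).
  replace (INR p + INR q - INR (p + q + s)) with (- INR s) by (rewrite Er; ring).
  rewrite Rpower_Ropp.
  rewrite !Rpower_pow by (try lra; rewrite !plus_INR; lra).
  set (r := (p + q + s)%nat) in *.
  assert (Rqs : 0 < INR (q + s)) by (rewrite plus_INR; lra).
  assert (Rps : 0 < INR (p + s)) by (rewrite plus_INR; lra).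
  assert (H1 : 0 < INR p ^ p) by (apply pow_lt; lra).
  assert (H2 : 0 < INR q ^ q) by (apply pow_lt; lra).
  assert (H3 : 0 < INR (q + s) ^ (q + s)) by (apply pow_lt; lra).
  assert (H4 : 0 < INR (p + s) ^ (p + s)) by (apply pow_lt; lra).
  assert (H5 : 0 < x ^ r) by (apply pow_lt; lra).
  assert (H6 : 0 < (1 - x) ^ s) by (apply pow_lt; lra).
  assert (H7 : 0 < INR r ^ r) by (apply pow_lt; lra).
  set (Q := INR p ^ p * INR q ^ q * INR (q + s) ^ (q + s) * INR (p + s) ^ (p + s) * x ^ r * /
      (1 - x) ^ s).
  assert (HQ : 0 < Q).
  { unfold Q. repeat apply Rmult_lt_0_compat; try assumption. apply Rinv_0_lt_compat, H6. }
  assert (Hs2 : sqrt Q ^ 2 = Q) by (rewrite <- Rsqr_pow2; apply Rsqr_sqrt; lra).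
  assert (HsQ : 0 < sqrt Q) by (apply sqrt_lt_R0, HQ).
  split; [apply Rdiv_lt_0_compat; assumption|].
  unfold Rdiv. rewrite Rpow_mult_distr, pow_inv, Hs2.
  replace (2 * r)%nat with (r + r)%nat by lia. rewrite pow_add.
  unfold den_const. fold r. unfold Q. field. lra.
Qed.

Lemma Cprod_opp_even_shift (r : nat) (u v : nat -> C) (z w : C) :
  (forall i, (i < r)%nat -> (z + u i = - (w + v i))%C) ->
  Cprod (fun i => z + u i)%C r = ((- (1)) ^ r * Cprod (fun i => w + v i) r)%C.
Proof.
  intros H. rewrite <- Cprod_scal. apply Cprod_ext. intros i Hi. rewrite H by exact Hi. ring.
Qed.

Lemma neg_pow_even (y : C) (s : nat) : Nat.Even s -> ((- y) ^ s)%C = (y ^ s)%C.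
Proof.
  intros [k ->]. induction k as [|k IH]; [reflexivity|].
  replace (2 * S k)%nat with (S (S (2 * k))) by lia. cbn [Cpow]. rewrite IH. ring.
Qed.

Lemma gpf_recurrence (p q s : nat) (a b x A d : R) (v : nat -> C) :
  (0 < p)%nat -> 0 < d ->
  special_gpf (int_data p q s a b x) (p + q + s) A d v ->
  forall w, regular (int_data p q s a b x) w ->
    (Cprod (fun i => w + v i) (p + q + s) * hgf (int_data p q s a b x) (w + 1) =
     RtoC d * Cprod (fun i => w + RtoC (INR i / INR (p + q + s))) (p + q + s) * hgf (int_data p
         q s a b x) w)%C.
Proof.
  intros Hp Hd HG w Hw.
  rewrite (gamma_product_ratio (int_data p q s a b x) (p + q + s) _ _ _ _ _ _ w eq_refl HG Hw).
  - rewrite Cexp_RtoC, exp_ln by exact Hd. reflexivity.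
  - intros i _. apply (regular_not_nonpos_int (int_data p q s a b x)); [lia|reflexivity|exact Hw].
Qed.

(** The denominator of the contiguity relation contains both products. Inserting the recurrence uses
    up the one over [v], and the diagonal entry must be the one over [vstar]. *)
Lemma m11_of_gpf (p q s : nat) (a b x d : R) (v vstar : nat -> C) :
  (0 < p)%nat -> (0 < q)%nat -> (0 < s)%nat -> 0 < x < 1 ->
  (forall w, m12 (contig_mat p q s a b x w) = 0) ->
  (forall w, regular (int_data p q s a b x) w ->
    (Cprod (fun i => w + v i) (p + q + s) * hgf (int_data p q s a b x) (w + 1) =
     RtoC d * Cprod (fun i => w + RtoC (INR i / INR (p + q + s))) (p + q + s) * hgf (int_data p
         q s a b x) w)%C) ->
  complementary_numbers p q (p + q + s) a b v vstar ->
  forall w, (RtoC (INR (p + q + s)) ^ (p + q + s) * m11 (contig_mat p q s a b x w))%C =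
    (RtoC (den_const p q s x) * RtoC d * Cprod (fun i => w + vstar i) (p + q + s))%C.
Proof.
  intros Hp Hq Hs Hx H0 Hrec Hc. set (r := (p + q + s)%nat) in *.
  assert (Rp := lt_0_INR p Hp). assert (Rq := lt_0_INR q Hq). assert (Rs := lt_0_INR s Hs).
  assert (Hr : (0 < r)%nat) by (unfold r; lia).
  assert (Rr : 0 < INR r) by (apply lt_0_INR, Hr).
  destruct (is_poly_contig_mat p q s a b x) as [Pm1 _].
  assert (Hz : forall w, (RtoC (INR r) ^ r * m11 (contig_mat p q s a b x w)
     - RtoC (den_const p q s x) * RtoC d * Cprod (fun i => w + vstar i) r)%C = 0).
  { apply (is_poly_eventually_0 (fun w => RtoC (INR r) ^ r * m11 (contig_mat p q s a b x w)
     - RtoC (den_const p q s x) * RtoC d * Cprod (fun i => w + vstar i) r)%C).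
    - apply is_poly_sub.
      + apply is_poly_mul; [apply is_poly_const|exact Pm1].
      + apply is_poly_mul; [apply is_poly_const|].
        apply (is_poly_Cprod (fun i w => w + vstar i)%C). intros; poly.
    - destruct (hgf_nat_pos (INR p) (INR q) (INR r) a b x Rp Rq Rr Hx) as [N1 HN1].
      destruct (eventually_not_nonpos_ints r v) as [N2 HN2].
      exists (max 1 (max N1 N2)). intros n Hn.
      assert (Hw : regular (int_data p q s a b x) (RtoC (INR n))).
      { apply regular_pos; [exact Rr|]. simpl. apply lt_0_INR. lia. }
      assert (E1 := hgf_triangular p q s a b x _ Hx H0 Hw).
      assert (E2 := Hrec _ Hw).
      rewrite (contig_den_complementary p q s a b x v vstar _ Hp Hq Hs Hx Hc) in E1. fold r in E1.
      destruct (HN1 n ltac:(lia)) as [F [HF EF]].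
      change (Data (INR p) (INR q) (INR r) a b x) with (int_data p q s a b x) in EF.
      rewrite EF in E1, E2.
      replace (Cpoch (RtoC (INR r) * RtoC (INR n)) r)
        with (RtoC (INR r) ^ r * Cprod (fun i => RtoC (INR n) + RtoC (INR i / INR r)) r)%C in E1.
      2:{ replace (RtoC (INR r) * RtoC (INR n))%C with (RtoC (INR r) * RtoC (INR n) + RtoC 0)%C
          by ring.
          rewrite Cpoch_affine by exact Hr. f_equal. apply Cprod_ext. intros i _.
          rewrite Rplus_0_r. reflexivity. }
      set (X := Cprod (fun i => RtoC (INR n) + v i)%C r) in *.
      set (Y := Cprod (fun i => RtoC (INR n) + RtoC (INR i / INR r))%C r) in *.
      set (Z := Cprod (fun i => RtoC (INR n) + vstar i)%C r) in *.
      set (F1 := hgf (int_data p q s a b x) (RtoC (INR n) + 1)) in *.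
      set (m := m11 (contig_mat p q s a b x (RtoC (INR n)))) in *.
      assert (HFC : RtoC F <> 0) by (intro E0; apply RtoC_inj in E0; lra).
      assert (HY : Y <> 0).
      { unfold Y. apply Cprod_neq_0. intros i _ E0.
        apply (regular_not_nonpos_int (int_data p q s a b x) r (RtoC (INR n)) i Hr eq_refl Hw).
        exists 0%nat. rewrite E0; simpl; f_equal; ring. }
      (* Obtained by substitution, without dividing by the product over [v]; afterwards only [Y] and
         [F] are cancelled, which are nonzero at large [n]. *)
      assert (E3 : (RtoC (den_const p q s x) * Z * (RtoC d * Y * RtoC F) = RtoC (INR r) ^ r * Y
          * m * RtoC F)%C).
      { rewrite <- E2, <- E1. ring. }
      transitivity ((RtoC (INR r) ^ r * Y * m * RtoC F - RtoC (den_const p q s x) * Z * (RtoC d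
          * Y * RtoC F)) / (Y * RtoC F))%C.
      + field. split; assumption.
      + rewrite E3. field. split; assumption. }
  intros w. specialize (Hz w).
  replace (RtoC (INR r) ^ r * m11 (contig_mat p q s a b x w))%C
    with ((RtoC (INR r) ^ r * m11 (contig_mat p q s a b x w)
     - RtoC (den_const p q s x) * RtoC d * Cprod (fun i => w + vstar i) r)
     + RtoC (den_const p q s x) * RtoC d * Cprod (fun i => w + vstar i) r)%C by ring.
  rewrite Hz. ring.
Qed.

Lemma dual_int_data (p q s : nat) (a b x : R) :
  dual (int_data p q s a b x) =
  int_data p q s (1 - 2 * INR p / INR (p + q + s) - a) (1 - 2 * INR q / INR (p + q + s) - b) x.
Proof. reflexivity. Qed.

Lemma dual_recurrence (p q s : nat) (a b x d : R) (v vstar : nat -> C) :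
  (0 < p)%nat -> (0 < q)%nat -> (0 < s)%nat -> Nat.Even s -> 0 < x < 1 -> 0 < d ->
  (forall w, m12 (contig_mat p q s a b x w) = 0) ->
  (forall w, regular (int_data p q s a b x) w ->
    (Cprod (fun i => w + v i) (p + q + s) * hgf (int_data p q s a b x) (w + 1) =
     RtoC d * Cprod (fun i => w + RtoC (INR i / INR (p + q + s))) (p + q + s) * hgf (int_data p
         q s a b x) w)%C) ->
  complementary_numbers p q (p + q + s) a b v vstar ->
  let lam' := dual (int_data p q s a b x) in
  let r := (p + q + s)%nat in
  forall w, regular lam' w ->
    (Cprod (fun i => w + (RtoC (1 - 2 / INR r) - vstar i)) r * hgf lam' (w + 1) =
     RtoC (dilation (int_data p q s a b x) ^ 2 / d) * Cprod (fun i => w + RtoC (INR i / INR r))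
         r * hgf lam' w)%C.
Proof.
  intros Hp Hq Hs Hev Hx Hd H0 Hrec Hc lam' r w' Hw'.
  assert (Rp := lt_0_INR p Hp). assert (Rq := lt_0_INR q Hq). assert (Rs := lt_0_INR s Hs).
  assert (Hr : (0 < r)%nat) by (unfold r; lia).
  assert (Rr : 0 < INR r) by (apply lt_0_INR, Hr).
  assert (HrC : RtoC (INR r) <> 0) by (intro E; apply RtoC_inj in E; lra).
  assert (E := dual_triangular p q s a b x w' Hx H0 Hr Hw'). cbv zeta in E. fold r lam' in E.
  assert (M := m11_of_gpf p q s a b x d v vstar Hp Hq Hs Hx H0 Hrec Hc (RtoC (2 / INR r - 1) -
      w')%C).
  fold r in M. fold r in Hc.
  set (w := (RtoC (2 / INR r - 1) - w')%C) in *.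
  destruct (dilation_int_data p q s a b x Hp Hq Hs Hx) as [Dpos D2]. fold r in D2.
  set (D := dilation (int_data p q s a b x)) in *.
  set (kap := den_const p q s x) in *.
  assert (Hkap : 0 < kap).
  { unfold kap, den_const.
  repeat apply Rmult_lt_0_compat; apply pow_lt; try lra; rewrite plus_INR; lra. }
  assert (HkapC : RtoC kap <> 0) by (intro E0; apply RtoC_inj in E0; lra).
  assert (HdC : RtoC d <> 0) by (intro E0; apply RtoC_inj in E0; lra).
  assert (Sgn : ((- (1)) ^ r)%C <> 0).
  { apply Cpow_nz. intro E0. apply C1_nz. replace (RtoC 1) with (- - (1))%C by ring.
  rewrite E0. ring. }
  (* [w + vstar_i] and [w' + (1 - 2/r - vstar_i)] are opposite; the resulting sign [(-1)^r] occurs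
     again in [EP] and cancels. *)
  rewrite (Cprod_opp_even_shift r vstar (fun i => RtoC (1 - 2 / INR r) - vstar i)%C w w') in M.
  2:{ intros i _. unfold w. rewrite !RtoC_minus. ring. }
  assert (EP : Cpoch (RtoC (INR r) * w - 1) r =
    ((- (1)) ^ r * (RtoC (INR r) ^ r * Cprod (fun i => w' + RtoC (INR i / INR r)) r))%C).
  { replace (RtoC (INR r) * w - 1)%C with (RtoC (INR r) * w + RtoC (-1))%C
      by (change (RtoC (-1)) with (RtoC (- (1))); rewrite RtoC_opp; ring).
    rewrite Cpoch_affine by exact Hr.
    (* [r w - 1 + i] is the opposite of [r w' + (r - 1 - i)]: the reflection permutes the factors
       [w' + i/r] by reversing their order. *)
    rewrite (Cprod_opp_even_shift r _ (fun i => RtoC (INR (r - 1 - i) / INR r)) w w').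
    - rewrite (Cprod_rev (fun i => w' + RtoC (INR i / INR r))%C). ring.
    - intros i Hi. unfold w. rewrite !minus_INR by lia. change (INR 1) with 1.
      replace ((INR r - 1 - INR i) / INR r) with (1 - (1 + INR i) / INR r) by (field; lra).
      replace ((INR i + -1) / INR r) with ((1 + INR i) / INR r - 2 / INR r) by (field; lra).
      rewrite !RtoC_minus. ring. }
  (* The parity of [s] removes the last sign, which leaves the positive rate [dilation^2 / d]. *)
  rewrite EP, neg_pow_even in E by exact Hev.
  set (X := Cprod (fun i => w' + (RtoC (1 - 2 / INR r) - vstar i))%C r) in *.
  set (Y := Cprod (fun i => w' + RtoC (INR i / INR r))%C r) in *.
  set (F := hgf lam' w') in *. set (F1 := hgf lam' (w' + 1)) in *.
  set (m := m11 (contig_mat p q s a b x w)) in *.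
  apply (f_equal RtoC) in D2.
  rewrite !RtoC_mult, !RtoC_pow, RtoC_minus in D2.
  replace (2 * r)%nat with (r + r)%nat in D2 by lia. rewrite Cpow_add_r in D2.
  rewrite RtoC_div, RtoC_pow by lra.
  assert (E1 : (RtoC kap * RtoC d * ((- (1)) ^ r * X) * F1 =
     RtoC (INR r) ^ r * ((1 - RtoC x) ^ s * ((- (1)) ^ r * (RtoC (INR r) ^ r * Y)) * F))%C).
  { rewrite E, <- M. ring. }
  transitivity (RtoC kap * RtoC d * ((- (1)) ^ r * X) * F1 / (RtoC kap * RtoC d * (- (1)) ^ r))%C.
  { field. repeat split; assumption. }
  rewrite E1.
  transitivity ((RtoC (INR r) ^ r * RtoC (INR r) ^ r * (1 - RtoC x) ^ s) * Y * F / (RtoC kap *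
      RtoC d))%C.
  { field. repeat split; assumption. }
  rewrite <- D2. field. split; assumption.
Qed.

Theorem theorem2p1 :
  (forall lam : data,
     A_solution lam -> A_solution (dual lam) /\ dual (dual lam) = lam)
  /\
  (forall (p q r : nat) (a b x : R),
     let lam := Data (INR p) (INR q) (INR r) a b x in
     A_solution lam ->
     forall (A d : R) (v vstar : nat -> C),
       0 < A -> 0 < d ->
       special_gpf lam r A d v ->
       complementary_numbers p q r a b v vstar ->
       d = dilation lam /\
       exists A' : R,
         0 < A' /\
         special_gpf (dual lam) r A' d
           (fun i => (RtoC (1 - 2 / INR r) - vstar i)%C)).
Proof.
  split; [exact A_solution_dual|].
  intros p q r a b x lam Hsol A d v vstar HA Hd HG Hc.
  destruct (A_solution_int_data lam Hsol)
    as [p' [q' [s [a' [b' [x' [Hp [Hq [Hs [Hev [Hx [E Hrat]]]]]]]]]]]].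
  unfold lam, int_data in E. injection E as Ep Eq Er Ea Eb Ex.
  apply INR_eq in Ep, Eq, Er. subst p' q' r a' b' x'.
  change lam with (int_data p q s a b x) in *. clear lam.
  assert (H0 := contig_m12_vanishes p q s a b x Hp Hq Hs Hx Hrat).
  assert (Hrec := gpf_recurrence p q s a b x A d v Hp Hd HG).
  assert (Hrec' := dual_recurrence p q s a b x d v vstar Hp Hq Hs Hev Hx Hd H0 Hrec Hc).
  cbv zeta in Hrec'. rewrite dual_int_data in *.
  set (D := dilation (int_data p q s a b x)) in *.
  assert (DP : 0 < D) by (apply dilation_int_data; assumption).
  (* [log_growth] depends only on [p], [q], [r] and [x], which duality fixes. Hence [d] and
     [D^2 / d] are the same number, and [d = D] as both are positive. *)
  assert (Ed := growth_rate_unique p q s a b x v d Hp Hq Hx Hrec).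
  assert (Ed' := growth_rate_unique p q s _ _ x _ _ Hp Hq Hx Hrec').
  assert (EdD : d = D).
  { rewrite <- Ed in Ed'. apply (f_equal (fun y => y * d)) in Ed'.
    replace (D ^ 2 / d * d) with (D ^ 2) in Ed' by (field; lra). nra. }
  split; [exact EdD|].
  replace (D ^ 2 / d) with d in Hrec' by (rewrite EdD; field; lra).
  rewrite Ed in Hrec'. rewrite Ed.
  exact (special_gpf_of_recurrence p q s _ _ x _ Hp Hq Hx Hrec').
Qed.
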